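(* Let $(\beta_{\boldsymbol{\mu},\boldsymbol{\nu}})_{\boldsymbol{\mu},\boldsymbol{\nu}}$ be a family of probability densities on $\mathbb{R}^N$, parameterized by their mean $\boldsymbol{\mu}\in\mathbb{R}^N$ and a vector of additional parameters $\boldsymbol{\nu}$, such that: (a) the family is translation-invariant; (b) for all $\boldsymbol{\nu}$, the density $\beta_{0,\boldsymbol{\nu}}$ has finite entropy and belongs to $\mathcal{S}(\mathbb{R}^N)$; (c) for all $\boldsymbol{\nu}$, $\mathcal{F}\beta_{0,\boldsymbol{\nu}}$ is nonzero everywhere. Let $r_{\boldsymbol{\nu}}(\boldsymbol{\mu})$ be a penalty over $\beta_{\boldsymbol{\mu},\boldsymbol{\nu}}$. Assume that, for all $\boldsymbol{\nu}$: (i) $r_{\boldsymbol{\nu}}\in\mathcal{S}'(\mathbb{R}^N)$; (ii) the quotient $\mathcal{F}r_{\boldsymbol{\nu}}/\mathcal{F}\check{\beta}_{0,\boldsymbol{\nu}}$ belongs to $\mathcal{S}'(\mathbb{R}^N)$. Then there exists a unique function $A_{\boldsymbol{\nu}}\in\mathcal{S}'(\mathbb{R}^N)$ such that $$r_{\boldsymbol{\nu}}(\boldsymbol{\mu})=\mathrm{KL}(\beta_{\boldsymbol{\mu},\boldsymbol{\nu}}\,\|\,\exp(A_{\boldsymbol{\nu}})).$$ Moreover, $$A_{\boldsymbol{\nu}}=-\mathrm{Ent}(\beta_{0,\boldsymbol{\nu}})\,\mathbf{1}-\mathcal{F}^{-1}\left[\frac{\mathcal{F}r_{\boldsymbol{\nu}}}{\mathcal{F}\check{\beta}_{0,\boldsymbol{\nu}}}\right],$$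 where $\check{\beta}_{0,\boldsymbol{\nu}}(\boldsymbol{\theta}):=\beta_{0,\boldsymbol{\nu}}(-\boldsymbol{\theta})$ and $\mathbf{1}$ is the constant function equal to $1$.
   Context: $\mathcal{S}(\mathbb{R}^N)$ is the Schwartz class and $\mathcal{S}'(\mathbb{R}^N)$ the space of tempered distributions. The Fourier transform is $(\mathcal{F}\varphi)(\xi)=\int_{\mathbb{R}^N}\varphi(x)e^{-i\xi x}\,dx$ on $\mathcal{S}(\mathbb{R}^N)$, extended by duality to $\mathcal{S}'(\mathbb{R}^N)$. The family is translation-invariant if $\beta_{\boldsymbol{\mu},\boldsymbol{\nu}}(\boldsymbol{\theta})=\beta_{0,\boldsymbol{\nu}}(\boldsymbol{\theta}-\boldsymbol{\mu})$ for all $\boldsymbol{\mu},\boldsymbol{\nu},\boldsymbol{\theta}$. The entropy is $\mathrm{Ent}(\beta)=-\int\ln(\beta(\boldsymbol{\theta}))\,\beta(\boldsymbol{\theta})\,d\boldsymbol{\theta}$. The KL-divergence is extended to functions $f$ and $g$ that are not necessarily probability densities by $\mathrm{KL}(f\|g)=\int\ln\left(\frac{f(\boldsymbol{\theta})}{g(\boldsymbol{\theta})}\right)f(\boldsymbol{\theta})\,d\boldsymbol{\theta}$. A penalty is a real-valued function $r_{\boldsymbol{\nu}}(\boldsymbol{\mu})$ of the parameters. The quotient $\mathcal{F}r_{\boldsymbol{\nu}}/\mathcal{F}\check{\beta}_{0,\boldsymbol{\nu}}$ is the product of the distribution $\mathcal{F}r_{\boldsymbol{\nu}}$ with the function $1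/\mathcal{F}\check{\beta}_{0,\boldsymbol{\nu}}$.
   Formalization: A is a tempered distribution, not always a function (r = -Ent(β₀) - β̌₀ gives a Dirac mass), and KL(β‖exp A) means -Ent(β) minus the pairing of A with β; the identity holds for almost every μ and at each continuity point of r, as r may be altered on a null set. *)

(* Defs.v *)
From HB Require Import structures.
From mathcomp Require Import all_boot all_order all_algebra.
From mathcomp Require Import all_classical all_reals all_analysis.
From mathcomp Require Import complex.

Set Implicit Arguments.
Unset Strict Implicit.
Unset Printing Implicit Defensive.

Import Order.TTheory GRing.Theory Num.Theory.
Import numFieldNormedType.Exports.

Local Open Scope classical_set_scope.
Local Open Scope ring_scope.
Local Open Scope complex_scope.

Section measurable_rV.
Variables (R : realType) (n : nat).

Definition rV_coord (i : 'I_n) (x : 'rV[R]_n) : measurableTypeR R := x 0 i.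

Let rV_set0 : g_sigma_preimage rV_coord set0.
Proof. exact: sigma_algebra0. Qed.

Let rV_setC A : g_sigma_preimage rV_coord A -> g_sigma_preimage rV_coord (~` A).
Proof. exact: sigma_algebraC. Qed.

Let rV_bigcup (F : _^nat) : (forall i, g_sigma_preimage rV_coord (F i)) ->
  g_sigma_preimage rV_coord (\bigcup_i (F i)).
Proof. exact: sigma_algebra_bigcup. Qed.

(* The product (Borel) sigma-algebra, generated by the coordinates. *)
HB.instance Definition _ := @isMeasurable.Build default_measure_display
  'rV[R]_n (g_sigma_preimage rV_coord) rV_set0 rV_setC rV_bigcup.

End measurable_rV.

Section measurable_fun_rV.
Variables (R : realType).

Lemma measurable_rV_coord n (i : 'I_n) :
  measurable_fun [set: 'rV[R]_n] (@rV_coord R n i).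
Proof.
move=> _ Y mY; rewrite setTI; apply: sub_sigma_algebra => /=.
rewrite -bigcup_seq/=; exists i => /=; first by rewrite mem_index_enum.
by exists Y => //; rewrite setTI.
Qed.

Lemma measurable_fun_rV d (T : measurableType d) n (f : T -> 'rV[R]_n) :
  (forall i, measurable_fun [set: T] (@rV_coord R n i \o f)) ->
  measurable_fun [set: T] f.
Proof.
move=> mf _ A mA; rewrite setTI.
suff : [set B | measurable (f @^-1` B)] A by [].
move: A mA; apply: smallest_sub.
  split => /=.
  - by rewrite preimage_set0; exact: measurable0.
  - by move=> A /= mA; rewrite setTD preimage_setC; exact: measurableC.
  - by move=> F /= mF; rewrite preimage_bigcup; exact: bigcupT_measurable.
rewrite -bigcup_seq => A/= [i _ [B mB <-]]; rewrite setTI.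
by rewrite -[X in measurable X]setTI -comp_preimage; exact: mf.
Qed.

End measurable_fun_rV.

Section lebesgue_rV_step.
Local Open Scope ereal_scope.
Variables (R : realType) (n : nat).

Definition rV_cons (p : measurableTypeR R * 'rV[R]_n) : 'rV[R]_n.+1 :=
  \row_(i < n.+1) (if unlift ord0 i is Some j then p.2 0%R j else p.1).

Definition rV_uncons (x : 'rV[R]_n.+1) : measurableTypeR R * 'rV[R]_n :=
  (x 0%R ord0, \row_j x 0%R (lift ord0 j)).

Lemma rV_consK : cancel rV_cons rV_uncons.
Proof.
move=> [a v] /=; rewrite /rV_uncons mxE unlift_none; congr pair.
by apply/rowP => j; rewrite !mxE liftK.
Qed.

Lemma rV_unconsK : cancel rV_uncons rV_cons.
Proof.
move=> x; apply/rowP => i; rewrite mxE.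
by case: unliftP => [j ->|->] //=; rewrite mxE.
Qed.

Lemma measurable_rV_cons : measurable_fun setT rV_cons.
Proof.
apply: measurable_fun_rV => i; have [j ->|->] := unliftP ord0 i.
  rewrite (_ : _ \o _ = @rV_coord R n j \o snd); last first.
    by apply/funext => p /=; rewrite /rV_coord mxE liftK.
  by apply: measurableT_comp; [exact: measurable_rV_coord|exact: measurable_snd].
rewrite (_ : _ \o _ = fst); first exact: measurable_fst.
by apply/funext => p /=; rewrite /rV_coord mxE unlift_none.
Qed.

Lemma measurable_rV_uncons : measurable_fun setT rV_uncons.
Proof.
apply: measurable_fun_pair; first exact: measurable_rV_coord.
apply: measurable_fun_rV => j.
rewrite (_ : _ \o _ = @rV_coord R n.+1 (lift ord0 j)).
  exact: measurable_rV_coord.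
by apply/funext => x /=; rewrite /rV_coord mxE.
Qed.

Variable mu : {sigma_finite_measure set 'rV[R]_n -> \bar R}.

Definition lebesgue_rV_step : set 'rV[R]_n.+1 -> \bar R :=
  pushforward (@lebesgue_measure R \x mu) rV_cons.

Let step0 : lebesgue_rV_step set0 = 0.
Proof. by rewrite /lebesgue_rV_step /pushforward preimage_set0 measure0. Qed.

Let step_ge0 A : 0 <= lebesgue_rV_step A.
Proof. by apply: integral_ge0 => x _; exact: measure_ge0. Qed.

Let step_sigma_additive : semi_sigma_additive lebesgue_rV_step.
Proof.
move=> F mF tF mUF; rewrite /lebesgue_rV_step /pushforward preimage_bigcup.
apply: measure_semi_sigma_additive.
- by move=> k; rewrite -[X in measurable X]setTI; exact: measurable_rV_cons.
- apply/trivIsetP => /= i j _ _ ij; rewrite -preimage_setI.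
  by move/trivIsetP : tF => /(_ _ _ _ _ ij) ->//; rewrite preimage_set0.
- rewrite -preimage_bigcup -[X in measurable X]setTI.
  exact: measurable_rV_cons.
Qed.

HB.instance Definition _ := isMeasure.Build _ _ _
  lebesgue_rV_step step0 step_ge0 step_sigma_additive.

Let step_sigma_finite : sigma_finite setT lebesgue_rV_step.
Proof.
have /sigma_finiteP[F [TF ndF Foo]] := sigma_finiteT (@lebesgue_measure R).
have /sigma_finiteP[G [TG ndG Goo]] := sigma_finiteT mu.
exists (fun k => rV_uncons @^-1` (F k `*` G k)).
  apply/esym; rewrite -subTset => x _.
  have [k _ Fk] : (\bigcup_k F k) (rV_uncons x).1 by rewrite -TF.
  have [l _ Gl] : (\bigcup_k G k) (rV_uncons x).2 by rewrite -TG.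
  exists (maxn k l) => //; split.
    by move: Fk; exact/subsetPset/ndF/leq_maxl.
  by move: Gl; exact/subsetPset/ndG/leq_maxr.
move=> k; have [mFk Fk] := Foo k; have [mGk Gk] := Goo k; split.
  rewrite -[X in measurable X]setTI; apply: measurable_rV_uncons => //.
  exact: measurableX.
rewrite /lebesgue_rV_step /pushforward -comp_preimage.
rewrite (_ : _ \o _ = id); last by apply/funext => p /=; rewrite rV_consK.
by rewrite preimage_id product_measure1E// lte_mul_pinfty// ge0_fin_numE.
Qed.

HB.instance Definition _ := @Measure_isSigmaFinite.Build _ _ _
  lebesgue_rV_step step_sigma_finite.

End lebesgue_rV_step.

(* R^0 is a point, of mass 1; R^(n+1) is identified with R * R^n. *)
Fixpoint lebesgue_rV (R : realType) (n : nat) :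
    {sigma_finite_measure set 'rV[R]_n -> \bar R} :=
  if n is m.+1 then lebesgue_rV_step (lebesgue_rV R m)
  else \d_(0 : 'rV[R]_0).

Section schwartz_class.
Variables (R : realType) (n : nat).
Implicit Types (f g : 'rV[R]_n -> R[i]) (h : 'rV[R]_n -> R) (a s : seq 'I_n).

(* A multi-index is given by the list of its directions, with repetitions, so *)
(* that its order is the size of the list.                                    *)
Definition monomial a (x : 'rV[R]_n) : R := \prod_(i <- a) x 0 i.

Definition pderiv s h : 'rV[R]_n -> R :=
  foldr (fun i k => 'D_(delta_mx 0 i) k) h s.

Definition cpderiv s f (x : 'rV[R]_n) : R[i] :=
  pderiv s (@complex.Re R \o f) x +i* pderiv s (@complex.Im R \o f) x.

Definition smooth h := forall s, continuous (pderiv s h) /\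
  forall i x, derivable (pderiv s h) x (delta_mx 0 i).

Definition csmooth f := smooth (@complex.Re R \o f) /\ smooth (@complex.Im R \o f).

Definition is_schwartz f := csmooth f /\
  forall a s, exists M : R, forall x,
    `|(monomial a x)%:C * cpderiv s f x| <= M%:C.

Lemma pderivD s h1 h2 : smooth h1 -> smooth h2 ->
  pderiv s (h1 \+ h2) = pderiv s h1 \+ pderiv s h2.
Proof.
move=> s1 s2; elim: s => //= i s ->; apply/funext => x.
by rewrite deriveD//; [exact: (s1 s).2|exact: (s2 s).2].
Qed.

Lemma pderivZ s c h : smooth h ->
  pderiv s (fun x => c * h x) = (fun x => c * pderiv s h x).
Proof.
move=> sh; elim: s => //= i s ->; apply/funext => x.
by rewrite (@deriveZ _ _ _ (pderiv s h) c x)//; exact: (sh s).2.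
Qed.

Lemma smoothD h1 h2 : smooth h1 -> smooth h2 -> smooth (h1 \+ h2).
Proof.
move=> s1 s2 s; rewrite pderivD//; split=> [x|i x].
  by apply: continuousD; [exact: (s1 s).1|exact: (s2 s).1].
by apply: derivableD; [exact: (s1 s).2|exact: (s2 s).2].
Qed.

Lemma smoothZ c h : smooth h -> smooth (fun x => c * h x).
Proof.
move=> sh s; rewrite pderivZ//; split=> [x|i x].
  by apply: continuousM; [exact: cst_continuous|exact: (sh s).1].
by apply: (@derivableZ _ _ _ (pderiv s h)); exact: (sh s).2.
Qed.

Lemma pderiv0 s : pderiv s (fun=> 0) = (fun=> 0).
Proof. by elim: s => //= i s ->; apply/funext => x; rewrite derive_cst. Qed.

Lemma smooth0 : smooth (fun=> 0).
Proof.
by move=> s; rewrite pderiv0; split=> [x|i x];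
  [exact: cst_continuous|exact: derivable_cst].
Qed.

Lemma Re_compD f g : @complex.Re R \o (f + g) = (@complex.Re R \o f) \+ (@complex.Re R \o g).
Proof.
by apply/funext => x; rewrite /= /GRing.add /=; case: (f x); case: (g x).
Qed.

Lemma Im_compD f g : @complex.Im R \o (f + g) = (@complex.Im R \o f) \+ (@complex.Im R \o g).
Proof.
by apply/funext => x; rewrite /= /GRing.add /=; case: (f x); case: (g x).
Qed.

Lemma Re_compZ c f : @complex.Re R \o (c *: f) = (fun x => complex.Re c *
  complex.Re (f x)) \+ (fun x => - complex.Im c * complex.Im (f x)).
Proof.
apply/funext => x /=; rewrite fctE /GRing.scale /=.
by case: c (f x) => [c d] [u v] /=; rewrite mulNr.
Qed.

Lemma Im_compZ c f : @complex.Im R \o (c *: f) = (fun x => complex.Re c *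
  complex.Im (f x)) \+ (fun x => complex.Im c * complex.Re (f x)).
Proof.
apply/funext => x /=; rewrite fctE /GRing.scale /=.
by case: c (f x) => [c d] [u v] /=; rewrite [d * u]mulrC.
Qed.

Lemma csmoothD f g : csmooth f -> csmooth g -> csmooth (f + g).
Proof.
by move=> [f1 f2] [g1 g2]; split; [rewrite Re_compD|rewrite Im_compD]; exact: smoothD.
Qed.

Lemma csmoothZ c f : csmooth f -> csmooth (c *: f).
Proof.
by move=> [f1 f2]; split; [rewrite Re_compZ|rewrite Im_compZ];
  apply: smoothD; exact: smoothZ.
Qed.

Lemma cpderivD s f g : csmooth f -> csmooth g ->
  cpderiv s (f + g) = cpderiv s f + cpderiv s g.
Proof.
move=> [f1 f2] [g1 g2]; apply/funext => x.
by rewrite /cpderiv Re_compD Im_compD !pderivD.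
Qed.

Lemma cpderivZ s c f : csmooth f -> cpderiv s (c *: f) = c *: cpderiv s f.
Proof.
move=> [f1 f2]; apply/funext => x; rewrite /cpderiv Re_compZ Im_compZ.
rewrite !pderivD; do ?exact: smoothZ.
rewrite (@pderivZ s _ (@complex.Re R \o f))// (@pderivZ s _ (@complex.Im R \o f))//.
rewrite (@pderivZ s _ (@complex.Re R \o f))// (@pderivZ s _ (@complex.Im R \o f))//.
transitivity (c * (pderiv s (@complex.Re R \o f) x +i*
  pderiv s (@complex.Im R \o f) x)) => //.
case: c => c d; rewrite [RHS]/GRing.mul [RHS]/= [LHS]/=.
by rewrite mulNr.
Qed.

Lemma is_schwartz0 : is_schwartz 0.
Proof.
split; first by split; exact: smooth0.
move=> a s; exists 0 => x.
suff -> : cpderiv s 0 x = 0 by rewrite mulr0 normr0.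
apply/eqP; rewrite eq_complex; apply/andP; split; apply/eqP.
  exact: (congr1 (fun k => k x) (pderiv0 s)).
exact: (congr1 (fun k => k x) (pderiv0 s)).
Qed.

Lemma is_schwartzD f g : is_schwartz f -> is_schwartz g -> is_schwartz (f + g).
Proof.
move=> [sf bf] [sg bg]; split; first exact: csmoothD.
move=> a s; have [M fM] := bf a s; have [L gL] := bg a s.
exists (M + L) => x; rewrite cpderivD// fctE mulrDr rmorphD/=.
by rewrite (le_trans (ler_normD _ _))// lerD.
Qed.

Lemma is_schwartzZ c f : is_schwartz f -> is_schwartz (c *: f).
Proof.
move=> [sf bf]; split; first exact: csmoothZ.
move=> a s; have [M fM] := bf a s.
exists (complex.Re `|c| * M) => x; rewrite cpderivZ// rmorphM/=.
rewrite (_ : (complex.Re `|c|)%:C = `|c|); last by rewrite normc_def.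
rewrite (_ : (c *: cpderiv s f) x = c * cpderiv s f x)//.
by rewrite mulrCA normrM ler_wpM2l.
Qed.

Definition schwartz_pred : {pred 'rV[R]_n -> R[i]} :=
  mem [set f | is_schwartz f].

Lemma schwartz_submod_closed : submod_closed schwartz_pred.
Proof.
split; first by rewrite inE; exact: is_schwartz0.
move=> c f g; rewrite !inE => sf sg.
by apply: is_schwartzD => //; exact: is_schwartzZ.
Qed.

HB.instance Definition _ := GRing.isSubmodClosed.Build _ _ schwartz_pred
  schwartz_submod_closed.

Record schwartz := Schwartz {
  schwartz_val :> 'rV[R]_n -> R[i];
  schwartz_valP : schwartz_val \in schwartz_pred }.

HB.instance Definition _ := [isSub for schwartz_val].
HB.instance Definition _ := [Choice of schwartz by <:].
HB.instance Definition _ := [SubChoice_isSubLmodule of schwartz by <:].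

End schwartz_class.

Section schwartz_topology.
Variables (R : realType) (n : nat).
Implicit Types (phi psi : schwartz R n) (k : nat) (e : R).

Lemma schwartzP phi : is_schwartz phi.
Proof. by have := schwartz_valP phi; rewrite inE. Qed.

(* The topology of the family of seminorms                                    *)
(* phi |-> sup_x |x^a (d^s phi)(x)| with a and s ranging over multi-indices.  *)
Definition schwartz_ball phi k e : set (schwartz R n) :=
  [set psi | forall a s, (size a <= k)%N -> (size s <= k)%N -> forall x,
    `|(monomial a x)%:C * cpderiv s (psi - phi) x| <= e%:C].

Definition schwartz_nbhs phi : set_system (schwartz R n) :=
  [set A | exists k e, 0 < e /\ schwartz_ball phi k e `<=` A].

Lemma schwartz_ball_refl phi k e : 0 < e -> schwartz_ball phi k e phi.
Proof.
move=> e0 a s _ _ x; rewrite subrr.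
rewrite (_ : cpderiv s _ x = 0); first by rewrite mulr0 normr0 lecR ltW.
have := @cpderivZ R n s 0 phi (schwartzP phi).1.
rewrite scale0r => /(congr1 (fun g => g x)) ->.
by rewrite (_ : (0 *: cpderiv s phi) x = 0 * cpderiv s phi x)// mul0r.
Qed.

Lemma schwartz_ball_trans phi psi rho k e1 e2 : schwartz_ball phi k e1 psi ->
  schwartz_ball psi k e2 rho -> schwartz_ball phi k (e1 + e2) rho.
Proof.
move=> b1 b2 a s ak sk x.
have -> : rho - phi = (psi - phi) + (rho - psi).
  by rewrite [RHS]addrC addrA subrK.
have -> : cpderiv s (psi - phi + (rho - psi)) x =
    cpderiv s (psi - phi) x + cpderiv s (rho - psi) x.
  exact: (congr1 (fun g => g x)
    (cpderivD s (schwartzP (psi - phi)).1 (schwartzP (rho - psi)).1)).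
rewrite mulrDr rmorphD/= (le_trans (ler_normD _ _))// lerD//.
  exact: b1.
exact: b2.
Qed.

Lemma schwartz_ball_le phi k1 k2 e1 e2 : (k1 <= k2)%N -> e2 <= e1 ->
  schwartz_ball phi k2 e2 `<=` schwartz_ball phi k1 e1.
Proof.
move=> k12 e21 psi b a s ak sk x.
by rewrite (le_trans (b a s _ _ x)) ?lecR// (leq_trans _ k12).
Qed.

HB.instance Definition _ := hasNbhs.Build (schwartz R n) schwartz_nbhs.

Let schwartz_nbhs_filter phi : ProperFilter (nbhs phi).
Proof.
apply: Build_ProperFilter_ex.
  by move=> A [k [e [e0 /(_ phi (@schwartz_ball_refl phi k e e0)) Ap]]]; exists phi.
split.
- by exists 0%N, 1; split.
- move=> A B [k1 [e1 [e10 kA]]] [k2 [e2 [e20 kB]]].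
  exists (maxn k1 k2), (Num.min e1 e2); split; first by rewrite lt_min e10.
  move=> psi bpsi; split; [apply: kA|apply: kB];
    apply: schwartz_ball_le bpsi; rewrite ?leq_maxl ?leq_maxr//.
    by rewrite ge_min lexx.
  by rewrite ge_min lexx orbT.
- by move=> A B AB [k [e [e0 kA]]]; exists k, e; split => //; exact: subset_trans AB.
Qed.

Let schwartz_nbhs_singleton phi (A : set (schwartz R n)) : nbhs phi A -> A phi.
Proof. by move=> [k [e [e0]]]; apply; exact: schwartz_ball_refl. Qed.

Let schwartz_nbhs_nbhs phi (A : set (schwartz R n)) :
  nbhs phi A -> nbhs phi (nbhs^~ A).
Proof.
move=> [k [e [e0 kA]]]; exists k, (e / 2); split; first by rewrite divr_gt0.
move=> psi bpsi; exists k, (e / 2); split; first by rewrite divr_gt0.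
move=> rho brho; apply: kA; rewrite [e]splitr.
exact: schwartz_ball_trans brho.
Qed.

HB.instance Definition _ := Nbhs_isNbhsTopological.Build (schwartz R n)
  schwartz_nbhs_filter schwartz_nbhs_singleton schwartz_nbhs_nbhs.

End schwartz_topology.

Section distributions.
Variables (R : realType) (n : nat).
Local Notation V := 'rV[R]_n.
Local Notation lebesgue := (lebesgue_rV R n).
Implicit Types (phi psi : schwartz R n) (u : schwartz R n -> R[i]^o).

Definition tempered u := linear u /\ continuous u.

(* Element of the Schwartz class with underlying function f; the default      *)
(* value is irrelevant for f in the Schwartz class.                           *)
Definition to_schwartz (f : V -> R[i]) : schwartz R n := insubd 0 f.

Definition cintegral (f : V -> R[i]) : R[i] :=
  (\int[lebesgue]_x complex.Re (f x))%R +i* (\int[lebesgue]_x complex.Im (f x))%R.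

Definition dotp (x y : V) : R := \sum_(i < n) x 0 i * y 0 i.

Definition expi (t : R) : R[i] := cos t +i* sin t.

Definition fourier (f : V -> R[i]) (xi : V) : R[i] :=
  cintegral (fun x => f x * expi (- dotp xi x)).

Definition inv_fourier (f : V -> R[i]) (x : V) : R[i] :=
  ((2 * pi) ^- n)%:C * cintegral (fun xi => f xi * expi (dotp xi x)).

(* The default value of to_schwartz plays no role here, since fourier and     *)
(* inv_fourier map the Schwartz class to itself.                              *)
Definition Fourier u : schwartz R n -> R[i]^o :=
  fun phi => u (to_schwartz (fourier phi)).

Definition inv_Fourier u : schwartz R n -> R[i]^o :=
  fun phi => u (to_schwartz (inv_fourier phi)).

Definition test_function phi : Prop := compact (closure [set x | phi x != 0]).

Definition locally_integrable_rV (f : V -> R) : Prop :=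
  measurable_fun setT f /\
  forall K : set V, compact K -> lebesgue.-integrable K (EFin \o f).

(* The (real-valued) function f, seen as a distribution, is the restriction   *)
(* of u to test functions, which are dense in the Schwartz class.             *)
Definition is_function (f : V -> R) u : Prop := locally_integrable_rV f /\
  forall phi, test_function phi -> u phi = cintegral (fun x => (f x)%:C * phi x).

(* The product of the tempered distribution u with a smooth function h is a   *)
(* priori only a distribution, defined on test functions by                   *)
(* phi |-> u (h * phi); is_product h u v says that it is the restriction of v *)
(* to test functions.                                                         *)
Definition is_product (h : V -> R[i]) u v : Prop :=
  forall phi, test_function phi -> v phi = u (to_schwartz (fun x => h x * phi x)).

Definition one_dist : schwartz R n -> R[i]^o := fun phi => cintegral phi.

End distributions.

Section densities.
Variables (R : realType) (n : nat).
Local Notation V := 'rV[R]_n.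
Local Notation lebesgue := (lebesgue_rV R n).
Implicit Types f g : V -> R.

Definition is_density f : Prop :=
  [/\ measurable_fun setT f, forall x, 0 <= f x &
      (\int[lebesgue]_x (f x)%:E = 1)%E].

Definition has_mean f (m : V) : Prop := forall i,
  lebesgue.-integrable setT (fun x => (x 0 i * f x)%:E) /\
  (\int[lebesgue]_x (x 0 i * f x))%R = m 0 i.

(* ln 0 = 0 in MathComp-Analysis, whence the usual 0 ln 0 = 0. *)
Definition finite_entropy f : Prop :=
  lebesgue.-integrable setT (fun x => (ln (f x) * f x)%:E).

Definition Ent f : R := - (\int[lebesgue]_x (ln (f x) * f x))%R.

Definition check f : V -> R := fun x => f (- x).

Definition KL f g : R := (\int[lebesgue]_x (ln (f x / g x) * f x))%R.

Definition ofreal f : V -> R[i] := fun x => (f x)%:C.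

(* KL f (exp A) = \int ln f * f - \int A * f for a tempered distribution A     *)
(* that need not be a function: the second integral is the pairing of A with  *)
(* f. When A is a function, this is the integral KL; see KL_expE.             *)
Definition KL_exp f (A : schwartz R n -> R[i]^o) : R[i] :=
  (\int[lebesgue]_x (ln (f x) * f x))%R%:C - A (to_schwartz (ofreal f)).

Lemma KL_expE f (a : V -> R) (A : schwartz R n -> R[i]^o) :
  is_density f -> finite_entropy f ->
  lebesgue.-integrable setT (fun x => (a x * f x)%:E) ->
  A (to_schwartz (ofreal f)) = cintegral (fun x => (a x)%:C * (f x)%:C) ->
  KL_exp f A = (KL f (expR \o a))%:C.
Proof.
move=> [_ f0 _] fe iaf AE; rewrite /KL_exp AE.
have -> : cintegral (fun x => (a x)%:C * (f x)%:C) =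
    (\int[lebesgue]_x (a x * f x))%R%:C.
  rewrite /cintegral; congr (_ +i* _).
    by apply: eq_Rintegral => x _ /=; rewrite mul0r subr0.
  rewrite -[RHS](@Rintegral_set0 _ V R lebesgue (cst 0)).
  rewrite /Rintegral !integral0_eq// => x _ /=.
  by rewrite mul0r mulr0 addr0.
rewrite -rmorphB/= -RintegralB//; congr (_%:C).
apply: eq_Rintegral => x _ /=.
have [->|fx0] := eqVneq (f x) 0; first by rewrite !mulr0 subr0.
have fx : 0 < f x by rewrite lt_def fx0 f0.
by rewrite lnM ?posrE ?invr_gt0 ?expR_gt0// lnV ?posrE ?expR_gt0// expRK mulrBl.
Qed.

End densities.

(* Main.v *)
(* Write b for beta_(0,nu), T_mu b for its translate by mu, and B for the      *)

(* Write [b] for the density of mean 0, [f] for its complex-valued version and [T mu] for its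
   translate. By [KL_exp_translate] the equation to solve reads A(T mu) = - Ent b - r(mu). Since mu
   |-> A(T mu) is the convolution of A with the reflected density, this is a deconvolution problem.
   The constant is absorbed by [one_dist], every translate having integral 1. On the Fourier side
   the convolution is multiplication by the transform of [check b], which vanishes nowhere: this
   yields both the formula and the uniqueness.

   As A and the quotient are only distributions, the argument goes by duality. The central identity
   is [tempered_conv]: for a test function phi, u(f conv phi) is the integral of phi(mu) u(T mu). It
   holds because f conv phi is the limit, in every seminorm, of Riemann sums of translates, mu |-> T
   mu being locally Lipschitz ([translate_lipschitz]). For existence, [deconvolution_ae] combines it
   with [fourier_conv] and [quotientK] to see that B(T mu), with B the inverse transform of the
   quotient, has the same integrals as r against all bumps; [du_bois_reymond] concludes. For
   uniqueness, [translates_total] shows that a tempered distribution vanishing on all translates of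
   f is zero. In both directions [test_dense] extends identities known on test functions to the
   whole Schwartz class.

   A distribution determines r only up to a null set, so the equation is an almost everywhere one.
   Null sets have no interior ([ae_dense]), so that equality holds at common points of continuity
   ([ae_eq_continuity_point]).

   The Fourier theory is developed for both signs of the exponent at once: continuity on the
   Schwartz class ([operator_fourier]), inversion by Abel summation ([fourier_inversion]) and
   convolution ([fourier_conv]). Estimates are stated with [norm1], [weight] and [bounded_by]; a
   linear functional is tempered exactly when one of these seminorms bounds it ([bound_continuous],
   [tempered_bound]). *)
(* distribution F^-1 [F r / F (check b)]. As the entropy is translation        *)
(* invariant, KL (T_mu b || exp A) = - Ent b - A (T_mu b), which for           *)
(* A = - Ent b - B is B (T_mu b), a continuous function of mu. Its integral    *)
(* against a test function phi is B (b * phi), because b * phi is a limit of   *)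
(* combinations of translates of b; and F^-1 (b * phi) is the product of       *)
(* F (check b) and F^-1 phi, so that this integral is (F r) (F^-1 phi), the    *)
(* integral of r phi. By the lemma of du Bois-Reymond, B (T_mu b) = r mu for   *)
(* almost every mu, and at each point of continuity of r. Conversely, if D is  *)
(* the difference of two solutions, D (T_mu b) vanishes for almost all mu,     *)
(* hence for all by continuity, so that D vanishes on all b * phi, whose       *)
(* Fourier transforms are dense in the Schwartz class because that of b does   *)
(* not vanish; thus D = 0.                                                     *)
Require Import Defs.
From HB Require Import structures.
From mathcomp Require Import all_boot all_order all_algebra.
From mathcomp Require Import all_classical all_reals all_analysis.
From mathcomp Require Import measurable_realfun complex.
From mathcomp Require Import ring lra.

Set Implicit Arguments.
Unset Strict Implicit.
Unset Printing Implicit Defensive.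

Import Order.TTheory GRing.Theory Num.Theory.
Import numFieldNormedType.Exports.

Local Open Scope classical_set_scope.
Local Open Scope ring_scope.
Local Open Scope complex_scope.

(** * A real-valued norm on complex numbers, and complex-valued integrals *)

Section norm1.
Variable R : realType.
Implicit Types (z w : R[i]) (t : R).

(* The norm |Re z| + |Im z| is real-valued, submultiplicative, and equivalent *)
(* to the modulus; it passes through integrals without any loss.              *)
Definition norm1 z : R := `|complex.Re z| + `|complex.Im z|.

Lemma norm1_ge0 z : 0 <= norm1 z. Proof. exact: addr_ge0. Qed.

Lemma ler_Re_norm1 z : `|complex.Re z| <= norm1 z.
Proof. by rewrite lerDl. Qed.

Lemma ler_Im_norm1 z : `|complex.Im z| <= norm1 z.
Proof. by rewrite lerDr. Qed.

Lemma norm1_0 : norm1 0 = 0.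
Proof. by rewrite /norm1 normr0 addr0. Qed.

Lemma norm1_real t : norm1 t%:C = `|t|.
Proof. by rewrite /norm1/= normr0 addr0. Qed.

Lemma norm1N z : norm1 (- z) = norm1 z.
Proof. by case: z => a b; rewrite /norm1/= !normrN. Qed.

Lemma cReD z w : complex.Re (z + w) = complex.Re z + complex.Re w.
Proof. by case: z w => [a b] [c d]. Qed.

Lemma cImD z w : complex.Im (z + w) = complex.Im z + complex.Im w.
Proof. by case: z w => [a b] [c d]. Qed.

Lemma cReN z : complex.Re (- z) = - complex.Re z.
Proof. by case: z. Qed.

Lemma cImN z : complex.Im (- z) = - complex.Im z.
Proof. by case: z. Qed.

Lemma cReM z w : complex.Re (z * w) =
  complex.Re z * complex.Re w - complex.Im z * complex.Im w.
Proof. by case: z w => [a b] [c d]. Qed.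

Lemma cImM z w : complex.Im (z * w) =
  complex.Re z * complex.Im w + complex.Im z * complex.Re w.
Proof. by case: z w => [a b] [c d]. Qed.

Lemma complexP z w : complex.Re z = complex.Re w ->
  complex.Im z = complex.Im w -> z = w.
Proof. by case: z w => [a b] [c d] /= -> ->. Qed.

Lemma ler_norm1D z w : norm1 (z + w) <= norm1 z + norm1 w.
Proof.
by rewrite /norm1 cReD cImD (le_trans (lerD (ler_normD _ _) (ler_normD _ _)))// addrACA.
Qed.

Lemma ler_norm1B z w : norm1 (z - w) <= norm1 z + norm1 w.
Proof. by rewrite -(norm1N w) ler_norm1D. Qed.

Lemma norm1BC z w : norm1 (z - w) = norm1 (w - z).
Proof. by rewrite -norm1N opprB. Qed.

Lemma ler_norm1M z w : norm1 (z * w) <= norm1 z * norm1 w.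
Proof.
rewrite /norm1 cReM cImM (le_trans (lerD (ler_normB _ _) (ler_normD _ _)))//.
by rewrite !normrM; lra.
Qed.

Lemma norm1Z t z : norm1 (t%:C * z) = `|t| * norm1 z.
Proof. by rewrite /norm1 cReM cImM/= !mul0r subr0 addr0 !normrM mulrDr. Qed.

Lemma norm1_le0 z : norm1 z <= 0 -> z = 0.
Proof.
move=> z0; apply: complexP; apply/eqP; rewrite -normr_le0 (le_trans _ z0)//.
  exact: ler_Re_norm1.
exact: ler_Im_norm1.
Qed.

Lemma norm1_eq_small z : (forall e, 0 < e -> norm1 z <= e) -> z = 0.
Proof.
move=> h; apply: norm1_le0; apply/ler_addgt0Pr => e e0.
by rewrite add0r h.
Qed.

Lemma ler_normC_norm1 z : `|z| <= (norm1 z)%:C.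
Proof.
case: z => a b; rewrite normc_def/= lecR /norm1/=.
rewrite -[leRHS]ger0_norm ?addr_ge0// -sqrtr_sqr ler_wsqrtr//.
rewrite sqrrD !real_normK ?num_real//; have := normr_ge0 a; have := normr_ge0 b.
by nra.
Qed.

(** Each of the two parts is at most the modulus. The constant 2 is crude, but seminorms are only
    compared up to constants. *)
Lemma ler_norm1_normC z e : `|z| <= e%:C -> norm1 z <= 2 * e.
Proof.
case: z => a b; rewrite normc_def/= lecR /norm1/= => ze.
have ha : `|a| <= e.
  by rewrite (le_trans _ ze)// -sqrtr_sqr ler_wsqrtr// lerDl sqr_ge0.
have hb : `|b| <= e.
  by rewrite (le_trans _ ze)// -sqrtr_sqr ler_wsqrtr// lerDr sqr_ge0.
lra.
Qed.

Lemma expi0 : expi (0 : R) = 1.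
Proof. by rewrite /expi cos0 sin0. Qed.

Lemma expiD t1 t2 : expi (t1 + t2) = expi t1 * expi t2.
Proof.
by apply: complexP; rewrite /expi ?cReM ?cImM/= ?cosD ?sinD// addrC mulrC [X in _ + X]mulrC
  addrC mulrC; ring.
Qed.

Lemma norm1_expi t : norm1 (expi t) <= 2.
Proof.
rewrite /norm1/=; have := cos_max t; have := sin_max t; lra.
Qed.

Lemma expiNM t : expi (- t) * expi t = 1.
Proof. by rewrite -expiD addNr expi0. Qed.

End norm1.

(** * Complex-valued functions: measurability, integrals, dominated convergence *)

Section complex_integral.
Variable R : realType.

Section cmeasurable.
Context d (T : measurableType d).
Implicit Types (f g : T -> R[i]).

Definition cmeasurable f := measurable_fun setT (fun x => complex.Re (f x)) /\
  measurable_fun setT (fun x => complex.Im (f x)).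

Lemma cmeasurable_cst (c : R[i]) : cmeasurable (fun=> c).
Proof. by split; exact: measurable_cst. Qed.

Lemma cmeasurable_real (h : T -> R) : measurable_fun setT h ->
  cmeasurable (fun x => (h x)%:C).
Proof. by move=> mh; split => //=; exact: measurable_cst. Qed.

Lemma cmeasurableD f g : cmeasurable f -> cmeasurable g ->
  cmeasurable (fun x => f x + g x).
Proof.
move=> [f1 f2] [g1 g2]; split.
  by under eq_fun do rewrite cReD; exact: measurable_funD.
by under eq_fun do rewrite cImD; exact: measurable_funD.
Qed.

Lemma cmeasurableM f g : cmeasurable f -> cmeasurable g ->
  cmeasurable (fun x => f x * g x).
Proof.
move=> [f1 f2] [g1 g2]; split.
  under eq_fun do rewrite cReM.
  by apply: measurable_funB; exact: measurable_funM.
under eq_fun do rewrite cImM.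
by apply: measurable_funD; exact: measurable_funM.
Qed.

Lemma cmeasurableN f : cmeasurable f -> cmeasurable (fun x => - f x).
Proof.
move=> [f1 f2]; split.
  by under eq_fun do rewrite cReN; exact: measurableT_comp.
by under eq_fun do rewrite cImN; exact: measurableT_comp.
Qed.

Lemma cmeasurableB f g : cmeasurable f -> cmeasurable g ->
  cmeasurable (fun x => f x - g x).
Proof. by move=> mf mg; apply: cmeasurableD => //; exact: cmeasurableN. Qed.

Lemma cmeasurable_prod I (r : seq I) (F : I -> T -> R[i]) :
  (forall i, cmeasurable (F i)) -> cmeasurable (fun x => \prod_(i <- r) F i x).
Proof.
move=> mF; elim: r => [|i r IH].
  by under eq_fun do rewrite big_nil; exact: cmeasurable_cst.
by under eq_fun do rewrite big_cons; exact: cmeasurableM.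
Qed.

Lemma cmeasurable_expi (h : T -> R) : measurable_fun setT h ->
  cmeasurable (fun x => expi (h x)).
Proof.
move=> mh; split => /=.
  by apply: measurableT_comp => //; apply: continuous_measurable_fun; exact: continuous_cos.
by apply: measurableT_comp => //; apply: continuous_measurable_fun; exact: continuous_sin.
Qed.

End cmeasurable.

Lemma cmeasurable_comp d d' (T : measurableType d) (T' : measurableType d')
    (f : T' -> R[i]) (h : T -> T') :
  measurable_fun setT h -> cmeasurable f -> cmeasurable (fun x => f (h x)).
Proof.
by move=> mh [f1 f2]; split;
  [exact: (measurableT_comp f1)|exact: (measurableT_comp f2)].
Qed.

Section cint.
Context d (T : measurableType d) (mu : {measure set T -> \bar R}).
Implicit Types (f g : T -> R[i]) (m : T -> R).

Definition integrableR m := mu.-integrable setT (EFin \o m).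

Definition cintegrable f := integrableR (fun x => complex.Re (f x)) /\
  integrableR (fun x => complex.Im (f x)).

Definition cint f : R[i] :=
  (\int[mu]_x complex.Re (f x))%R +i* (\int[mu]_x complex.Im (f x))%R.

Lemma cintegrable_cmeasurable f : cintegrable f -> cmeasurable f.
Proof.
by move=> [/measurable_int + /measurable_int +]; split; exact/measurable_EFinP.
Qed.

Lemma integrableR_le m1 m : measurable_fun setT m1 -> integrableR m ->
  (forall x, `|m1 x| <= m x) -> integrableR m1.
Proof.
move=> mm1 im m1m; apply: le_integrable im => //; first exact/measurable_EFinP.
by move=> x _ /=; rewrite lee_fin (le_trans (m1m x))// ler_norm.
Qed.

Lemma cintegrable_le f m : cmeasurable f -> integrableR m ->
  (forall x, norm1 (f x) <= m x) -> cintegrable f.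
Proof.
move=> [f1 f2] im fm; split; apply: (integrableR_le _ im) => // x.
  by rewrite (le_trans _ (fm x))// ler_Re_norm1.
by rewrite (le_trans _ (fm x))// ler_Im_norm1.
Qed.

Lemma integrableRD m1 m2 : integrableR m1 -> integrableR m2 ->
  integrableR (fun x => m1 x + m2 x).
Proof.
move=> i1 i2.
rewrite /integrableR (_ : EFin \o _ = ((EFin \o m1) \+ (EFin \o m2))%E)//.
exact: integrableD.
Qed.

Lemma integrableRZ (c : R) m : integrableR m -> integrableR (fun x => c * m x).
Proof.
move=> i1; rewrite /integrableR.
rewrite (_ : EFin \o _ = (fun x => c%:E * (EFin \o m) x)%E)//.
exact: integrableZl.
Qed.

Lemma cintegrable_norm1 f : cintegrable f -> integrableR (fun x => norm1 (f x)).
Proof.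
by move=> [f1 f2]; apply: integrableRD; apply: integrable_norm.
Qed.

Lemma cintegrableD f g : cintegrable f -> cintegrable g ->
  cintegrable (fun x => f x + g x).
Proof.
move=> fi gi; apply: (@cintegrable_le _ (fun x => norm1 (f x) + norm1 (g x))).
- by apply: cmeasurableD; exact: cintegrable_cmeasurable.
- by apply: integrableRD; exact: cintegrable_norm1.
- by move=> x; exact: ler_norm1D.
Qed.

Lemma cintegrableMl f g (B : R) : cmeasurable g -> (forall x, norm1 (g x) <= B) ->
  cintegrable f -> cintegrable (fun x => g x * f x).
Proof.
move=> mg gB fi; apply: (@cintegrable_le _ (fun x => B * norm1 (f x))).
- by apply: cmeasurableM => //; exact: cintegrable_cmeasurable.
- by apply: integrableRZ; exact: cintegrable_norm1.
- by move=> x; rewrite (le_trans (ler_norm1M _ _))// ler_wpM2r// norm1_ge0.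
Qed.

Lemma cintegrableZ (c : R[i]) f : cintegrable f -> cintegrable (fun x => c * f x).
Proof. by apply: (@cintegrableMl _ _ (norm1 c)) => //; exact: cmeasurable_cst. Qed.

Lemma cintD f g : cintegrable f -> cintegrable g ->
  cint (fun x => f x + g x) = cint f + cint g.
Proof.
move=> [f1 f2] [g1 g2]; apply: complexP; rewrite ?cReD ?cImD/=.
  by rewrite -RintegralD//; apply: eq_Rintegral => x _; rewrite cReD.
by rewrite -RintegralD//; apply: eq_Rintegral => x _; rewrite cImD.
Qed.

Lemma cintZ (c : R[i]) f : cintegrable f -> cint (fun x => c * f x) = c * cint f.
Proof.
move=> [f1 f2].
have Zi r m : integrableR m -> mu.-integrable setT (EFin \o (fun x => r * m x)).
  by move=> ?; exact: integrableRZ.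
apply: complexP; rewrite ?cReM ?cImM/=.
  under eq_Rintegral do rewrite cReM.
  by rewrite RintegralB// ?RintegralZl//; exact: Zi.
under eq_Rintegral do rewrite cImM.
by rewrite RintegralD// ?RintegralZl//; exact: Zi.
Qed.

Lemma cintegrableB f g : cintegrable f -> cintegrable g ->
  cintegrable (fun x => f x - g x).
Proof.
move=> fi gi; under eq_fun do rewrite -mulN1r.
by apply: cintegrableD => //; exact: cintegrableZ.
Qed.

Lemma cintB f g : cintegrable f -> cintegrable g ->
  cint (fun x => f x - g x) = cint f - cint g.
Proof.
move=> fi gi; rewrite -mulN1r -cintZ// -cintD//; last exact: cintegrableZ.
by under eq_fun do rewrite -mulN1r.
Qed.

Lemma cint0 : cint (fun=> 0) = 0.
Proof. by apply: complexP => /=; rewrite Rintegral_cst// mul0r. Qed.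

Lemma cintegrable0 : cintegrable (fun=> 0).
Proof. by split; exact: integrable0. Qed.

Lemma cintegrable_sum (I : eqType) (r : seq I) (F : I -> T -> R[i]) :
  (forall i, cintegrable (F i)) -> cintegrable (fun x => \sum_(i <- r) F i x).
Proof.
move=> Fi; elim: r => [|i r IH].
  by under eq_fun do rewrite big_nil; exact: cintegrable0.
by under eq_fun do rewrite big_cons; exact: cintegrableD.
Qed.

Lemma cint_sum (I : eqType) (r : seq I) (F : I -> T -> R[i]) :
  (forall i, cintegrable (F i)) ->
  cint (fun x => \sum_(i <- r) F i x) = \sum_(i <- r) cint (F i).
Proof.
move=> Fi; elim: r => [|i r IH].
  by rewrite big_nil; under eq_fun do rewrite big_nil; exact: cint0.
rewrite big_cons -IH -cintD//; first by under eq_fun do rewrite big_cons.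
exact: cintegrable_sum.
Qed.

Lemma norm1_cint_le f m : cmeasurable f -> integrableR m ->
  (forall x, norm1 (f x) <= m x) -> norm1 (cint f) <= (\int[mu]_x m x)%R.
Proof.
move=> mf im fm; have fi := cintegrable_le mf im fm.
have [f1 f2] := fi.
apply: (@le_trans _ _ (\int[mu]_x norm1 (f x))%R).
  rewrite /norm1/= RintegralD//; last 2 first.
    exact: integrable_norm.
    exact: integrable_norm.
  by rewrite lerD// le_normr_Rintegral.
by apply: le_Rintegral => //; exact: cintegrable_norm1.
Qed.

Lemma cint_real m : cint (fun x => (m x)%:C) = (\int[mu]_x m x)%R%:C.
Proof. by congr (_ +i* _); rewrite /= Rintegral_cst// mul0r. Qed.

Lemma cintegrable_real m : integrableR m -> cintegrable (fun x => (m x)%:C).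
Proof. by move=> im; split => //; exact: integrable0. Qed.

Lemma eq_cint f g : f =1 g -> cint f = cint g.
Proof. by move=> /funext ->. Qed.

(** Convergence is expressed by the real sequence [norm1 (f_ k x - f x)], so that the claim reduces
    to real dominated convergence for each of the two parts. *)
Lemma cint_dominated (f_ : nat -> T -> R[i]) f m :
  (forall k, cmeasurable (f_ k)) -> cmeasurable f -> integrableR m ->
  (forall k x, norm1 (f_ k x) <= m x) ->
  (forall x, norm1 (f_ k x - f x) @[k --> \oo] --> 0) ->
  norm1 (cint (f_ k) - cint f) @[k --> \oo] --> 0.
Proof.
move=> mf_ mf im fm cf.
(* The bound passes to the limit, as [f x] is within any [e] of some [f_ k x]. *)
have fm0 x : norm1 (f x) <= m x.
  apply/ler_addgt0Pr => e e0.
  have /cvgrPdist_lt /(_ _ e0) [k _ /(_ k (leqnn _))/=] := cf x.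
  rewrite sub0r normrN ger0_norm ?norm1_ge0// => h.
  have -> : f x = f_ k x - (f_ k x - f x) by ring.
  by rewrite (le_trans (ler_norm1B _ _))// lerD// ltW.
have fi : cintegrable f := cintegrable_le mf im fm0.
have f_i k : cintegrable (f_ k) := cintegrable_le (mf_ k) im (fm k).
(* [P] stands for the real or the imaginary part, both additive and 1-Lipschitz for [norm1]. *)
have C (P : R[i] -> R) : (forall z w, P (z - w) = P z - P w) ->
    (forall z, `|P z| <= norm1 z) ->
    (forall k, measurable_fun setT (P \o f_ k)) -> measurable_fun setT (P \o f) ->
    `|(\int[mu]_x P (f_ k x))%R - (\int[mu]_x P (f x))%R| @[k --> \oo] --> 0.
  move=> PB Pn m1 m2.
  have ei (h : T -> R[i]) : measurable_fun setT (P \o h) ->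
      (forall x, norm1 (h x) <= m x) -> mu.-integrable setT (fun x => (P (h x))%:E).
    move=> mh hm; apply: (@integrableR_le (P \o h) m mh im) => x.
    by rewrite (le_trans (Pn _)).
  have h1 : {ae mu, forall x, setT x ->
      (P (f_ k x))%:E @[k --> \oo] --> (P (f x))%:E}.
    apply: aeW => x _ /=; apply: cvg_EFin; first exact: nearW.
    apply/cvgrPdist_lt => e e0; have /cvgrPdist_lt /(_ _ e0) := cf x.
    apply: filterS => k; rewrite sub0r normrN ger0_norm ?norm1_ge0// => h.
    by rewrite /= -PB (le_lt_trans (Pn _))// norm1BC.
  have h2 : {ae mu, forall x k, setT x -> (`|(P (f_ k x))%:E| <= (m x)%:E)%E}.
    by apply: aeW => x k _ /=; rewrite lee_fin (le_trans (Pn _)).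
  have := dominated_convergence measurableT
    (fun k => (measurable_EFinP _ _).2 (m1 k)) ((measurable_EFinP _ _).2 m2) h1 im h2.
  case=> _ _; have -> : (\int[mu]_x (EFin \o (P \o f)) x =
      (\int[mu]_x P (f x))%R%:E)%E.
    by rewrite fineK//; apply: integrable_fin_num => //; exact: ei.
  move=> /fine_cvgP[_].
  set u := (X in X @ _ --> _) => ul.
  have -> : (fun k => `|(\int[mu]_x P (f_ k x))%R - (\int[mu]_x P (f x))%R|) =
      (fun k => `|u k - (\int[mu]_x P (f x))%R|) by [].
  rewrite -(@normr0 _ R) -(subrr (\int[mu]_x P (f x))%R).
  by apply: cvg_norm; apply: cvgB => //; exact: cvg_cst.
have RB z w : complex.Re (z - w) = complex.Re z - complex.Re w :> R.
  by rewrite cReD cReN.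
have IB z w : complex.Im (z - w) = complex.Im z - complex.Im w :> R.
  by rewrite cImD cImN.
have := C _ RB (@ler_Re_norm1 R) (fun k => (mf_ k).1) mf.1.
have := C _ IB (@ler_Im_norm1 R) (fun k => (mf_ k).2) mf.2.
move=> hI hR; rewrite -[X in _ --> X]addr0.
under eq_fun do rewrite /norm1 RB IB /=.
exact: cvgD hR hI.
Unshelve. all: by end_near.
Qed.

End cint.
End complex_integral.

(** * Fubini and affine changes of variables *)

Section product_integral.
Context d1 d2 (T1 : measurableType d1) (T2 : measurableType d2) (R : realType).
Variable m1 : {sigma_finite_measure set T1 -> \bar R}.
Variable m2 : {sigma_finite_measure set T2 -> \bar R}.

Lemma integrableR_prod (f : T1 -> R) (g : T2 -> R) :
  integrableR m1 f -> integrableR m2 g ->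
  integrableR (m1 \x m2)%E (fun p => f p.1 * g p.2).
Proof.
move=> fi gi.
have mf : measurable_fun setT f by apply/measurable_EFinP; exact: measurable_int fi.
have mg : measurable_fun setT g by apply/measurable_EFinP; exact: measurable_int gi.
apply/integrable12ltyP.
  apply/measurable_EFinP; apply: measurable_funM.
    exact: (measurableT_comp mf measurable_fst).
  exact: (measurableT_comp mg measurable_snd).
under eq_integral => x _.
  under eq_integral do rewrite /= normrM EFinM.
  rewrite ge0_integralZl//; last exact/measurable_EFinP/measurableT_comp.
  over.
move/integrableP : (fi) => [_ foo]; move/integrableP : (gi) => [_ goo].
rewrite /= in foo goo.
rewrite ge0_integralZr//=; last 2 first.
- exact/measurable_EFinP/measurableT_comp.
- exact: integral_ge0.
by rewrite lte_mul_pinfty ?integral_ge0// ge0_fin_numE// integral_ge0.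
Qed.

Section fubini.
Variables (F : T1 * T2 -> R[i]) (f : T1 -> R) (g : T2 -> R).
Hypotheses (mF : cmeasurable F) (fi : integrableR m1 f) (gi : integrableR m2 g).
Hypothesis Ffg : forall x y, norm1 (F (x, y)) <= f x * g y.

Lemma cintegrable_dominated_prod : cintegrable (m1 \x m2)%E F.
Proof.
apply: (cintegrable_le mF (integrableR_prod fi gi)) => -[x y].
exact: Ffg.
Qed.

Let integrable_slice1 x : cintegrable m2 (fun y => F (x, y)).
Proof.
apply: (@cintegrable_le _ _ _ m2 _ (fun y => f x * g y)) => //.
  by apply: cmeasurable_comp mF; exact: measurable_pair1.
exact: integrableRZ.
Qed.

Let integrable_slice2 y : cintegrable m1 (fun x => F (x, y)).
Proof.
apply: (@cintegrable_le _ _ _ m1 _ (fun x => g y * f x)) => //.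
- by apply: cmeasurable_comp mF; exact: measurable_pair2.
- exact: integrableRZ.
- by move=> x; rewrite mulrC.
Qed.

(** Domination by a product f(x) g(y) makes every slice of [F] integrable, not just almost every
    one, so that [fine] can be removed from the inner integral at each point. *)
Lemma cint_fubini1 : cint (m1 \x m2)%E F = cint m1 (fun x => cint m2 (fun y => F (x, y))).
Proof.
have [i1 i2] := cintegrable_dominated_prod.
apply: complexP => /=; congr fine.
  rewrite -(integral12_prod_meas1 i1); apply: eq_integral => x _.
  by rewrite /= fineK//; apply: integrable_fin_num => //; exact: (integrable_slice1 x).1.
rewrite -(integral12_prod_meas1 i2); apply: eq_integral => x _.
by rewrite /= fineK//; apply: integrable_fin_num => //; exact: (integrable_slice1 x).2.
Qed.

Lemma cint_fubini2 : cint (m1 \x m2)%E F = cint m2 (fun y => cint m1 (fun x => F (x, y))).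
Proof.
have [i1 i2] := cintegrable_dominated_prod.
apply: complexP => /=; congr fine.
  rewrite -(integral21_prod_meas1 i1); apply: eq_integral => x _.
  by rewrite /= fineK//; apply: integrable_fin_num => //; exact: (integrable_slice2 x).1.
rewrite -(integral21_prod_meas1 i2); apply: eq_integral => x _.
by rewrite /= fineK//; apply: integrable_fin_num => //; exact: (integrable_slice2 x).2.
Qed.

Lemma cint_fubini : cint m1 (fun x => cint m2 (fun y => F (x, y))) =
  cint m2 (fun y => cint m1 (fun x => F (x, y))).
Proof. by rewrite -cint_fubini1 cint_fubini2. Qed.

End fubini.
End product_integral.

(** * Integration on row vectors: slicing, affine maps, products of one-variable functions *)

Section lebesgue_rV_integral.
Variable R : realType.
Local Notation leb n := (lebesgue_rV R n).
Local Notation leb1 := (@lebesgue_measure R).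

Lemma ge0_integral_rVS n (f : 'rV[R]_n.+1 -> \bar R) :
  measurable_fun setT f -> (forall x, (0 <= f x)%E) ->
  (\int[leb n.+1]_x f x =
   \int[leb1]_t \int[leb n]_y f (rV_cons (t, y)))%E.
Proof.
move=> mf f0.
have -> : (\int[leb n.+1]_x f x =
    \int[pushforward (leb1 \x leb n)%E (@rV_cons R n)]_x f x)%E by [].
rewrite ge0_integral_pushforward//; last exact: measurable_rV_cons.
rewrite preimage_setT fubini_tonelli1//.
  by apply: measurableT_comp => //; exact: measurable_rV_cons.
by move=> x; exact: f0.
Qed.

Lemma cint_rVS n (f : 'rV[R]_n.+1 -> R[i]) : cmeasurable f ->
  cintegrable (leb1 \x leb n)%E (f \o @rV_cons R n) ->
  cintegrable (leb n.+1) f /\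
  cint (leb n.+1) f = cint (leb1 \x leb n)%E (f \o @rV_cons R n).
Proof.
move=> [mf1 mf2] [f1 f2].
have mc := @measurable_rV_cons R n.
have P (h : 'rV[R]_n.+1 -> R) : measurable_fun setT h ->
    integrableR (leb1 \x leb n)%E (h \o @rV_cons R n) ->
    integrableR (leb n.+1) h /\
    (\int[leb n.+1]_x (h x)%:E =
       \int[(leb1 \x leb n)%E]_x (h (rV_cons x))%:E)%E.
  move=> mh hi.
  have mEh : measurable_fun setT (EFin \o h) by exact/measurable_EFinP.
  have hi' : (leb1 \x leb n)%E.-integrable (@rV_cons R n @^-1` setT)
    ((EFin \o h) \o @rV_cons R n) by rewrite preimage_setT.
  split.
    have /integrableP[_] := integrable_pushforward mc mEh hi' measurableT.
    by move=> hoo; apply/integrableP; split.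
  have := integral_pushforward mc mEh hi' measurableT.
  by rewrite preimage_setT => <-.
have [i1 e1] := P _ mf1 f1; have [i2 e2] := P _ mf2 f2.
by split => //; apply: complexP => /=; congr fine.
Qed.

Lemma measurable_affine1 (a c : R) :
  measurable_fun setT (fun t : measurableTypeR R => a * t + c : measurableTypeR R).
Proof. by apply: measurable_funD => //; apply: measurable_funM. Qed.

(** The image of Lebesgue measure under t |-> a t + c, multiplied by |a|, gives each half-open
    interval its length, hence is Lebesgue measure by uniqueness. *)
Lemma ge0_integral_affine1 (a c : R) (f : R -> \bar R) : a != 0 ->
  measurable_fun setT f -> (forall x, (0 <= f x)%E) ->
  (\int[leb1]_t f (a * t + c)%R = (`|a|^-1)%:E * \int[leb1]_t f t)%E.
Proof.
move=> a0 mf f0; have aN : 0 <= `|a| by [].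
have m_ := measurable_affine1 a c.
pose push : {measure set (measurableTypeR R) -> \bar R} :=
  measure_function_pushforward__canonical__measure_function_Measure leb1 m_.
pose nu := mscale (NngNum aN) push.
have nuE A : measurable A -> leb1 A = nu A.
  move=> mA; apply: lebesgue_measure_unique mA => _ [[x y] _ <-]/=.
  rewrite /nu /mscale/= /pushforward.
  have ap : 0 < `|a| by rewrite normr_gt0.
  have [a_gt0|a_le0] := ltP 0 a.
    have -> : (fun t => a * t + c) @^-1` `]x, y] =
        `](x - c) / a, (y - c) / a]%classic.
      apply/seteqP; split => t /=; rewrite !in_itv/= ltr_pdivrMr// ler_pdivlMr//;
        by rewrite ltrBlDr lerBrDr [t * a]mulrC.
    rewrite !lebesgue_measure_itv/= !lte_fin ltr_pM2r ?invr_gt0//.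
    rewrite ltrD2r; case: ifPn => xy; last by rewrite mule0.
    rewrite -!EFinB -EFinM gtr0_norm//; congr EFin; field; exact: lt0r_neq0.
  (* The map is now decreasing: the preimage of a right-closed interval is a left-closed one. *)
  have a_lt0 : a < 0 by rewrite lt_neqAle a0.
  have -> : (fun t => a * t + c) @^-1` `]x, y] =
      `[(y - c) / a, (x - c) / a[%classic.
    apply/seteqP; split => t /=; rewrite !in_itv/= ltr_ndivlMr// ler_ndivrMr//;
      by rewrite ltrBlDr lerBrDr [t * a]mulrC andbC.
  rewrite !lebesgue_measure_itv/= !lte_fin ltr_nM2r ?invr_lt0//.
  rewrite ltrD2r; case: ifPn => xy; last by rewrite mule0.
  by rewrite -!EFinB -EFinM ltr0_norm//; congr EFin; field.
rewrite [in RHS](eq_measure_integral nu); last by move=> A mA _; exact: nuE.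
rewrite ge0_integral_mscale//= ge0_integral_pushforward//.
by rewrite preimage_setT muleA -EFinM mulVf ?normr_eq0// mul1e.
Qed.

Lemma measurable_affine_rV n (a : R) (c : 'rV[R]_n) :
  measurable_fun setT (fun x : 'rV[R]_n => a *: x + c).
Proof.
apply: measurable_fun_rV => i.
rewrite (_ : _ \o _ = (fun t => a * t + c 0 i) \o rV_coord i); last first.
  by apply/funext => x; rewrite /rV_coord/= !mxE.
by apply: measurableT_comp; [exact: measurable_affine1|exact: measurable_rV_coord].
Qed.

(** The map acts on each coordinate separately, so Tonelli splits it into the one-dimensional case
    and the induction hypothesis. *)
Lemma ge0_integral_affine_rV n (a : R) (c : 'rV[R]_n) (f : 'rV[R]_n -> \bar R) :
  a != 0 -> measurable_fun setT f -> (forall x, (0 <= f x)%E) ->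
  (\int[leb n]_x f (a *: x + c)%R = ((`|a| ^+ n)^-1)%:E * \int[leb n]_x f x)%E.
Proof.
move=> a0; elim: n c f => [|n IH] c f mf f0.
  rewrite expr0 invr1 mul1e; apply: eq_integral => x _; congr f.
  by rewrite [LHS]thinmx0 [RHS]thinmx0.
rewrite ge0_integral_rVS//; last first.
  exact: (measurableT_comp mf (measurable_affine_rV a c)).
rewrite ge0_integral_rVS//.
pose c' := \row_j c 0 (lift ord0 j).
have E t y : a *: rV_cons (t, y) + c = rV_cons (a * t + c 0 0, a *: y + c').
  apply/rowP => j; rewrite !mxE; case: unliftP => [k ->|->]; rewrite /= ?mxE//.
have mfc t : measurable_fun setT (fun y => f (rV_cons (t, y))).
  apply: measurableT_comp => //.
  by apply: (measurableT_comp (@measurable_rV_cons R n)); exact: measurable_pair1.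
pose G (t : R) := (\int[leb n]_y f (rV_cons (t, y)))%E.
have mG : measurable_fun setT G.
  apply: (@measurable_fun_fubini_tonelli_F _ _ _ _ _ _ (f \o @rV_cons R n)) => //.
    exact: (measurableT_comp mf (@measurable_rV_cons R n)).
  by move=> x; exact: f0.
have G0 t : (0 <= G t)%E by exact: integral_ge0.
pose c0 : R := c ord0 ord0.
transitivity (\int[leb1]_t (((`|a| ^+ n)^-1)%:E * G (a * t + c0)%R))%E.
  apply: eq_integral => t _; under eq_integral do rewrite E.
  by rewrite (IH c' (fun y => f (rV_cons (a * t + c0, y)))).
have <- : (\int[leb1]_t G t =
  \int[leb1]_t \int[leb n]_y f (rV_cons (t, y)))%E by [].
(* Forgets the body of [G], which the rewrites below should treat as an arbitrary measurable
   function. *)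
move: G mG G0 => G mG G0.
rewrite ge0_integralZl_EFin//; last exact: (measurableT_comp mG (measurable_affine1 _ _)).
by rewrite (ge0_integral_affine1 c0 a0 mG G0) muleA -EFinM -invfM exprS mulrC.
Qed.

Section affine.
Variables (n : nat) (a : R) (c : 'rV[R]_n).
Hypothesis a0 : a != 0.

Lemma integral_affine_rV (h : 'rV[R]_n -> R) : integrableR (leb n) h ->
  integrableR (leb n) (fun x => h (a *: x + c)) /\
  (\int[leb n]_x h (a *: x + c) = (`|a| ^+ n)^-1 * \int[leb n]_x h x)%R.
Proof.
move=> hi; move/integrableP : (hi) => [mh hoo].
have m_ := measurable_affine_rV a c.
have hi' : integrableR (leb n) (fun x => h (a *: x + c)).
  apply/integrableP; split; first exact: (measurableT_comp mh m_).
  rewrite /= (ge0_integral_affine_rV c a0 (f := fun x => `|(h x)%:E|%E))//.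
    rewrite lte_mul_pinfty//.
  exact: measurableT_comp.
split => //; apply: EFin_inj; rewrite EFinM.
rewrite !fineK; [|exact: integrable_fin_num..].
rewrite [LHS]integralE [X in _ = (_ * X)%E]integralE.
have pE (k : 'rV[R]_n -> \bar R) : measurable_fun setT k -> (forall x, (0 <= k x)%E) ->
  (\int[leb n]_x k (a *: x + c)%R = ((`|a| ^+ n)^-1)%:E * \int[leb n]_x k x)%E.
  by move=> *; exact: ge0_integral_affine_rV.
have e1 := pE _ (measurable_funepos mh) (fun x => funepos_ge0 _ x).
have e2 := pE _ (measurable_funeneg mh) (fun x => funeneg_ge0 _ x).
rewrite muleBr//; last first.
  apply: fin_num_adde_defr; apply: integrable_pos_fin_num => //.
by congr (_ - _)%E; [rewrite -[RHS]e1|rewrite -[RHS]e2];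
  apply: eq_integral => x _; rewrite ?funeposE ?funenegE.
Qed.

Lemma cint_affine_rV (f : 'rV[R]_n -> R[i]) : cintegrable (leb n) f ->
  cintegrable (leb n) (fun x => f (a *: x + c)) /\
  cint (leb n) (fun x => f (a *: x + c)) = ((`|a| ^+ n)^-1)%:C * cint (leb n) f.
Proof.
move=> [/integral_affine_rV[i1 e1] /integral_affine_rV[i2 e2]]; split => //.
by apply: complexP; rewrite ?cReM ?cImM/= ?e1 ?e2 mul0r ?subr0 ?addr0.
Qed.

End affine.

Lemma cintegralE n (f : 'rV[R]_n -> R[i]) : cintegral f = cint (leb n) f.
Proof. by []. Qed.

(** Fubini along the first coordinate, then induction. This one computation gives the mass of
    [1 / weight], the transform of the Abel kernel and the measure of boxes. *)
Lemma cint_prod n (f : 'I_n -> R -> R[i]) : (forall i, cintegrable leb1 (f i)) ->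
  cintegrable (leb n) (fun x => \prod_i f i (x 0 i)) /\
  cint (leb n) (fun x => \prod_i f i (x 0 i)) = \prod_i cint leb1 (f i).
Proof.
elim: n f => [|n IH] f fi.
  under eq_fun do rewrite big_ord0.
  rewrite big_ord0.
  have E : cintegrable (leb 0) (fun=> 1).
    by apply: (@cintegrable_real _ _ _ (leb 0) (cst 1)); exact: finite_measure_integrable_cst.
  split => //; rewrite (cint_real (leb 0) (cst 1)).
  by rewrite Rintegral_cst// mul1r [X in fine X]diracT.
have mf : cmeasurable (fun x : 'rV[R]_n.+1 => \prod_i f i (x 0 i)).
  apply: cmeasurable_prod => i.
  apply: (cmeasurable_comp (measurable_rV_coord i)).
  exact: cintegrable_cmeasurable (fi i).
have [Ii Ie] := IH (fun i => f (lift ord0 i)) (fun i => fi _).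
set g := fun x : 'rV[R]_n => \prod_i f (lift ord0 i) (x 0 i) in Ii Ie.
have E p : \prod_i f i (rV_cons p 0 i) = f ord0 p.1 * g p.2.
  rewrite big_ord_recl; congr (f _ _ * _); first by rewrite mxE unlift_none.
  by apply: eq_bigr => i _; rewrite mxE liftK.
have mF : cmeasurable (fun p : measurableTypeR R * 'rV[R]_n => f ord0 p.1 * g p.2).
  apply: cmeasurableM.
    apply: (cmeasurable_comp measurable_fst).
    exact: cintegrable_cmeasurable (fi ord0).
  apply: (cmeasurable_comp measurable_snd).
  exact: cintegrable_cmeasurable Ii.
have n1 := cintegrable_norm1 (fi ord0).
have n2 := cintegrable_norm1 Ii.
have FN x y : norm1 (f ord0 (x, y).1 * g (x, y).2) <= norm1 (f ord0 x) * norm1 (g y).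
  exact: ler_norm1M.
have [] := @cint_rVS n _ mf.
  rewrite (_ : _ \o _ = fun p => f ord0 p.1 * g p.2); last exact/funext.
  exact: (cintegrable_dominated_prod mF n1 n2 FN).
move=> i1 ->; split => //.
rewrite (_ : _ \o _ = fun p => f ord0 p.1 * g p.2); last exact/funext.
rewrite (cint_fubini1 mF n1 n2 FN) big_ord_recl -Ie.
rewrite mulrC -cintZ//; apply: eq_cint => x /=.
by rewrite cintZ// mulrC.
Qed.

End lebesgue_rV_integral.

(** * The one-dimensional Abel kernel *)

Section explicit_integrals.
Variable R : realType.
Local Notation leb1 := (@lebesgue_measure R).

Lemma is_derive_cast (f : R -> R) (t d d' : R) :
  is_derive t 1 f d -> d = d' -> is_derive t 1 f d'.
Proof. by move=> + <-. Qed.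

(** Twice the half-line integral, by the fundamental theorem of calculus. The equation
    ['D_1 F x = f x] is asked for on x > 0 only, because the integrands to come involve |x| and have
    a simple primitive there. *)
Lemma even_integral (f F : R -> R) (l : R) :
  (forall x, 0 <= f x) -> continuous f -> (forall x, f (- x) = f x) ->
  (forall x, derivable F x 1) -> (forall x, 0 < x -> 'D_1 F x = f x) ->
  F x @[x --> +oo] --> l ->
  integrableR leb1 f /\ (\int[leb1]_x f x)%R = 2 * (l - F 0).
Proof.
move=> f0 cf evf dF Ff Fl.
have e : (\int[leb1]_x (f x)%:E = (2 * (l - F 0))%:E)%E.
  rewrite ge0_symfun_integralT//; last by move=> x /=; rewrite evf.
  rewrite -set_itvcy (ge0_continuous_FTC2y _ _ Fl)//.
  - exact: continuous_subspaceT.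
  - apply: cvg_at_right_filter; apply: differentiable_continuous.
    exact/derivable1_diffP.
  - by move=> x; rewrite in_itv/= andbT => x0; rewrite derive1E Ff.
split; last by rewrite /Rintegral e.
apply/integrableP; split.
  by apply/measurable_EFinP; exact: continuous_measurable_fun.
under eq_integral do rewrite /= ger0_norm//.
by rewrite e ltry.
Qed.

Lemma atan_ndecr (x y : R) : x <= y -> atan x <= atan y.
Proof.
rewrite le_eqVlt => /predU1P[->//|xy].
have [z _ e] := @MVT R atan (fun z => (1 + z ^+ 2)^-1) x y xy
  (fun z _ => is_derive1_atan z)
  (continuous_subspaceT (@continuous_atan R)).
rewrite -subr_ge0 e mulr_ge0// ?invr_ge0 ?subr_ge0 ?ltW//.
by rewrite ltr_wpDr// sqr_ge0.
Qed.

Lemma cvg_atan_pinfty : @atan R x @[x --> +oo] --> pi / 2.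
Proof.
apply/cvgrPdist_le => e e0.
(* The minimum keeps pi/2 - e' in the interval where [atan] inverts [tan]. *)
pose e' := Num.min e (pi / 2).
have e'0 : 0 < e' by rewrite lt_min e0 divr_gt0// pi_gt0.
near=> x; rewrite ger0_norm ?subr_ge0; last exact/ltW/atan_ltpi2.
rewrite lerBlDr -lerBlDl.
apply: (@le_trans _ _ (pi / 2 - e')); first by rewrite lerB// ge_min lexx.
rewrite -[leLHS]tanK; last first.
  rewrite in_itv/= ltrBlDr ltrDl e'0 andbT -subr_gt0 opprK.
  rewrite addrAC subr_gt0 (@le_lt_trans _ _ (pi / 2))//.
    by rewrite ge_min lexx orbT.
  by rewrite ltrDl divr_gt0// pi_gt0.
by apply: atan_ndecr; near: x; exact: nbhs_pinfty_ge (num_real _).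
Unshelve. all: by end_near. Qed.

Lemma integral_cauchy : integrableR leb1 (fun t => (1 + t ^+ 2)^-1) /\
  (\int[leb1]_t (1 + t ^+ 2)^-1)%R = pi.
Proof.
have [||||||i ->] := @even_integral (fun t : R => (1 + t ^+ 2)^-1) atan (pi / 2).
- by move=> x; rewrite invr_ge0 addr_ge0// sqr_ge0.
- exact: continuous_oneDsqrV.
- by move=> x; rewrite sqrrN.
- by move=> x; apply: ex_derive.
- by move=> x _; rewrite derive_val.
- exact: cvg_atan_pinfty.
by split => //; rewrite atan0 subr0 mulrC divfK.
Qed.

Lemma cvg_expR_bounded (g : R -> R) (B : R) : (forall t, `|g t| <= B) ->
  expR (- t) * g t @[t --> +oo] --> 0.
Proof.
move=> gB; have B0 : 0 <= B by rewrite (le_trans _ (gB 0)).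
apply/cvgr0Pnorm_le => e e0; near=> t.
rewrite normrM gtr0_norm ?expR_gt0// (@le_trans _ _ (expR (- t) * B))//.
  by rewrite ler_wpM2l ?expR_ge0.
rewrite (@le_trans _ _ (expR (- t) * (B + 1)))// ?ler_wpM2l ?expR_ge0 ?lerDl//.
rewrite -ler_pdivlMr ?ltr_wpDl//.
near: t.
have eB : 0 < e / (B + 1) by rewrite divr_gt0// ltr_wpDl.
have /cvgr0Pnorm_le /(_ (e / (B + 1))) := @cvgr_expR R.
move=> /(_ eB).
apply: filterS => t; rewrite ger0_norm// expR_ge0//.
Unshelve. all: by end_near. Qed.

(** Adding 1 to the cosine makes the integrand nonnegative, as [even_integral] requires; the extra
    mass is that of exp(-|t|), which z = 0 computes. [F] is the explicit primitive on t > 0. *)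
Lemma integral_abel_even (z : R) :
  integrableR leb1 (fun t => expR (- `|t|) * (1 + cos (z * t))) /\
  (\int[leb1]_t (expR (- `|t|) * (1 + cos (z * t))))%R = 2 + 2 / (1 + z ^+ 2).
Proof.
pose F (t : R) := expR (- t) *
  (- 1 + (z * sin (z * t) - cos (z * t)) / (1 + z ^+ 2)).
have z0 : 1 + z ^+ 2 != 0 by rewrite lt0r_neq0// ltr_wpDr// sqr_ge0.
have Fd (t : R) : is_derive t 1 F (expR (- t) * (1 + cos (z * t))).
  have e1 : is_derive t 1 (fun t => expR (- t)) (- expR (- t)).
    have := @is_derive1_comp _ expR (-%R) t _ _ (is_derive_expR (- t)) (is_deriveNid t 1).
    by rewrite mulrN1.
  have em : is_derive t 1 (fun t => z * t) z.
    by have := is_deriveZ z (is_derive_id t 1); rewrite scaler1.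
  have e2 := @is_derive1_comp _ sin (fun t => z * t) t _ _ (is_derive_sin _) em.
  have e3 := @is_derive1_comp _ cos (fun t => z * t) t _ _ (is_derive_cos _) em.
  have -> : F = (fun t => expR (- t)) * (cst (- 1) + (1 + z ^+ 2)^-1 *:
      (z *: (sin \o (fun t => z * t)) - (cos \o (fun t => z * t)))).
    by apply/funext => u; rewrite /F/= !fctE /= [X in _ = _ * (_ + X)]mulrC.
  have e4 := is_deriveZ (1 + z ^+ 2)^-1 (is_deriveB (is_deriveZ z e2) e3).
  have D := is_deriveM e1 (is_deriveD (is_derive_cst (- 1 : R) t 1) e4).
  apply: (is_derive_cast D).
  by rewrite !fctE /= /GRing.scale /=; field.
have F0 : F 0 = - 1 - (1 + z ^+ 2)^-1.
  by rewrite /F oppr0 expR0 mulr0 sin0 cos0; field.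
have Fl : F t @[t --> +oo] --> 0.
  apply: (@cvg_expR_bounded _ (1 + (`|z| + 1) / (1 + z ^+ 2))) => t.
  rewrite (le_trans (ler_normD _ _))// normrN1 lerD2l normrM.
  rewrite [X in _ * X]gtr0_norm; last by rewrite invr_gt0 ltr_wpDr// sqr_ge0.
  rewrite ler_pM2r; last by rewrite invr_gt0 ltr_wpDr// sqr_ge0.
  rewrite (le_trans (ler_normB _ _))// lerD//; last first.
    by rewrite ler_norml cos_geN1 cos_le1.
  by rewrite normrM ler_piMr// ler_norml sin_geN1 sin_le1.
have [||||||i ->] := @even_integral (fun t => expR (- `|t|) * (1 + cos (z * t))) F 0.
- by move=> t; rewrite mulr_ge0 ?expR_ge0// -lerBlDl sub0r cos_geN1.
- move=> t; apply: cvgM.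
    apply: continuous_comp; last exact: continuous_expR.
    by apply: cvgN; exact: norm_continuous.
  apply: cvgD; first exact: cvg_cst.
  apply: continuous_comp; last exact: continuous_cos.
  by apply: cvgMl_tmp; exact: cvg_id.
- by move=> t; rewrite normrN mulrN cosN.
- by move=> t; apply: ex_derive.
- by move=> t t0; rewrite derive_val gtr0_norm.
- exact: Fl.
by split => //; rewrite F0; field.
Qed.

Definition abel (t : R) : R := expR (- `|t|).

Lemma abel_ge0 t : 0 <= abel t. Proof. exact: expR_ge0. Qed.

Lemma abel_le1 t : abel t <= 1.
Proof. by rewrite /abel -expR0 ler_expR oppr_le0. Qed.

Lemma continuous_abel : continuous abel.
Proof.
move=> t; apply: continuous_comp; last exact: continuous_expR.
by apply: cvgN; exact: norm_continuous.
Qed.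

Lemma measurable_abel : measurable_fun setT abel.
Proof. apply: continuous_measurable_fun; exact: continuous_abel. Qed.

Lemma integral_abel : integrableR leb1 abel /\ (\int[leb1]_t abel t)%R = 2.
Proof.
have [i e] := integral_abel_even 0.
have E : (fun t : R => expR (- `|t|) * (1 + cos (0 * t))) = (fun t => 2 * abel t).
  by apply/funext => t; rewrite mul0r cos0 mulrC.
rewrite E in i e.
have i' : integrableR leb1 abel.
  have := integrableRZ 2^-1 i; under eq_fun do rewrite mulrA mulVf// mul1r.
  by [].
split => //; move: e; rewrite RintegralZl// expr0n addr0 divr1 => e.
by apply: (@mulfI _ 2) => //; rewrite e; ring.
Qed.

Lemma measurable_mulr (z : R) : measurable_fun setT (fun t : R => z * t).
Proof. exact: measurable_funM. Qed.

Lemma cintegrable_abel_expi (z : R) :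
  cintegrable leb1 (fun t => (abel t)%:C * expi (z * t)).
Proof.
have [i _] := integral_abel.
under eq_fun do rewrite mulrC.
apply: (@cintegrableMl _ _ _ _ _ _ 2).
- apply: cmeasurable_expi; exact: measurable_mulr.
- by move=> t; exact: norm1_expi.
- exact: cintegrable_real.
Qed.

(** The transform of exp(-|t|) is twice the Cauchy kernel: the real part comes from
    [integral_abel_even], and the imaginary part is the integral of an odd function. *)
Lemma cint_abel_expi (z : R) :
  cint leb1 (fun t => (abel t)%:C * expi (z * t)) = (2 / (1 + z ^+ 2))%:C.
Proof.
have [i1 e1] := integral_abel_even z; have [i2 e2] := integral_abel.
have [iR iI] := cintegrable_abel_expi z.
apply: complexP => /=.
  have : (\int[leb1]_t (expR (- `|t|) * (1 + cos (z * t)) - abel t))%R = 2 / (1 + z ^+ 2).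
    by rewrite RintegralB// e1 e2; ring.
  by move=> <-; apply: eq_Rintegral => t _ /=; rewrite /abel; ring.
set g := fun t : R => abel t * sin (z * t).
have E : (fun t : R => complex.Im ((abel t)%:C * expi (z * t))) = g.
  by apply/funext => t /=; rewrite /g mul0r addr0.
rewrite E in iI *.
have gN t : g (- t) = - g t by rewrite /g /abel normrN mulrN sinN mulrN.
rewrite /Rintegral integralE.
(* The substitution of -t for t exchanges the positive and negative parts of the odd function
   [g]. *)
have -> : (\int[leb1]_t (fun t => (g t)%:E)^\- t =
    \int[leb1]_t (fun t => (g t)%:E)^\+ t)%E.
  rewrite -[RHS]mul1e -invr1 -(@normrN1 R).
  rewrite -(@ge0_integral_affine1 _ (-1) 0)//.
  - apply: eq_integral => t _; rewrite mulN1r addr0 funeposE funenegE.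
    by rewrite gN EFinN.
  - exact: measurable_funepos (measurable_int _ iI).
rewrite subee//; apply: integrable_pos_fin_num => //; exact: iI.
Qed.

End explicit_integrals.

(** * Differential calculus on row vectors *)

Section calculus_rV.
Variables (R : realType) (n : nat).
Local Notation V := 'rV[R]_n.
Implicit Types (h : V -> R) (f g : V -> R[i]) (s : seq 'I_n).
Local Notation "'e_ i" := (delta_mx 0 i : V) (at level 8, i at level 2, format "''e_' i").
Local Notation D i f := (cpderiv [:: i] f).

Lemma is_derive_line (U : normedModType R) (h : U -> R) (x v : U) (t : R) : derivable h (x
  + t *: v) v ->
  is_derive t 1 (fun s : R => h (x + s *: v)) ('D_v h (x + t *: v)).
Proof.
have E : (fun k : R => k^-1 *: (((fun s : R => h (x + s *: v)) \o shift t) (k *: 1)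
    - h (x + t *: v))) =
    (fun k => k^-1 *: ((h \o shift (x + t *: v)) (k *: v) - h (x + t *: v))).
  apply/funext => k /=; congr (_ *: (h _ - _)).
  by rewrite [k *: 1]mulr1 scalerDl addrCA.
by move=> dh; apply: DeriveDef; rewrite /derivable /derive E.
Qed.

Lemma mean_value_line (U : normedModType R) (h : U -> R) (x v : U) (t : R) : (forall y,
  derivable h y v) ->
  exists2 c, `|c| <= `|t| & h (x + t *: v) - h x = t * 'D_v h (x + c *: v).
Proof.
move=> dh; pose k (s : R) := h (x + s *: v); pose dk (s : R) := 'D_v h (x + s *: v).
have kd (u : R) : is_derive u 1 k (dk u) by exact: is_derive_line.
have kc : continuous k.
  by move=> u; apply/differentiable_continuous/derivable1_diffP; exact: (@ex_derive _ _ _ _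
    _ _ _ (kd u)).
have -> : h x = k 0 by rewrite /k scale0r addr0.
have [t0|t0|<-] := ltgtP 0 t.
- have [c] := @MVT _ k dk 0 t t0 (fun u _ => kd u) (continuous_subspaceT kc).
  rewrite in_itv/= subr0 mulrC => /andP[c0 ct] e; exists c => //.
  by rewrite !ger0_norm// ltW.
- have [c] := @MVT _ k dk t 0 t0 (fun u _ => kd u) (continuous_subspaceT kc).
  rewrite in_itv/= sub0r => /andP[c0 ct] e; exists c.
    by rewrite !ler0_norm ?lerN2// ltW.
  by rewrite -/(k t) -opprB e mulrN opprK mulrC.
- by exists 0 => //; rewrite /k subrr mul0r.
Qed.

(** A remainder of order t^2, divided by t, tends to 0. Such remainders come out of Taylor bounds
    and survive integration, so this is how integrals depending on a parameter are differentiated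
    below. *)
Lemma is_derive_quadratic (U : normedModType R) (h : U -> R) (x v : U) (L C : R) :
  (forall t, `|t| <= 1 -> `|h (x + t *: v) - h x - t * L| <= t ^+ 2 * C) ->
  is_derive x v h L.
Proof.
move=> hC.
have C0 : 0 <= C by rewrite -[leRHS]mul1r -(expr1n _ 2) (le_trans _ (hC 1 _))// normr1.
suff cv : (fun t => t^-1 *: ((h \o shift x) (t *: v) - h x)) @ 0^' --> L.
  by apply: DeriveDef; [exact: cvgP cv|exact/cvg_lim].
apply/cvgrPdist_le => e e0; near=> t.
have t0 : t != 0 by near: t; exact: nbhs_dnbhs_neq.
have t1 : `|t| <= 1.
  by near: t; apply: dnbhs0_le.
have te : `|t| <= e / (C + 1).
  by near: t; apply: dnbhs0_le; rewrite divr_gt0// ltr_wpDl.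
have -> : L - t^-1 *: ((h \o shift x) (t *: v) - h x) =
    - (t^-1 * (h (x + t *: v) - h x - t * L)).
  rewrite (_ : t^-1 *: _ = t^-1 * (h (x + t *: v) - h x)); first by field.
  by rewrite /= [t *: v + x]addrC.
rewrite normrN normrM normfV (@le_trans _ _ (`|t|^-1 * (t ^+ 2 * C)))//.
  by rewrite ler_wpM2l// hC.
rewrite -real_normK ?num_real// mulrA expr2 mulrA mulVf ?normr_eq0// mul1r.
rewrite (@le_trans _ _ (e / (C + 1) * C))//; first by rewrite ler_wpM2r.
rewrite mulrAC ler_pdivrMr; last by rewrite ltr_wpDl.
by rewrite ler_pM2l// lerDl.
Unshelve. all: by end_near. Qed.

(** A box centred at [x], large enough for any path from [x] to [y] that changes one coordinate at a
    time. *)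
Definition hull (x y z : V) := forall j, `|z 0 j - x 0 j| <= `|y 0 j - x 0 j|.

(** The difference telescopes along a path from [x] to [y] whose steps are parallel to the axes, and
    the mean value theorem applies to each step. *)
Lemma lipschitz_rV h (x y : V) (B : R) :
  (forall i z, derivable h z 'e_i) ->
  (forall i z, hull x y z -> `|'D_('e_i) h z| <= B) ->
  `|h y - h x| <= B * \sum_j `|y 0 j - x 0 j|.
Proof.
(* [w k] already has its first [k] coordinates equal to those of [y]. *)
move=> dh hB; pose w k : V := \row_j (if (j < k)%N then y 0 j else x 0 j).
have -> : h y - h x = \sum_(j < n) (h (w j.+1) - h (w j)).
  rewrite -(big_mkord xpredT (fun j => h (w j.+1) - h (w j))) telescope_sumr//.
  congr (h _ - h _); apply/rowP => j; rewrite mxE ?ltn_ord//.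
rewrite mulr_sumr (le_trans (ler_norm_sum _ _ _))// ler_sum// => j _.
have -> : w j.+1 = w j + (y 0 j - x 0 j) *: 'e_j.
  apply/rowP => k; rewrite !mxE eqxx/= ltnS leq_eqVlt.
  have [->|kj] := eqVneq k j; first by rewrite eqxx ltnn mulr1; ring.
  by rewrite mulr0 addr0 (negbTE (kj : (k != j :> nat))).
have [c cy ->] := mean_value_line (w j) (y 0 j - x 0 j) (dh j).
rewrite normrM mulrC ler_wpM2r// hB// => k; rewrite !mxE eqxx/=.
have [->|kj] := eqVneq k j; first by rewrite ltnn mulr1 addrAC subrr add0r.
by rewrite mulr0 addr0; case: ifP => // _; rewrite subrr normr0.
Qed.

Lemma coord_near (x : V) (e : R) : 0 < e ->
  \forall y \near x, forall j, `|(y : V) 0 j - x 0 j| < e.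
Proof.
move=> e0; apply: (@filter_forall _ _ _ (nbhs x) (nbhs_filter x)) => j.
have /cvgrPdist_lt /(_ _ e0) := @coord_continuous R 1 n 0 j x.
by apply: filterS => y; rewrite distrC.
Qed.

Lemma sum_dist_near (x : V) (e : R) : 0 < e ->
  \forall y \near x, \sum_j `|(y : V) 0 j - x 0 j| < e.
Proof.
move=> e0; have e1 : 0 < e / n.+1%:R by rewrite divr_gt0.
apply: filterS (coord_near x e1) => y hy.
rewrite (@le_lt_trans _ _ (\sum_(j < n) e / n.+1%:R))//.
  by apply: ler_sum => j _; exact/ltW.
rewrite sumr_const card_ord -[ltLHS]mulr_natr mulrAC ltr_pdivrMr//.
by rewrite ltr_pM2l// ltr_nat.
Qed.

Lemma continuous_lipschitz_rV h (B : R) : 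
  (forall x y, `|h y - h x| <= B * \sum_j `|y 0 j - x 0 j|) -> continuous h.
Proof.
move=> hB x; apply: (@cvgrPdist_lt _ _ _ (nbhs x) (nbhs_filter x) h (h x)).2 => e e0.
have e1 : 0 < e / (`|B| + 1) by rewrite divr_gt0// ltr_wpDl.
apply: filterS (sum_dist_near x e1) => y hy.
rewrite distrC (le_lt_trans (hB _ _))//.
rewrite (@le_lt_trans _ _ ((`|B| + 1) * \sum_j `|y 0 j - x 0 j|))//.
  rewrite ler_wpM2r ?sumr_ge0// (le_trans (ler_norm _))// lerDl//.
by rewrite mulrC -ltr_pdivlMr// ltr_wpDl.
Qed.

Lemma continuous_bounded_partials h (B : R) :
  (forall i z, derivable h z 'e_i) -> (forall i z, `|'D_('e_i) h z| <= B) ->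
  continuous h.
Proof.
move=> dh hB; apply: (@continuous_lipschitz_rV _ B) => x y.
by apply: lipschitz_rV => // i z _; exact: hB.
Qed.

Lemma pderiv_rcons s i h : pderiv (rcons s i) h = pderiv s ('D_('e_i) h).
Proof. by rewrite /pderiv foldr_rcons. Qed.

Lemma pderiv_cat s1 s2 h : pderiv (s1 ++ s2) h = pderiv s1 (pderiv s2 h).
Proof. by rewrite /pderiv foldr_cat. Qed.

Lemma smooth_pderiv s h : smooth h -> smooth (pderiv s h).
Proof. by move=> sh t; rewrite -pderiv_cat; exact: sh. Qed.

Lemma cpderiv_cons i s f : cpderiv (i :: s) f = D i (cpderiv s f).
Proof. by []. Qed.

Lemma cpderiv_cat s1 s2 f : cpderiv (s1 ++ s2) f = cpderiv s1 (cpderiv s2 f).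
Proof. by apply/funext => x; rewrite /cpderiv !pderiv_cat. Qed.

Lemma cpderiv_rcons s i f : cpderiv (rcons s i) f = cpderiv s (D i f).
Proof. by rewrite -cats1 cpderiv_cat. Qed.

Lemma cpderiv_nil f : cpderiv [::] f = f.
Proof. by apply/funext => x; rewrite /cpderiv /=; case: (f x). Qed.

Lemma csmooth_cpderiv s f : csmooth f -> csmooth (cpderiv s f).
Proof. by move=> [f1 f2]; split; exact: smooth_pderiv. Qed.

Definition cderivable f := forall i x, derivable (@complex.Re R \o f) x 'e_i /\
  derivable (@complex.Im R \o f) x 'e_i.

Lemma csmooth_cderivable f : csmooth f -> cderivable f.
Proof. by move=> [f1 f2] i x; split; [exact: (f1 [::]).2|exact: (f2 [::]).2]. Qed.

Lemma lipschitz_norm1 f (x y : V) (B : R) : cderivable f ->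
  (forall i z, hull x y z -> norm1 (D i f z) <= B) ->
  norm1 (f y - f x) <= 2 * B * \sum_j `|y 0 j - x 0 j|.
Proof.
move=> df fB; rewrite /norm1 cReD cImD cReN cImN -mulrA mulr_natl mulr2n lerD//.
  apply: (@lipschitz_rV (@complex.Re R \o f)); first by move=> i z; exact: (df i z).1.
  by move=> i z /(fB i); apply: le_trans (ler_Re_norm1 _).
apply: (@lipschitz_rV (@complex.Im R \o f)); first by move=> i z; exact: (df i z).2.
by move=> i z /(fB i); apply: le_trans (ler_Im_norm1 _).
Qed.

(** The mean value theorem is applied twice, the second time to the first derivative. The factor 2
    adds up the real and imaginary parts. *)
Lemma taylor_norm1 f i x (t B : R) : csmooth f ->
  (forall c, `|c| <= `|t| -> norm1 (D i (D i f) (x + c *: 'e_i)) <= B) ->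
  norm1 (f (x + t *: 'e_i) - f x - t%:C * D i f x) <= 2 * t ^+ 2 * B.
Proof.
move=> sf fB; have df := csmooth_cderivable sf.
have Q (P : R[i] -> R) : (forall z, `|P z| <= norm1 z) ->
    smooth (P \o f) -> (forall y, 'D_('e_i) (P \o f) y = P (D i f y)) ->
    (forall y, 'D_('e_i) (P \o D i f) y = P (D i (D i f) y)) ->
    `|P (f (x + t *: 'e_i)) - P (f x) - t * P (D i f x)| <= t ^+ 2 * B.
  move=> Pn sP P1 P2.
  have [c ct ->] := mean_value_line x t (fun y => (sP [::]).2 i y).
  have dP y : derivable (P \o D i f) y 'e_i.
    have -> : P \o D i f = pderiv [:: i] (P \o f) by apply/funext => z /=; rewrite -P1.
    exact: (sP [:: i]).2.
  rewrite P1 -mulrBr; have [c' c't e] := mean_value_line x c dP.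
  rewrite [X in t * X]e normrM -real_normK ?num_real// expr2 -!mulrA ler_wpM2l//.
  rewrite normrM ler_pM// P2 (le_trans (Pn _))// fB//.
  exact: le_trans ct.
rewrite /norm1 !cReD !cImD !cReN !cImN !cReM !cImM /= !mul0r subr0 addr0.
rewrite -mulrA mulr_natl mulr2n lerD//.
  by apply: (Q (@complex.Re R)) => //; [exact: ler_Re_norm1|exact: sf.1].
by apply: (Q (@complex.Im R)) => //; [exact: ler_Im_norm1|exact: sf.2].
Qed.

Lemma cderive_quadratic f i x (L : R[i]) (C : R) :
  (forall t, `|t| <= 1 -> norm1 (f (x + t *: 'e_i) - f x - t%:C * L) <= t ^+ 2 * C) ->
  [/\ derivable (@complex.Re R \o f) x 'e_i, derivable (@complex.Im R \o f) x 'e_i &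
      D i f x = L].
Proof.
move=> fC.
have d1 : is_derive x 'e_i (@complex.Re R \o f) (complex.Re L).
  apply: (@is_derive_quadratic _ _ _ _ _ C) => t t1; apply: le_trans (fC t t1).
  apply: le_trans (ler_Re_norm1 _).
  by rewrite !cReD !cReN cReM/= mul0r subr0.
have d2 : is_derive x 'e_i (@complex.Im R \o f) (complex.Im L).
  apply: (@is_derive_quadratic _ _ _ _ _ C) => t t1; apply: le_trans (fC t t1).
  apply: le_trans (ler_Im_norm1 _).
  by rewrite !cImD !cImN cImM/= mul0r addr0.
split; [exact: ex_derive|exact: ex_derive|].
by rewrite /cpderiv/= !derive_val; case: (L).
Qed.

(** A coinduction principle: a class of functions that is stable under partial derivatives, all of
    them bounded, consists of smooth functions. Boundedness of the partial derivatives supplies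
    continuity at each order. *)
Lemma csmooth_coind (P : (V -> R[i]) -> Prop) :
  (forall f, P f -> [/\ cderivable f, exists B, forall i x, norm1 (D i f x) <= B &
    forall i, P (D i f)]) ->
  forall f, P f -> csmooth f /\ forall s, P (cpderiv s f).
Proof.
move=> coP f Pf.
have Ps s : P (cpderiv s f).
  elim: s => [|i s IH]; first by rewrite cpderiv_nil.
  by rewrite cpderiv_cons; have [_ _] := coP _ IH.
split => //; split=> s; have [ds [B sB] _] := coP _ (Ps s); split.
- apply: (@continuous_bounded_partials _ B); first by move=> i z; exact: (ds i z).1.
  by move=> i z; exact: le_trans (ler_Re_norm1 _) (sB i z).
- by move=> i x; exact: (ds i x).1.
- apply: (@continuous_bounded_partials _ B); first by move=> i z; exact: (ds i z).2.
  by move=> i z; exact: le_trans (ler_Im_norm1 _) (sB i z).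
- by move=> i x; exact: (ds i x).2.
Qed.

End calculus_rV.

(** * Products, inverses and the Leibniz rule for smooth functions *)

Section smooth_functions.
Variables (R : realType) (n : nat).
Local Notation V := 'rV[R]_n.
Implicit Types (h : V -> R) (f g : V -> R[i]) (s : seq 'I_n).
Local Notation "'e_ i" := (delta_mx 0 i : V) (at level 8, i at level 2, format "''e_' i").
Local Notation D i f := (cpderiv [:: i] f).

(* C^k regularity, by recursion on k rather than on lists of directions. *)
Fixpoint Ck k h : Prop := continuous h /\
  (if k is k'.+1 then
    forall i, (forall x, derivable h x 'e_i) /\ Ck k' ('D_('e_i) h) else True).

(** In [pderiv] the last direction of the list is differentiated first, whereas [Ck] begins with the
    first derivative taken; hence the induction from the end of the list. *)
Lemma smooth_Ck h : smooth h <-> forall k, Ck k h.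
Proof.
split=> [sh k|ch s].
  elim: k h sh => [|k IH] h sh; split; do ?exact: (sh [::]).1.
    by [].
  move=> i; split; first exact: (sh [::]).2.
  by apply: IH => s; rewrite -pderiv_rcons; exact: sh.
elim/last_ind: s h ch => [|s i IH] h ch.
  by split; [exact: (ch 0).1|move=> i x; exact: ((ch 1).2 i).1].
by rewrite pderiv_rcons; apply: IH => k; exact: ((ch k.+1).2 i).2.
Qed.

Lemma CkW k h : Ck k.+1 h -> Ck k h.
Proof.
elim: k h => [|k IH] h [ch dh]; split => // i; split; first exact: (dh i).1.
by apply: IH; exact: (dh i).2.
Qed.

Lemma CkD k h1 h2 : Ck k h1 -> Ck k h2 -> Ck k (h1 \+ h2).
Proof.
elim: k h1 h2 => [|k IH] h1 h2 [c1 d1] [c2 d2]; split => //.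
- by move=> x; apply: continuousD; [exact: c1|exact: c2].
- by move=> x; apply: continuousD; [exact: c1|exact: c2].
move=> i; split; first by move=> x; apply: derivableD; [exact: (d1 i).1|exact: (d2 i).1].
rewrite (_ : 'D_('e_i) _ = 'D_('e_i) h1 \+ 'D_('e_i) h2).
  by apply: IH; [exact: (d1 i).2|exact: (d2 i).2].
by apply/funext => x; rewrite deriveD//; [exact: (d1 i).1|exact: (d2 i).1].
Qed.

Lemma CkM k h1 h2 : Ck k h1 -> Ck k h2 -> Ck k (fun x => h1 x * h2 x).
Proof.
elim: k h1 h2 => [|k IH] h1 h2 H1 H2; have [c1 d1] := H1; have [c2 d2] := H2; split => //.
- by move=> x; apply: continuousM; [exact: c1|exact: c2].
- by move=> x; apply: continuousM; [exact: c1|exact: c2].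
move=> i; split.
  by move=> x; apply: derivableM; [exact: (d1 i).1|exact: (d2 i).1].
rewrite (_ : 'D_('e_i) _ = (fun x => h1 x * 'D_('e_i) h2 x) \+
    (fun x => h2 x * 'D_('e_i) h1 x)).
  by apply: CkD; apply: IH; do ?exact: CkW; [exact: (d2 i).2|exact: (d1 i).2].
by apply/funext => x; rewrite deriveM//; [exact: (d1 i).1|exact: (d2 i).1].
Qed.

Lemma Ck_cst k (c : R) : Ck k (fun=> c).
Proof.
elim: k c => [|k IH] c; split => //; do ?by move=> x; exact: cst_continuous.
move=> i; split; first by move=> x; exact: derivable_cst.
rewrite (_ : 'D_('e_i) _ = fun=> 0); first exact: IH.
by apply/funext => x; rewrite derive_cst.
Qed.

Lemma CkV k h : (forall x, h x != 0) -> Ck k h -> Ck k (fun x => (h x)^-1).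
Proof.
move=> h0; elim: k => [|k IH] H; have [ch dh] := H; split => //.
- by move=> x; apply: continuousV; [exact: h0|exact: ch].
- by move=> x; apply: continuousV; [exact: h0|exact: ch].
move=> i; split; first by move=> x; apply: derivableV => //; exact: (dh i).1.
rewrite (_ : 'D_('e_i) _ = fun x => -1 * ((h x)^-1 * (h x)^-1 * 'D_('e_i) h x)).
  have Hk := IH (CkW H).
  apply: CkM; first exact: Ck_cst.
  by apply: CkM; [exact: CkM|exact: (dh i).2].
apply/funext => x; rewrite deriveV//; last exact: (dh i).1.
by rewrite mulN1r -mulNr -expr2 exprVn.
Qed.

Lemma smoothM h1 h2 : smooth h1 -> smooth h2 -> smooth (fun x => h1 x * h2 x).
Proof.
by move=> /smooth_Ck c1 /smooth_Ck c2; apply/smooth_Ck => k; exact: CkM.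
Qed.

Lemma smooth_cst (c : R) : @smooth R n (fun=> c).
Proof. by apply/smooth_Ck => k; exact: Ck_cst. Qed.

Lemma smoothV h : (forall x, h x != 0) -> smooth h -> smooth (fun x => (h x)^-1).
Proof. by move=> h0 /smooth_Ck c; apply/smooth_Ck => k; exact: CkV. Qed.

Lemma smooth_prod I (r : seq I) (F : I -> V -> R) : (forall i, smooth (F i)) ->
  smooth (fun x => \prod_(i <- r) F i x).
Proof.
move=> sF; elim: r => [|i r IH].
  by under eq_fun do rewrite big_nil; exact: smooth_cst.
by under eq_fun do rewrite big_cons; exact: smoothM.
Qed.

Lemma csmooth_real h : smooth h -> csmooth (ofreal h).
Proof. by move=> sh; split; [exact sh|exact (@smooth0 R n)]. Qed.

Lemma csmooth_cst (c : R[i]) : @csmooth R n (fun=> c).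
Proof. by split; exact: smooth_cst. Qed.

Lemma smoothBM h1 h2 h3 h4 : smooth h1 -> smooth h2 -> smooth h3 -> smooth h4 ->
  smooth ((fun x => h1 x * h2 x) \+ (fun x => -1 * (h3 x * h4 x))).
Proof. by move=> s1 s2 s3 s4; exact (smoothD (smoothM s1 s2) (smoothZ (-1) (smoothM s3 s4))). Qed.

Lemma smoothDM h1 h2 h3 h4 : smooth h1 -> smooth h2 -> smooth h3 -> smooth h4 ->
  smooth ((fun x => h1 x * h2 x) \+ (fun x => h3 x * h4 x)).
Proof. by move=> s1 s2 s3 s4; exact (smoothD (smoothM s1 s2) (smoothM s3 s4)). Qed.

Lemma csmoothM f g : csmooth f -> csmooth g -> csmooth (fun x => f x * g x).
Proof.
move=> [f1 f2] [g1 g2]; split.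
  rewrite (_ : _ \o _ = (fun x => (@complex.Re R \o f) x * (@complex.Re R \o g) x) \+
      (fun x => -1 * ((@complex.Im R \o f) x * (@complex.Im R \o g) x))).
    exact (smoothBM f1 g1 f2 g2).
  by apply/funext => x /=; rewrite cReM mulN1r.
rewrite (_ : _ \o _ = (fun x => (@complex.Re R \o f) x * (@complex.Im R \o g) x) \+
    (fun x => (@complex.Im R \o f) x * (@complex.Re R \o g) x)).
  exact (smoothDM f1 g2 f2 g1).
by apply/funext => x /=; rewrite cImM.
Qed.

(** The inverse is the conjugate divided by the squared modulus [q], a nonvanishing smooth real
    function. *)
Lemma csmoothV f : (forall x, f x != 0) -> csmooth f -> csmooth (fun x => (f x)^-1).
Proof.
move=> f0 [f1 f2].
pose q := (fun x => (@complex.Re R \o f) x * (@complex.Re R \o f) x) \+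
  (fun x => (@complex.Im R \o f) x * (@complex.Im R \o f) x).
have sq : smooth q by exact (smoothDM f1 f1 f2 f2).
have qE x : q x = complex.Re (f x) ^+ 2 + complex.Im (f x) ^+ 2 by rewrite !expr2.
have q0 x : q x != 0.
  have := f0 x; apply: contraNneq.
  rewrite qE => /eqP; rewrite paddr_eq0 ?sqr_ge0// !sqrf_eq0 => /andP[/eqP a /eqP b].
  exact/eqP/complexP.
have sV := smoothV q0 sq; split.
  rewrite (_ : _ \o _ = (fun x => (@complex.Re R \o f) x * (fun x => (q x)^-1) x)).
    exact (smoothM f1 sV).
  by apply/funext => x /=; rewrite qE; case: (f x).
rewrite (_ : _ \o _ = (fun x => -1 * ((fun x => (@complex.Im R \o f) x * (fun x => (q
  x)^-1) x) x))).
  exact (smoothZ (-1) (smoothM f2 sV)).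
by apply/funext => x /=; rewrite qE; case: (f x) => a b /=; rewrite mulN1r.
Qed.

Lemma is_deriveMM h1 h2 h3 h4 (x v : V) (d1 d2 d3 d4 c : R) :
  is_derive x v h1 d1 -> is_derive x v h2 d2 ->
  is_derive x v h3 d3 -> is_derive x v h4 d4 ->
  'D_v (fun x => h1 x * h2 x + c * (h3 x * h4 x)) x =
  h1 x * d2 + h2 x * d1 + c * (h3 x * d4 + h4 x * d3).
Proof.
move=> D1 D2 D3 D4.
have D := is_deriveD (is_deriveM D1 D2) (is_deriveZ c (is_deriveM D3 D4)).
exact: (@derive_val _ _ _ _ _ _ _ D).
Qed.

Lemma cpderivM f g i : csmooth f -> csmooth g ->
  D i (fun x => f x * g x) = (fun x => D i f x * g x + f x * D i g x).
Proof.
move=> sf sg; apply/funext => x.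
have [f1 f2] := csmooth_cderivable sf i x; have [g1 g2] := csmooth_cderivable sg i x.
have F1 := DeriveDef f1 erefl; have F2 := DeriveDef f2 erefl.
have G1 := DeriveDef g1 erefl; have G2 := DeriveDef g2 erefl.
apply: complexP; rewrite ?cReD ?cImD ?cReM ?cImM /=.
  rewrite (_ : _ \o _ = (fun x => (@complex.Re R \o f) x * (@complex.Re R \o g) x +
      -1 * ((@complex.Im R \o f) x * (@complex.Im R \o g) x))).
    by rewrite (is_deriveMM (-1) F1 G1 F2 G2) /=; ring.
  by apply/funext => y /=; rewrite cReM mulN1r.
rewrite (_ : _ \o _ = (fun x => (@complex.Re R \o f) x * (@complex.Im R \o g) x +
    1 * ((@complex.Im R \o f) x * (@complex.Re R \o g) x))).
  by rewrite (is_deriveMM 1 F1 G2 F2 G1) /=; ring.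
by apply/funext => y /=; rewrite cImM mul1r.
Qed.

End smooth_functions.

(** * Weighted seminorms of the Schwartz class *)

Section seminorms.
Variables (R : realType) (n : nat).
Local Notation V := 'rV[R]_n.
Implicit Types (h : V -> R) (f g : V -> R[i]) (a s : seq 'I_n).
Local Notation "'e_ i" := (delta_mx 0 i : V) (at level 8, i at level 2, format "''e_' i").
Local Notation D i f := (cpderiv [:: i] f).

(** The product form has three virtues: powers of [weight] expand into monomials, its inverse is
    integrable in every dimension as a product of Cauchy kernels, and [2 ^+ n / weight] is the
    transform of the Abel kernel. *)
Definition weight (x : V) : R := \prod_i (1 + x 0 i ^+ 2).

Lemma factor_ge1 (t : R) : 1 <= 1 + t ^+ 2.
Proof. by rewrite lerDl sqr_ge0. Qed.

Lemma weight_ge1 x : 1 <= weight x.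
Proof.
rewrite /weight; elim/big_ind : _ => // [u v u1 v1|i _]; last exact: factor_ge1.
by rewrite -[leLHS]mulr1 ler_pM.
Qed.

Lemma weight_gt0 x : 0 < weight x.
Proof. exact: lt_le_trans (weight_ge1 x). Qed.

Lemma weight_ge0 x : 0 <= weight x. Proof. exact/ltW/weight_gt0. Qed.

Lemma ler_coord_weight (x : V) i : `|x 0 i| <= weight x.
Proof.
rewrite /weight (bigD1 i)//= -[leLHS]mulr1 ler_pM//.
  by rewrite -[X in _ + X]real_normK ?num_real//; have := normr_ge0 (x 0 i); nra.
elim/big_ind : _ => // [u v u1 v1|j _]; last exact: factor_ge1.
by rewrite -[leLHS]mulr1 ler_pM.
Qed.

Lemma ler_weight_exp x k l : (k <= l)%N -> weight x ^+ k <= weight x ^+ l.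
Proof. by move=> kl; rewrite ler_weXn2l// weight_ge1. Qed.

(** A Peetre-type inequality. In each coordinate, 2 (1 + x^2) (1 + y^2) - (1 + (x + y)^2) = 1 + (x -
    y)^2 + 2 x^2 y^2. *)
Lemma ler_weight_shift x y : weight (x + y) <= 2 ^+ n * weight x * weight y.
Proof.
rewrite /weight -mulrA -{7}[n]card_ord -prodr_const -!big_split/=.
apply: ler_prod => i _; rewrite addr_ge0//= ?sqr_ge0// !mxE.
have := sqr_ge0 (x 0 i - y 0 i); have := sqr_ge0 (x 0 i * y 0 i).
by rewrite !expr2; nra.
Qed.

Lemma ler_norm_monomial a x : `|monomial a x| <= weight x ^+ size a.
Proof.
rewrite /monomial; elim: a => [|i a IH]; first by rewrite big_nil normr1.
by rewrite big_cons exprS normrM ler_pM// ler_coord_weight.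
Qed.

Lemma weight_exp_prod k x :
  weight x ^+ k = \prod_(i <- flatten (nseq k (index_enum 'I_n))) (1 + x 0 i ^+ 2).
Proof.
elim: k => [|k IH]; first by rewrite big_nil.
by rewrite exprS /= big_cat -IH.
Qed.

(* weight ^ k is a sum of 2^(n k) monomials of degree at most 2 n k. *)
Lemma weight_exp_monomials k x (z : R[i]) (e : R) :
  (forall a, (size a <= 2 * (n * k))%N -> norm1 ((monomial a x)%:C * z) <= e) ->
  weight x ^+ k * norm1 z <= 2 ^+ (n * k) * e.
Proof.
rewrite weight_exp_prod => ze.
have: size (flatten (nseq k (index_enum 'I_n))) = (n * k)%N.
  rewrite size_flatten /shape map_nseq sumn_nseq.
  by rewrite /index_enum -enumT size_enum_ord.
move: (flatten _) => L sL; rewrite -sL in ze *.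
have {}ze a : (size a <= 2 * size L)%N -> `|monomial a x| * norm1 z <= e.
  by rewrite -norm1Z; exact: ze.
(* Generalised over a monomial [a] already extracted: each factor 1 + x_i^2 either leaves [a] as it
   is or prepends [i] twice. *)
suff H K : (forall a, (size a <= K)%N -> `|monomial a x| * norm1 z <= e) ->
    forall a, (size a + 2 * size L <= K)%N ->
    \prod_(i <- L) (1 + x 0 i ^+ 2) * (`|monomial a x| * norm1 z) <= 2 ^+ size L * e.
  by have := H _ ze [::] (leqnn _); rewrite /monomial big_nil normr1 mul1r.
elim: L {sL ze} => [|i L IH] zK a aK.
  by rewrite big_nil !mul1r zK// (leq_trans _ aK)// leq_addr.
have h1 := IH zK a; have h2 := IH zK [:: i, i & a].
have -> : \prod_(j <- i :: L) (1 + x 0 j ^+ 2) * (`|monomial a x| * norm1 z) =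
    \prod_(j <- L) (1 + x 0 j ^+ 2) * (`|monomial a x| * norm1 z) +
    \prod_(j <- L) (1 + x 0 j ^+ 2) * (`|monomial [:: i, i & a] x| * norm1 z).
  rewrite /monomial !big_cons !normrM [`|x 0 i| * (`|x 0 i| * _)]mulrA -expr2.
  by rewrite real_normK ?num_real//; ring.
rewrite /= exprS -mulrA [2 * _]mulr_natl mulr2n lerD//.
  by apply: h1; rewrite (leq_trans _ aK)//= leq_add2l leq_mul2l leqnSn orbT.
by apply: h2; rewrite (leq_trans _ aK)//= mulnS addnA addn2 !addSn.
Qed.

(** The Schwartz seminorms, indexed by one integer and stated as upper bounds instead of suprema.
    They increase with [k] ([bounded_by_le]) and are equivalent to those of the topology
    ([schwartz_bounded_by], [bounded_by_schwartz]). *)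
Definition bounded_by (k : nat) (e : R) f := forall s, (size s <= k)%N ->
  forall x, weight x ^+ k * norm1 (cpderiv s f x) <= e.

Lemma bounded_by_ge0 k e f : bounded_by k e f -> 0 <= e.
Proof.
move=> /(_ [::] isT 0); apply: le_trans.
by rewrite mulr_ge0 ?norm1_ge0// exprn_ge0// weight_ge0.
Qed.

Lemma bounded_by_le k k' e e' f : (k <= k')%N -> e <= e' ->
  bounded_by k' e f -> bounded_by k e' f.
Proof.
move=> kk ee fb s sk x; rewrite (le_trans _ ee)// (le_trans _ (fb s (leq_trans sk kk) x))//.
by rewrite ler_wpM2r ?norm1_ge0// ler_weight_exp.
Qed.

Lemma bounded_by_norm1 k e f s x : (size s <= k)%N -> bounded_by k e f ->
  norm1 (cpderiv s f x) <= e / weight x ^+ k.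
Proof.
move=> sk fb; rewrite ler_pdivlMr ?exprn_gt0 ?weight_gt0// mulrC.
exact: fb.
Qed.

Lemma bounded_by_D k e f i : bounded_by k.+1 e f -> bounded_by k e (D i f).
Proof.
move=> fb s sk x; rewrite -cpderiv_rcons.
apply: le_trans (fb (rcons s i) _ x); last by rewrite size_rcons.
by rewrite ler_wpM2r ?norm1_ge0// ler_weight_exp.
Qed.

Lemma schwartz_bounded_by k (e : R) f :
  (forall a s, (size a <= 2 * (n * k))%N -> (size s <= k)%N -> forall x,
    `|(monomial a x)%:C * cpderiv s f x| <= e%:C) ->
  bounded_by k (2 ^+ (n * k) * (2 * e)) f.
Proof.
move=> fb s sk x; apply: weight_exp_monomials => a ak.
exact/ler_norm1_normC/fb.
Qed.

Lemma bounded_by_schwartz k (e : R) f : bounded_by k e f ->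
  forall a s, (size a <= k)%N -> (size s <= k)%N -> forall x,
    `|(monomial a x)%:C * cpderiv s f x| <= e%:C.
Proof.
move=> fb a s ak sk x; rewrite (le_trans (ler_normC_norm1 _))// lecR norm1Z.
apply: le_trans (fb s sk x); rewrite ler_wpM2r ?norm1_ge0//.
exact: le_trans (ler_norm_monomial _ _) (ler_weight_exp _ ak).
Qed.

Lemma is_schwartzP f : is_schwartz f <-> csmooth f /\ forall k, exists e, bounded_by k e f.
Proof.
split=> -[sf fb]; split => //; last first.
  move=> a s; have [e fe] := fb (maxn (size a) (size s)).
  by exists e => x; apply: bounded_by_schwartz fe _ _ _ _ _; rewrite ?leq_maxl ?leq_maxr.
move=> k; have /choice [M] : forall p : seq 'I_n * seq 'I_n, exists e : R, forall x,
    `|(monomial p.1 x)%:C * cpderiv p.2 f x| <= e%:C.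
  by move=> [a s]; exact: fb.
move=> MP.
have M0 p : 0 <= M p.
  by rewrite -lecR; apply: le_trans (MP p 0); exact: normr_ge0.
(* There are finitely many multi-indices of bounded length, and the sum of their bounds dominates
   each of them. *)
exists (2 ^+ (n * k) * (2 *
  \sum_(a : (2 * (n * k)).-bseq 'I_n) \sum_(s : k.-bseq 'I_n) M (val a, val s))).
apply: schwartz_bounded_by => a s ak sk x.
rewrite (le_trans (MP (a, s) x))// lecR.
rewrite (bigD1 (Bseq ak))//= (bigD1 (Bseq sk))//= -addrA lerDl.
by rewrite addr_ge0// sumr_ge0// => *; rewrite sumr_ge0.
Qed.

Lemma bounded_byZ k e (c : R[i]) f : csmooth f ->
  bounded_by k e f -> bounded_by k (norm1 c * e) (c *: f).
Proof.
move=> sf bf s sk x; rewrite cpderivZ//.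
apply: (@le_trans _ _ (weight x ^+ k * (norm1 c * norm1 (cpderiv s f x)))).
  by rewrite ler_wpM2l ?exprn_ge0 ?weight_ge0// ler_norm1M.
by rewrite mulrCA ler_wpM2l ?norm1_ge0// bf.
Qed.

(** Monotonicity of [P] lets the maximum of the indices and the sum of the absolute values of the
    constants serve for all [i]. *)
Lemma finite_uniform_bound (I : finType) (P : I -> nat -> R -> Prop) :
  (forall i k k' C C', (k <= k')%N -> C <= C' -> P i k C -> P i k' C') ->
  (forall i, exists k C, P i k C) -> exists k C, 0 <= C /\ forall i, P i k C.
Proof.
move=> Pmono /choice [K] /choice [C PC].
exists (\max_i K i), (\sum_i `|C i|); split; first exact: sumr_ge0.
move=> i; apply: Pmono (PC i); first exact: leq_bigmax.
by rewrite (le_trans (ler_norm _))// (bigD1 i)//= lerDl sumr_ge0.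
Qed.

(** Leibniz rule for multipliers whose derivatives grow polynomially. The bounds are uniform in the
    parameter [t], which [test_dense] needs for a family of dilated cutoffs. *)
Lemma bounded_byM T (m : T -> V -> R[i]) : (forall t, csmooth (m t)) ->
  (forall s, exists p (C : R), forall t x, norm1 (cpderiv s (m t) x) <= C * weight x ^+ p) ->
  forall k, exists k' (C : R), 0 <= C /\ forall t f e, csmooth f -> bounded_by k' e f ->
    bounded_by k (C * e) (fun x => m t x * f x).
Proof.
(* The number [j] of derivatives is separated from the power [k] of the weight, and [m] stays
   general because the induction also uses its partial derivatives as multipliers. *)
suff H j : forall (m : T -> V -> R[i]), (forall t, csmooth (m t)) ->
  (forall s, exists p (C : R), forall t x, norm1 (cpderiv s (m t) x) <= C * weight x ^+ p) ->
  forall k, exists k' (C : R), 0 <= C /\ forall t f e, csmooth f -> bounded_by k' e f ->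
    forall s, (size s <= j)%N -> forall x,
    weight x ^+ k * norm1 (cpderiv s (fun x => m t x * f x) x) <= C * e.
  move=> sm bm k; have [k' [C [C0 h]]] := H k m sm bm k.
  by exists k', C; split => // t f e sf bf s sk x; exact: h.
elim: j => [|j IH] {}m sm bm k.
  have [p [C mC]] := bm [::]; exists (k + p)%N, `|C|; split => // t f e sf bf s.
  rewrite leqn0 size_eq0 => /eqP -> x; rewrite cpderiv_nil.
  have := mC t x; rewrite cpderiv_nil => mx.
  have := bf [::] isT x; rewrite cpderiv_nil exprD => fx.
  rewrite (@le_trans _ _ (weight x ^+ k * (`|C| * weight x ^+ p * norm1 (f x))))//.
    rewrite ler_wpM2l ?exprn_ge0 ?weight_ge0// (le_trans (ler_norm1M _ _))//.
    rewrite ler_wpM2r ?norm1_ge0// (le_trans mx)// ler_wpM2r ?exprn_ge0 ?weight_ge0//.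
    exact: ler_norm.
  rewrite (_ : weight x ^+ k * _ = `|C| * (weight x ^+ k * weight x ^+ p * norm1 (f x))).
    by rewrite ler_wpM2l.
  by ring.
have [k0 [C0 [C00 H0]]] := IH m sm bm k.
have /(@finite_uniform_bound 'I_n) [|k1 [C1 [C10 H1]]] : forall i, exists k' (C : R),
    0 <= C /\ forall t f e, csmooth f -> bounded_by k' e f ->
    forall s, (size s <= j)%N -> forall x,
    weight x ^+ k * norm1 (cpderiv s (fun x => D i (m t) x * f x) x) <= C * e.
- move=> i; apply: (IH (fun t => D i (m t))).
    by move=> t; exact: csmooth_cpderiv.
  by move=> s; have [p [C pC]] := bm (rcons s i); exists p, C => t x; rewrite -cpderiv_rcons.
- move=> i k1 k2 C1 C2 k12 C12 [C1_0 h]; split; first exact: le_trans C12.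
  move=> t f e sf bf s sj x.
  have e0 := bounded_by_ge0 bf.
  rewrite (le_trans (h t f e sf _ s sj x))// ?ler_wpM2r//.
  exact: bounded_by_le bf.
exists (maxn k0.+1 k1), (C0 + C1); split; first exact: addr_ge0.
move=> t f e sf bf s sj x; have e0 := bounded_by_ge0 bf.
have b0 : bounded_by k0.+1 e f by apply: bounded_by_le bf => //; exact: leq_maxl.
have b1 : bounded_by k1 e f by apply: bounded_by_le bf => //; exact: leq_maxr.
case/lastP : s sj => [_|s i].
  rewrite (le_trans (H0 t f e sf _ [::] isT x))//; last by rewrite ler_wpM2r// lerDl.
  exact: bounded_by_le b0.
rewrite size_rcons ltnS => sj; rewrite cpderiv_rcons cpderivM//.
rewrite (_ : (fun x => _) = (fun x => D i (m t) x * f x) + (fun x => m t x * D i f x))//.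
rewrite cpderivD; last 2 first.
- exact (csmoothM (csmooth_cpderiv [:: i] (sm t)) sf).
- exact (csmoothM (sm t) (csmooth_cpderiv [:: i] sf)).
rewrite (@le_trans _ _ (weight x ^+ k *
  (norm1 (cpderiv s (fun x => D i (m t) x * f x) x) +
   norm1 (cpderiv s (fun x => m t x * D i f x) x))))//.
  by rewrite ler_wpM2l ?exprn_ge0 ?weight_ge0// ler_norm1D.
rewrite mulrDr [C0 + C1]addrC mulrDl lerD//.
  exact: (H1 i).2.
exact (H0 t _ e (csmooth_cpderiv [:: i] sf) (bounded_by_D i b0) s sj x).
Qed.

(** Operators act on bare functions, so that they compose before being packaged as elements of
    [schwartz]. Linearity is stated apart, in [linear_on_schwartz]. *)
Definition continuous_operator (T : (V -> R[i]) -> V -> R[i]) :=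
  (forall f, is_schwartz f -> csmooth (T f)) /\
  forall k, exists k' (C : R), 0 <= C /\ forall f e, is_schwartz f ->
    bounded_by k' e f -> bounded_by k (C * e) (T f).

Lemma operator_schwartz T f : continuous_operator T -> is_schwartz f -> is_schwartz (T f).
Proof.
move=> [sT bT] sf; apply/is_schwartzP; split; first exact: sT.
move=> k; have [k' [C [C0 h]]] := bT k.
by have [_ /(_ k')[e fe]] := (is_schwartzP f).1 sf; exists (C * e); exact: h.
Qed.

Lemma operator_comp T1 T2 : continuous_operator T1 -> continuous_operator T2 ->
  continuous_operator (T1 \o T2).
Proof.
move=> c1 c2; split; first by move=> f sf /=; apply: c1.1; exact: operator_schwartz.
move=> k; have [k1 [C1 [C10 h1]]] := c1.2 k; have [k2 [C2 [C20 h2]]] := c2.2 k1.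
exists k2, (C1 * C2); split; first exact: mulr_ge0.
move=> f e sf bf /=; rewrite -mulrA; apply: h1; first exact: operator_schwartz.
exact: h2.
Qed.

Lemma operator_id : continuous_operator id.
Proof.
split; first by move=> f [].
by move=> k; exists k, 1; split => // f e _; rewrite mul1r.
Qed.

Lemma operator_D i : continuous_operator (cpderiv [:: i]).
Proof.
split; first by move=> f [sf _]; exact: csmooth_cpderiv.
move=> k; exists k.+1, 1; split => // f e _ bf; rewrite mul1r.
exact: bounded_by_D.
Qed.

Lemma operatorM (m : V -> R[i]) : csmooth m ->
  (forall s, exists p (C : R), forall x, norm1 (cpderiv s m x) <= C * weight x ^+ p) ->
  continuous_operator (fun f x => m x * f x).
Proof.
move=> sm bm; split; first by move=> f [sf _]; exact: csmoothM.
move=> k.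
have bm' s : exists p (C : R), forall (t : unit) x, norm1 (cpderiv s m x) <= C * weight x ^+ p.
  by have [p [C h]] := bm s; exists p, C.
have [k' [C [C0 h]]] := @bounded_byM unit (fun=> m) (fun=> sm) bm' k.
by exists k', C; split => // f e [sf _]; exact: (h tt).
Qed.

Lemma schwartz_operatorM (m : V -> R[i]) : is_schwartz m ->
  continuous_operator (fun f x => m x * f x).
Proof.
move=> /is_schwartzP[sm bm]; apply: operatorM => // s.
have [e me] := bm (size s); exists 0%N, e => x; rewrite mulr1.
rewrite (le_trans _ (me s (leqnn _) x))// ler_peMl ?norm1_ge0//.
by rewrite exprn_ege1// weight_ge1.
Qed.

Lemma operatorZ (c : R[i]) T : continuous_operator T ->
  continuous_operator (fun f => c *: T f).
Proof.
move=> cT; split; first by move=> f sf; apply: csmoothZ; exact: cT.1.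
move=> k; have [k1 [C1 [C10 h1]]] := cT.2 k.
exists k1, (norm1 c * C1); split; first by rewrite mulr_ge0// norm1_ge0.
move=> f e sf bf; rewrite -mulrA; apply: bounded_byZ; first exact: cT.1.
exact: h1.
Qed.

End seminorms.

(** * Grids *)

Section grid.
Variables (R : realType) (n : nat).
Local Notation V := 'rV[R]_n.

Section fineness.
Variable m : nat.

(** Mesh 1/(m+1) on the cube of half-side m+1. Outside the cube, [inord] and truncation return
    default values, which [grid_dist] excludes by its hypothesis. *)
Definition grid_index (t : R) : 'I_(2 * m.+1 * m.+1).+1 :=
  inord (Num.truncn ((t + m.+1%:R) * m.+1%:R)).

Definition grid_cell (x : V) : {ffun 'I_n -> 'I_(2 * m.+1 * m.+1).+1} :=
  [ffun j => grid_index (x 0 j)].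

Definition grid_point (q : {ffun 'I_n -> 'I_(2 * m.+1 * m.+1).+1}) : V :=
  \row_j ((q j)%:R / m.+1%:R - m.+1%:R).

Lemma grid_dist (x : V) : (forall j, `|x 0 j| < m.+1%:R) ->
  forall j, `|x 0 j - grid_point (grid_cell x) 0 j| <= m.+1%:R^-1.
Proof.
move=> xm j; rewrite mxE ffunE /grid_index.
have := xm j; rewrite ltr_norml => /andP[xl xr].
set t := x 0 j in xl xr *; set M : R := m.+1%:R in xl xr *.
have M0 : 0 < M by rewrite /M.
have tM : 0 <= (t + M) * M by rewrite mulr_ge0 ?(ltW M0)// -lerBlDr sub0r ltW.
have /andP[k1 k2] := truncn_itv tM.
set k := Num.truncn _ in k1 k2 *.
have kK : (k < (2 * m.+1 * m.+1).+1)%N.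
  rewrite ltnS -(ler_nat R) (le_trans k1)// !natrM -/M ler_pM2r//.
  by rewrite mulr_natl mulr2n lerD2r ltW.
rewrite inordK// opprD opprK addrCA addrC.
have -> : t + M - k%:R / M = ((t + M) * M - k%:R) / M by field; exact: lt0r_neq0.
rewrite normrM normfV (gtr0_norm M0) ger0_norm ?subr_ge0//.
rewrite -[leRHS]mul1r ler_pM2r ?invr_gt0//.
by rewrite lerBlDl -natr1 in k2 *; exact: ltW.
Qed.

Lemma measurable_truncn (l : nat) :
  measurable [set t : measurableTypeR R | Num.truncn ((t + m.+1%:R) * m.+1%:R) = l].
Proof.
pose A k := [set t : measurableTypeR R | (t + m.+1%:R) * m.+1%:R < k.+1%:R].
have mA k : measurable (A k).
  rewrite (_ : A k = (fun t : R => (t + m.+1%:R) * m.+1%:R) @^-1` `]-oo, k.+1%:R[%classic).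
    rewrite -[X in measurable X]setTI.
    have mf : measurable_fun setT (fun t : measurableTypeR R => (t + m.+1%:R) * m.+1%:R : R).
      by apply: measurable_funM => //; exact: measurable_funD.
    exact: mf.
  by apply/seteqP; split => t; rewrite /A /= in_itv.
case: l => [|l].
  rewrite (_ : [set _ | _] = A 0%N)//; apply/seteqP; split => t; rewrite /A/=.
    by move=> e; rewrite -truncn_le_nat e.
  by rewrite -truncn_le_nat leqn0 => /eqP.
rewrite (_ : [set _ | _] = A l.+1 `\` A l); first exact: measurableD.
apply/seteqP; split => t; rewrite /A/= -!truncn_le_nat.
  by move=> ->; split; rewrite ?leqnn// ltnn.
by move=> [h1 /negP]; rewrite -ltnNge => h2; apply/eqP; rewrite eqn_leq h1.
Qed.

Lemma measurable_grid_cell q : measurable [set x | grid_cell x = q].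
Proof.
have mi k : measurable [set t : measurableTypeR R | grid_index t = k].
  rewrite (_ : [set _ | _] = \bigcup_(l in [set l | inord l = k])
      [set t : measurableTypeR R | Num.truncn ((t + m.+1%:R) * m.+1%:R) = l]).
    by apply: bigcup_measurable => l _; exact: measurable_truncn.
  apply/seteqP; split => [t /= <-|t [l /= <- tl]].
    by exists (Num.truncn ((t + m.+1%:R) * m.+1%:R)).
  by rewrite /grid_index tl.
rewrite (_ : [set _ | _] = \big[setI/setT]_(j < n) (rV_coord j @^-1` [set t | grid_index t = q j])).
  apply: bigsetI_measurable => j _; rewrite -[X in measurable X]setTI.
  exact: measurable_rV_coord.
rewrite -bigcap_seq; apply/seteqP; split => x /=.
  by move=> <- j _ /=; rewrite ffunE.
move=> xq; apply/ffunP => j; rewrite ffunE; apply: xq.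
by rewrite /= mem_index_enum.
Qed.

Lemma grid_sum (U : zmodType) (F : V -> U) x :
  \sum_q (if grid_cell x == q then F (grid_point q) else 0) =
  F (grid_point (grid_cell x)).
Proof.
rewrite (bigD1 (grid_cell x))//= eqxx big1 ?addr0// => q.
by rewrite eq_sym => /negbTE ->.
Qed.

(** Sampling on the grid turns any [h] into a finite combination of indicators of measurable
    cells. *)
Lemma measurable_grid (h : V -> R) :
  measurable_fun setT (fun x => h (grid_point (grid_cell x))).
Proof.
rewrite (_ : (fun x => _) = fun x => \sum_q h (grid_point q) * \1_[set y | grid_cell y = q] x).
  apply: measurable_sum => q; apply: measurable_funM => //.
  apply: measurable_indic; exact: measurable_grid_cell.
apply/funext => x; rewrite -grid_sum; apply: eq_bigr => q _.
rewrite indicE; case: eqP => xq; first by rewrite mem_set// mulr1.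
by rewrite memNset// mulr0.
Qed.

End fineness.

Lemma near_of_coord (x : V) (A : set V) : nbhs x A ->
  exists2 e : R, 0 < e & forall y : V, (forall j, `|y 0 j - x 0 j| < e) -> A y.
Proof.
move=> /nbhs_ballP[e /= e0 xA]; exists e => // y yx.
by apply: xA; split => // i j; rewrite ord1 /ball/= distrC.
Qed.

Lemma large_nat (B : R) : \forall m \near \oo, B < m.+1%:R.
Proof.
exists (Num.truncn B) => // m /= Bm; rewrite (lt_le_trans (truncnS_gt B))//.
by rewrite ler_nat ltnS.
Qed.

Lemma grid_cvg (x : V) : grid_point (grid_cell m x) @[m --> \oo] --> x.
Proof.
move=> A /near_of_coord[e e0 xA].
suff h : \forall m \near \oo, A (grid_point (grid_cell m x)) by exact: h.
near=> m; apply: xA => j.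
have xm k : `|x 0 k| < m.+1%:R.
  rewrite (@le_lt_trans _ _ (\sum_k `|x 0 k|))//.
    by rewrite (bigD1 k)//= lerDl sumr_ge0.
  by near: m; exact: large_nat.
have := grid_dist xm j; rewrite distrC => /le_lt_trans; apply.
rewrite invf_plt ?posrE//; near: m; exact: large_nat.
Unshelve. all: by end_near. Qed.

(** A continuous function is the pointwise limit of its grid samples. This links the topology of row
    vectors to the sigma-algebra generated by the coordinates. *)
Lemma continuous_measurable_rV (h : V -> R) : continuous h -> measurable_fun setT h.
Proof.
move=> ch; apply: (@measurable_fun_cvg _ _ _ _ (fun m x => h (grid_point (grid_cell m x)))).
  by move=> m; exact: measurable_grid.
move=> x _; apply: (@cvg_comp _ _ _ (fun m => grid_point (grid_cell m x)) h _ (nbhs x)).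
  exact: grid_cvg.
exact: ch.
Qed.

End grid.

(** * Fourier transform *)

Section fourier.
Variables (R : realType) (n : nat).
Local Notation V := 'rV[R]_n.
Local Notation leb := (lebesgue_rV R n).
Implicit Types (f g : V -> R[i]) (a s : seq 'I_n) (i : 'I_n) (sg : R).
Local Notation "'e_ i" := (delta_mx 0 i : V) (at level 8, i at level 2, format "''e_' i").
Local Notation D i f := (cpderiv [:: i] f).

Lemma integrable_weightV : integrableR leb (fun x => (weight x)^-1).
Proof.
have [ci _] := @integral_cauchy R.
have [+ _] := @cint_prod R n (fun _ t => ((1 + t ^+ 2)^-1)%:C)
  (fun _ => cintegrable_real ci).
move=> [+ _]; rewrite /integrableR; congr (_.-integrable _ (EFin \o _)).
by apply/funext => x; rewrite -rmorph_prod /= /weight prodfV.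
Qed.

Definition weight_mass : R := (\int[leb]_x (weight x)^-1)%R.

Lemma weight_mass_ge0 : 0 <= weight_mass.
Proof. by apply: Rintegral_ge0 => x _; rewrite invr_ge0 weight_ge0. Qed.

Lemma norm1_cint_weight f (e : R) : cmeasurable f ->
  (forall x, norm1 (f x) <= e / weight x) ->
  cintegrable leb f /\ norm1 (cint leb f) <= e * weight_mass.
Proof.
move=> mf fe; have iw := integrableRZ e integrable_weightV.
split; first exact: cintegrable_le iw fe.
rewrite (le_trans (norm1_cint_le mf iw fe))// RintegralZl//.
exact: integrable_weightV.
Qed.

Lemma csmooth_cmeasurable f : csmooth f -> cmeasurable f.
Proof.
by move=> [f1 f2]; split; apply: continuous_measurable_rV;
  [exact: (f1 [::]).1|exact: (f2 [::]).1].
Qed.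

Lemma bounded_by_weight k e f x : (0 < k)%N -> bounded_by k e f ->
  norm1 (f x) <= e / weight x.
Proof.
move=> k0 bf; rewrite -[f]cpderiv_nil.
by apply: (bounded_by_norm1 x) (bounded_by_le k0 (lexx _) bf).
Qed.

Lemma schwartz_integrable f : is_schwartz f -> cintegrable leb f.
Proof.
move=> /is_schwartzP[sf /(_ 1%N)[e fe]].
by have [] := norm1_cint_weight (csmooth_cmeasurable sf)
  (fun x => bounded_by_weight x (ltn0Sn 0) fe).
Qed.

(** The sign is a parameter so that -1 ([fourier]) and 1 ([inv_fourier], up to a constant) are
    treated together. *)
Definition fourier_sg sg f (xi : V) : R[i] := cint leb (fun x => f x * expi (sg * dotp xi x)).

Lemma measurable_dotp xi : measurable_fun setT (fun x : V => dotp xi x).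
Proof.
rewrite /dotp; apply: measurable_sum => i; apply: measurable_funM => //.
exact: measurable_rV_coord.
Qed.

Lemma cmeasurable_expi_dotp sg xi : cmeasurable (fun x : V => expi (sg * dotp xi x)).
Proof. by apply: cmeasurable_expi; apply: measurable_funM => //; exact: measurable_dotp. Qed.

Lemma cintegrable_fourier sg f xi : cintegrable leb f ->
  cintegrable leb (fun x => f x * expi (sg * dotp xi x)).
Proof.
move=> fi; under eq_fun do rewrite mulrC.
apply: (@cintegrableMl _ _ _ _ _ _ 2) => //; first exact: cmeasurable_expi_dotp.
by move=> x; exact: norm1_expi.
Qed.

Lemma norm1_fourier_sg sg f (e : R) xi : cmeasurable f ->
  (forall x, norm1 (f x) <= e / weight x) ->
  norm1 (fourier_sg sg f xi) <= 2 * weight_mass * e.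
Proof.
move=> mf fe.
have [|x|_ h] := @norm1_cint_weight (fun x => f x * expi (sg * dotp xi x)) (2 * e).
- by apply: cmeasurableM => //; exact: cmeasurable_expi_dotp.
- rewrite (le_trans (ler_norm1M _ _))// -mulrA mulrC ler_pM ?norm1_ge0//.
  exact: norm1_expi.
by rewrite mulrAC.
Qed.

Lemma fourier_sgD sg f g : cintegrable leb f -> cintegrable leb g ->
  fourier_sg sg (f + g) = fourier_sg sg f + fourier_sg sg g.
Proof.
move=> fi gi; apply/funext => xi.
transitivity (fourier_sg sg f xi + fourier_sg sg g xi) => //; rewrite /fourier_sg.
rewrite -cintD; [|exact: cintegrable_fourier..].
by apply: eq_cint => x; rewrite -mulrDl.
Qed.

Lemma fourier_sgZ sg (c : R[i]) f : cintegrable leb f ->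
  fourier_sg sg (c *: f) = c *: fourier_sg sg f.
Proof.
move=> fi; apply/funext => xi.
transitivity (c * fourier_sg sg f xi) => //; rewrite /fourier_sg.
rewrite -cintZ; last exact: cintegrable_fourier.
by apply: eq_cint => x; rewrite mulrA.
Qed.

Lemma dotpDl (x y z : V) : dotp (x + y) z = dotp x z + dotp y z.
Proof. by rewrite /dotp -big_split; apply: eq_bigr => i _; rewrite mxE mulrDl. Qed.

Lemma dotpC (x y : V) : dotp x y = dotp y x.
Proof. by apply: eq_bigr => i _; rewrite mulrC. Qed.

Lemma dotpZl (c : R) (x y : V) : dotp (c *: x) y = c * dotp x y.
Proof. by rewrite /dotp mulr_sumr; apply: eq_bigr => i _; rewrite mxE mulrA. Qed.

Lemma dotpNl (x y : V) : dotp (- x) y = - dotp x y.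
Proof. by rewrite -scaleN1r dotpZl mulN1r. Qed.

Lemma dotp_delta i (y : V) : dotp 'e_i y = y 0 i.
Proof.
rewrite /dotp (bigD1 i)//= mxE !eqxx mul1r big1 ?addr0// => j ji.
by rewrite mxE eqxx (negbTE ji) mul0r.
Qed.

Lemma dotp_line (xi x : V) i t : dotp (xi + t *: 'e_i) x = dotp xi x + t * x 0 i.
Proof. by rewrite dotpDl dotpZl dotp_delta. Qed.

Lemma sin_le_abs (t : R) : `|sin t| <= `|t|.
Proof.
have [|c _] := @mean_value_line _ _ (@sin R) 0 1 t.
  by move=> y; exact: (@ex_derive _ _ _ _ _ _ _ (is_derive_sin y)).
rewrite !add0r [t%:A]mulr1 sin0 subr0 => ->.
rewrite (@derive_val _ _ _ _ _ _ _ (is_derive_sin _)) normrM ler_piMr//.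
by rewrite ler_norml cos_geN1 cos_le1.
Qed.

Lemma cos_sub1_abs (t : R) : `|cos t - 1| <= t ^+ 2.
Proof.
have [|c ct] := @mean_value_line _ _ (@cos R) 0 1 t.
  by move=> y; exact: (@ex_derive _ _ _ _ _ _ _ (is_derive_cos y)).
rewrite !add0r [t%:A]mulr1 [c%:A]mulr1 cos0 => ->.
rewrite (@derive_val _ _ _ _ _ _ _ (is_derive_cos _)) normrM normrN.
rewrite -real_normK ?num_real// expr2 ler_wpM2l// (le_trans _ ct)//.
exact: sin_le_abs.
Qed.

Lemma sin_sub_abs (t : R) : `|sin t - t| <= t ^+ 2.
Proof.
have [|c ct] := @mean_value_line _ _ (fun t => sin t - t) 0 1 t.
  by move=> y; apply: derivableB; [exact: (@ex_derive _ _ _ _ _ _ _ (is_derive_sin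
    y))|exact: derivable_id].
rewrite !add0r [t%:A]mulr1 [c%:A]mulr1 sin0 !subr0 => ->.
rewrite (@derive_val _ _ _ _ _ _ _ (is_deriveB (is_derive_sin c) (is_derive_id c 1))).
rewrite -[leRHS]real_normK ?num_real// expr2 normrM ler_wpM2l//.
rewrite (le_trans _ ct)//.
have [|d dc] := @mean_value_line _ _ (@cos R) 0 1 c.
  by move=> y; exact: (@ex_derive _ _ _ _ _ _ _ (is_derive_cos y)).
rewrite !add0r [c%:A]mulr1 [d%:A]mulr1 cos0 => ->.
rewrite (@derive_val _ _ _ _ _ _ _ (is_derive_cos _)) normrM normrN ler_piMr//.
by rewrite ler_norml sin_geN1 sin_le1.
Qed.

Lemma expi_taylor (t : R) : norm1 (expi t - 1 - (0 +i* t)) <= 2 * t ^+ 2.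
Proof.
rewrite /norm1 /= !subr0 mulr_natl mulr2n lerD//; first exact: cos_sub1_abs.
exact: sin_sub_abs.
Qed.

Lemma pderiv_cst s (c : R) : pderiv s (fun _ : V => c) = fun=> (if s is [::] then c else 0).
Proof.
elim: s => //= i s ->; apply/funext => x.
by case: s => [|j s]; rewrite derive_cst.
Qed.

Lemma derive_coord (c : R) i j (x : V) :
  is_derive x 'e_j (fun x : V => c * x 0 i) (c * (i == j)%:R).
Proof.
apply: (@is_derive_quadratic _ _ _ _ _ _ 0) => t _.
by rewrite !mxE eqxx /= mulr0 normr_le0; apply/eqP; ring.
Qed.

Lemma pderiv_coord (c : R) i s : (0 < size s)%N -> exists C : R, forall x : V,
  `|pderiv s (fun x => c * x 0 i) x| <= C.
Proof.
case/lastP: s => // s j _; exists (`|c * (i == j)%:R|) => x.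
rewrite pderiv_rcons (_ : 'D_('e_j) _ = fun=> c * (i == j)%:R); last first.
  by apply/funext => y; exact: (@derive_val _ _ _ _ _ _ _ (derive_coord c i j y)).
by rewrite pderiv_cst; case: s => // *; rewrite normr0.
Qed.

Lemma smooth_coord (c : R) i : smooth (fun x : V => c * x 0 i).
Proof.
move=> s; case/lastP: s => [|s j] /=.
  split=> [x|j x]; last exact: (@ex_derive _ _ _ _ _ _ _ (derive_coord c i j x)).
  apply: (@continuous_lipschitz_rV _ _ _ `|c|) => y z.
  by rewrite -mulrBr normrM ler_wpM2l// (bigD1 i)//= lerDl sumr_ge0.
rewrite pderiv_rcons (_ : 'D_('e_j) _ = fun=> c * (i == j)%:R); last first.
  by apply/funext => y; exact: (@derive_val _ _ _ _ _ _ _ (derive_coord c i j y)).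
exact: smooth_cst.
Qed.

(** Multiplication by i sg x_i, which differentiation of the transform brings under the integral. *)
Definition mul_icoord sg i f := fun x : V => (0 +i* (sg * x 0 i)) * f x.

Lemma operator_mul_icoord sg i : continuous_operator (mul_icoord sg i).
Proof.
apply: operatorM.
  by split; [exact: smooth0|exact: smooth_coord].
move=> s; case: (posnP (size s)) => [/size0nil ->|s0].
  exists 1%N, `|sg| => x; rewrite cpderiv_nil /norm1/= normr0 add0r normrM expr1.
  by rewrite ler_wpM2l// ler_coord_weight.
have [C hC] := pderiv_coord sg i s0; exists 0%N, C => x.
rewrite expr0 mulr1 /norm1 /cpderiv /=.
rewrite (_ : pderiv s (@complex.Re R \o _) = fun=> 0); last exact: pderiv0.
by rewrite normr0 add0r; exact: hC.
Qed.

(** Differentiation under the integral sign: the second-order remainder of the exponential is at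
    most a constant times (t x_i)^2, and x_i^2 f is still integrable. *)
Lemma taylor_fourier sg f i xi : is_schwartz f -> exists C : R, forall t,
  norm1 (fourier_sg sg f (xi + t *: 'e_i) - fourier_sg sg f xi -
         t%:C * fourier_sg sg (mul_icoord sg i f) xi) <= t ^+ 2 * C.
Proof.
move=> sf; have sX := operator_schwartz (operator_mul_icoord sg i) sf.
have /is_schwartzP[_ /(_ 1%N)[e Xe]] :=
  operator_schwartz (operator_mul_icoord sg i) sX.
(* 4 = 2 * 2, one factor from [norm1_expi] and one from [expi_taylor]; [e] bounds f multiplied twice
   by i sg x_i. *)
exists (4 * e * weight_mass) => t.
have fi := schwartz_integrable sf; have Xi := schwartz_integrable sX.
have i1 := cintegrable_fourier sg (xi + t *: 'e_i) fi.
have i2 := cintegrable_fourier sg xi fi.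
have i3 := cintegrable_fourier sg xi Xi.
rewrite /fourier_sg -cintB// -cintZ// -cintB//; last 2 first.
- exact: cintegrableB.
- exact: cintegrableZ.
rewrite mulrA.
have -> : (fun x => f x * expi (sg * dotp (xi + t *: 'e_i) x) -
    f x * expi (sg * dotp xi x) -
    t%:C * (mul_icoord sg i f x * expi (sg * dotp xi x))) =
    (fun x => f x * expi (sg * dotp xi x) *
      (expi (t * (sg * x 0 i)) - 1 - (0 +i* (t * (sg * x 0 i))))).
  apply/funext => x; rewrite dotp_line mulrDr expiD [sg * (t * _)]mulrCA.
  have -> : 0 +i* (t * (sg * x 0 i)) = t%:C * (0 +i* (sg * x 0 i)).
    by apply: complexP; rewrite ?cReM ?cImM/= ?mul0r ?mulr0 ?subr0 ?addr0.
  by rewrite /mul_icoord; ring.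
apply: (norm1_cint_weight _ _).2.
  apply: cmeasurableM; first exact: cintegrable_cmeasurable i2.
  apply: cmeasurableB; first apply: cmeasurableB; do ?exact: cmeasurable_cst.
    apply: cmeasurable_expi; do 2! apply: measurable_funM => //.
    exact: measurable_rV_coord.
  split => /=; first exact: measurable_cst.
  by do 2! apply: measurable_funM => //; exact: measurable_rV_coord.
move=> x; have Xx := bounded_by_weight x (ltn0Sn 0) Xe.
rewrite (le_trans (ler_norm1M _ _))//.
apply: (@le_trans _ _ (2 * norm1 (f x) * (2 * (t * (sg * x 0 i)) ^+ 2))).
  rewrite ler_pM ?norm1_ge0//; last exact: expi_taylor.
  rewrite (le_trans (ler_norm1M _ _))// mulrC ler_wpM2r ?norm1_ge0//.
  exact: norm1_expi.
have E : norm1 (mul_icoord sg i (mul_icoord sg i f) x) = (sg * x 0 i) ^+ 2 * norm1 (f x).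
  rewrite /mul_icoord mulrA.
  have -> : (0 +i* (sg * x 0 i)) * (0 +i* (sg * x 0 i)) = (- (sg * x 0 i) ^+ 2)%:C.
    by apply: complexP; rewrite ?cReM ?cImM/=; ring.
  by rewrite norm1Z normrN ger0_norm// sqr_ge0.
rewrite E in Xx.
rewrite (_ : _ * _ = 4 * t ^+ 2 * ((sg * x 0 i) ^+ 2 * norm1 (f x))); last by ring.
rewrite (_ : t ^+ 2 * _ / _ = 4 * t ^+ 2 * (e / weight x)); last by ring.
by rewrite ler_wpM2l// mulr_ge0// sqr_ge0.
Qed.

Lemma derive_fourier sg f i xi : is_schwartz f ->
  [/\ derivable (@complex.Re R \o fourier_sg sg f) xi 'e_i,
      derivable (@complex.Im R \o fourier_sg sg f) xi 'e_i &
      D i (fourier_sg sg f) xi = fourier_sg sg (mul_icoord sg i f) xi].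
Proof.
move=> sf; have [C hC] := taylor_fourier sg i xi sf.
by apply: (@cderive_quadratic _ _ _ _ _ _ C) => t _; exact: hC.
Qed.

Lemma cpderiv_fourier sg f i : is_schwartz f ->
  D i (fourier_sg sg f) = fourier_sg sg (mul_icoord sg i f).
Proof. by move=> sf; apply/funext => xi; have [_ _] := derive_fourier sg i xi sf. Qed.

Lemma schwartz_fourier_bounded sg f : is_schwartz f -> exists B, forall xi,
  norm1 (fourier_sg sg f xi) <= B.
Proof.
move=> /is_schwartzP[sf /(_ 1%N)[e fe]].
exists (2 * weight_mass * e) => xi; apply: norm1_fourier_sg.
  exact: csmooth_cmeasurable.
by move=> x; exact: bounded_by_weight fe.
Qed.

(** By coinduction on the class of transforms of Schwartz functions, stable under derivatives by
    [cpderiv_fourier]. *)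
Lemma csmooth_fourier sg f : is_schwartz f -> csmooth (fourier_sg sg f).
Proof.
move=> sf; pose P g := exists2 h, is_schwartz h & g = fourier_sg sg h.
suff [] : csmooth (fourier_sg sg f) /\ forall s, P (cpderiv s (fourier_sg sg f)) by [].
apply: csmooth_coind; last by exists f.
move=> _ [h sh ->]; split.
- by move=> i x; have [] := derive_fourier sg i x sh.
- have /choice[B hB] i := schwartz_fourier_bounded sg (operator_schwartz
  (operator_mul_icoord sg i) sh).
  exists (\sum_i `|B i|) => i x; rewrite cpderiv_fourier// (le_trans (hB i x))//.
  by rewrite (le_trans (ler_norm _))// (bigD1 i)//= lerDl sumr_ge0.
- move=> i; exists (mul_icoord sg i h); last exact: cpderiv_fourier.
  exact: operator_schwartz (operator_mul_icoord sg i) sh.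
Qed.

Lemma fourier_translate sg f (c xi : V) : cintegrable leb f ->
  fourier_sg sg (fun x => f (x + c)) xi = expi (- (sg * dotp xi c)) * fourier_sg sg f xi.
Proof.
move=> fi; have gi := cintegrable_fourier sg xi fi.
have [gc e] := cint_affine_rV c (oner_neq0 R) gi.
rewrite normr1 expr1n invr1 mul1r in e.
rewrite /fourier_sg -e -cintZ//; apply: eq_cint => x.
rewrite scale1r [dotp xi (x + c)]dotpC dotpDl mulrDr expiD (dotpC c).
by rewrite mulrCA [expi _ * (_ * _)]mulrCA expiNM mulr1 (dotpC x).
Qed.

(** 2^n comes from [ler_weight_shift], and one more factor 2 bounds 1 + c^2. *)
Lemma weight_line (c : R) i (x : V) : `|c| <= 1 ->
  weight x <= 2 ^+ n.+1 * weight (x + c *: 'e_i).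
Proof.
move=> c1; have {1}-> : x = (x + c *: 'e_i) + (- c) *: 'e_i.
  by rewrite scaleNr addrK.
rewrite (le_trans (ler_weight_shift _ _))// exprSr -!mulrA ler_wpM2l//.
rewrite mulrC ler_wpM2r ?weight_ge0//.
rewrite /weight (bigD1 i)//= big1 => [|j ji].
  rewrite mulr1 !mxE !eqxx mulr1 sqrrN -real_normK ?num_real//.
  have := normr_ge0 c; nra.
by rewrite !mxE (negbTE ji) andbF mulr0 expr0n addr0.
Qed.

(** Translating f by t e_i multiplies its transform by an exponential. Both the difference f(x + t
    e_i) - f(x) and this exponential are expanded to first order in t, with quadratic errors;
    dividing by t and letting it tend to 0 identifies the linear terms. *)
Lemma fourier_D sg f i xi : is_schwartz f ->
  fourier_sg sg (D i f) xi = - (0 +i* (sg * xi 0 i)) * fourier_sg sg f xi.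
Proof.
move=> sf; have sD := operator_schwartz (operator_D R i) sf.
have /is_schwartzP[_ /(_ 1%N)[e De]] := operator_schwartz (operator_D R i) sD.
have e0 := bounded_by_ge0 De.
have fi := schwartz_integrable sf; have Di := schwartz_integrable sD.
set F := fourier_sg sg f xi; set FD := fourier_sg sg (D i f) xi.
(* The factors are 2 from [taylor_norm1], 2 from [norm1_expi], and 2^(n+1) e for the second
   derivative along the segment, by [weight_line]. *)
pose C1 := 2 * (2 * (2 ^+ n.+1 * e)) * weight_mass.
have H1 t : `|t| <= 1 ->
    norm1 ((expi (- (sg * (t * xi 0 i))) - 1) * F - t%:C * FD) <= t ^+ 2 * C1.
  move=> t1; have [fti _] := cint_affine_rV (t *: 'e_i) (oner_neq0 R) fi.
  have {}fti : cintegrable leb (fun x => f (x + t *: 'e_i)).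
    by under eq_fun do rewrite -[X in X + _]scale1r.
  have := fourier_translate sg (t *: 'e_i) xi fi.
  rewrite dotpC dotpZl dotp_delta -/F => E.
  rewrite mulrBl mul1r -E /F /FD /fourier_sg -cintB; [|exact: cintegrable_fourier..].
  rewrite -cintZ; last exact: cintegrable_fourier.
  rewrite -cintB; last 2 first.
  - by apply: cintegrableB; exact: cintegrable_fourier.
  - by apply: cintegrableZ; exact: cintegrable_fourier.
  rewrite /C1 [leRHS]mulrA; apply: (norm1_cint_weight _ _).2.
    apply: cmeasurableB; [apply: cmeasurableB|apply: cmeasurableM].
    - exact: cintegrable_cmeasurable (cintegrable_fourier sg xi fti).
    - exact: cintegrable_cmeasurable (cintegrable_fourier sg xi fi).
    - exact: cmeasurable_cst.
    - exact: cintegrable_cmeasurable (cintegrable_fourier sg xi Di).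
  move=> x; rewrite mulrA -!mulrBl (le_trans (ler_norm1M _ _))//.
  have Tx : norm1 (f (x + t *: 'e_i) - f x - t%:C * D i f x) <=
      2 * t ^+ 2 * (2 ^+ n.+1 * e / weight x).
    apply: taylor_norm1; first by case: sf.
    move=> c ct; have c1 := le_trans ct t1.
    rewrite (le_trans (bounded_by_weight _ (ltn0Sn 0) De))//.
    rewrite ler_pdivrMr ?weight_gt0// mulrAC ler_pdivlMr ?weight_gt0//.
    by rewrite [2 ^+ _ * e]mulrC -mulrA ler_wpM2l// weight_line.
  rewrite (@le_trans _ _ (2 * t ^+ 2 * (2 ^+ n.+1 * e / weight x) * 2))//; last first.
    by rewrite le_eqVlt; apply/orP; left; apply/eqP; ring.
  by rewrite ler_pM ?norm1_ge0// norm1_expi.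
pose C2 := C1 + 2 * (sg * xi 0 i) ^+ 2 * norm1 F.
have C20 : 0 <= C2.
  rewrite /C2 addr_ge0//; first by rewrite /C1 !mulr_ge0// weight_mass_ge0.
  by rewrite mulr_ge0 ?norm1_ge0// mulr_ge0// sqr_ge0.
have H2 t : `|t| <= 1 ->
    norm1 (t%:C * (- (0 +i* (sg * xi 0 i)) * F - FD)) <= t ^+ 2 * C2.
  move=> t1; have := expi_taylor (- (sg * (t * xi 0 i))).
  set E := expi _; set z := (X in E - 1 - X) => hE.
  have -> : t%:C * (- (0 +i* (sg * xi 0 i)) * F - FD) =
      ((E - 1) * F - t%:C * FD) - (E - 1 - z) * F.
    have -> : z = t%:C * - (0 +i* (sg * xi 0 i)).
      by rewrite /z; apply: complexP; rewrite ?cReM ?cImM/=; ring.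
    by ring.
  rewrite (le_trans (ler_norm1B _ _))// /C2 mulrDr lerD ?H1//.
  rewrite (le_trans (ler_norm1M _ _))// [leRHS]mulrA ler_wpM2r ?norm1_ge0//.
  rewrite (le_trans hE)// le_eqVlt; apply/orP; left; apply/eqP; ring.
apply/eqP; rewrite eq_sym -subr_eq0; apply/eqP; apply: norm1_eq_small => d d0.
(* At most 1, so that [H2] applies, and such that t C2 <= d after division by t. *)
pose t := Num.min 1 (d / (C2 + 1)).
have C21 : 0 < C2 + 1 by rewrite ltr_wpDl.
have t0 : 0 < t by rewrite lt_min ltr01 divr_gt0.
have := H2 t; rewrite gtr0_norm// ge_min lexx => /(_ isT).
rewrite norm1Z gtr0_norm// expr2 -mulrA ler_pM2l// => /le_trans; apply.
rewrite (@le_trans _ _ (d / (C2 + 1) * (C2 + 1)))//.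
  by rewrite ler_pM ?lerDl// ?ge_min ?lexx ?orbT// ltW.
by rewrite divfK ?lt0r_neq0.
Qed.

End fourier.

(** * Fourier inversion *)

Section fourier_inversion.
Variables (R : realType) (n : nat).
Local Notation V := 'rV[R]_n.
Local Notation leb := (lebesgue_rV R n).
Implicit Types (f g : V -> R[i]) (a s : seq 'I_n) (i : 'I_n) (x y z xi : V).
Local Notation D i f := (cpderiv [:: i] f).
Variable sg : R.
Hypothesis sg2 : sg ^+ 2 = 1.

(** The operator on f corresponding to xi^a d^s on its transform. The factor i sg turns D_i into
    multiplication by sg^2 xi_i = xi_i. *)
Definition fourier_word a s f :=
  foldr (fun i g => (0 +i* sg) *: D i g) (foldr (mul_icoord sg) f s) a.

Lemma operator_fourier_word a s : continuous_operator (fourier_word a s).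
Proof.
rewrite /fourier_word; elim: a => [|i a IH] /=; last first.
  by apply: operatorZ; exact: (operator_comp (operator_D R i) IH).
elim: s => [|i s IH] /=; first exact: operator_id.
exact: (operator_comp (operator_mul_icoord sg i) IH).
Qed.

Lemma fourier_wordE a s f xi : is_schwartz f ->
  (monomial a xi)%:C * cpderiv s (fourier_sg sg f) xi =
  fourier_sg sg (fourier_word a s f) xi.
Proof.
move=> sf; have sw b := operator_schwartz (operator_fourier_word b s) sf.
elim: a => [|i a IH].
  rewrite /monomial big_nil mul1r /fourier_word /=; have {sw} := sw [::].
  rewrite /fourier_word /= => _; congr (_ xi); elim: s => [|i s IH] /=.
    by rewrite cpderiv_nil.
  rewrite cpderiv_cons IH cpderiv_fourier//.
  exact: operator_schwartz (operator_fourier_word [::] s) sf.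
rewrite /monomial big_cons rmorphM/= -mulrA IH /fourier_word /=.
rewrite -/(fourier_word a s f) fourier_sgZ; last first.
  exact/schwartz_integrable/(operator_schwartz (operator_D R i)).
transitivity ((0 +i* sg) * fourier_sg sg (D i (fourier_word a s f)) xi) => //.
rewrite fourier_D// mulrA; congr (_ * _).
apply: complexP; rewrite ?cReM ?cImM/=; last by ring.
by rewrite -[LHS]mul1r -sg2; ring.
Qed.

(** A power of the weight times a derivative of the transform is controlled by finitely many xi^a
    d^s. Each of them is the transform of a [fourier_word], hence bounded through the integral of
    that word. *)
Lemma operator_fourier : continuous_operator (fourier_sg sg : (V -> R[i]) -> _).
Proof.
split; first by move=> f; exact: csmooth_fourier.
move=> k; pose I := ((2 * (n * k)).-bseq 'I_n * k.-bseq 'I_n)%type.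
have [||k' [C [C0 H]]] := @finite_uniform_bound R I (fun p k' C => forall f e,
    is_schwartz f -> bounded_by k' e f ->
    bounded_by 1 (C * e) (fourier_word p.1 p.2 f)).
- move=> p k1 k2 C1 C2 k12 C12 h f e sf bf.
  apply: (@bounded_by_le _ _ 1 1 (C1 * e)) => //.
    by rewrite ler_wpM2r// (bounded_by_ge0 bf).
  by apply: h => //; exact: bounded_by_le bf.
- move=> p; have [_ /(_ 1%N)[k1 [C1 [_ h]]]] := operator_fourier_word p.1 p.2.
  by exists k1, C1.
exists k', (2 ^+ (n * k) * (2 * weight_mass R n * C)); split.
  by rewrite mulr_ge0// mulr_ge0// mulr_ge0// weight_mass_ge0.
move=> f e sf bf s sk xi; rewrite -mulrA; apply: weight_exp_monomials => a ak.
rewrite fourier_wordE// -mulrA.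
have sw := operator_schwartz (operator_fourier_word a s) sf.
apply: norm1_fourier_sg; first by apply: csmooth_cmeasurable; case: sw.
by move=> x; exact: bounded_by_weight (ltn0Sn 0) (H (Bseq ak, Bseq sk) f e sf bf).
Qed.

Lemma schwartz_fourier f : is_schwartz f -> is_schwartz (fourier_sg sg f).
Proof. exact: operator_schwartz operator_fourier. Qed.

Definition abel_rV xi : R := \prod_j abel (xi 0 j).

Lemma abel_rV_ge0 xi : 0 <= abel_rV xi.
Proof. by apply: prodr_ge0 => j _; exact: abel_ge0. Qed.

Lemma abel_rV_le1 xi : abel_rV xi <= 1.
Proof.
apply: (@le_trans _ _ (\prod_(j < n) 1)); last by rewrite big1.
by apply: ler_prod => j _; rewrite abel_ge0 abel_le1.
Qed.

Lemma measurable_abel_rV : measurable_fun setT abel_rV.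
Proof.
apply: measurable_prod => j _.
exact: (measurableT_comp (@measurable_abel R) (measurable_rV_coord j)).
Qed.

Lemma cint_abel_rV z :
  cintegrable leb (fun xi => (abel_rV xi)%:C * expi (dotp z xi)) /\
  cint leb (fun xi => (abel_rV xi)%:C * expi (dotp z xi)) = (2 ^+ n / weight z)%:C.
Proof.
have [] := @cint_prod R n (fun j t => (abel t)%:C * expi (z 0 j * t))
  (fun j => cintegrable_abel_expi (z 0 j)).
have -> : (fun xi : V => \prod_j ((abel (xi 0 j))%:C * expi (z 0 j * xi 0 j))) =
    (fun xi => (abel_rV xi)%:C * expi (dotp z xi)).
  apply/funext => xi; rewrite big_split /= -rmorph_prod; congr (_ * _).
  rewrite /dotp; apply/esym; apply: (big_morph _ (@expiD R)).
  exact: expi0.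
move=> hi ->; split => //; under eq_bigr do rewrite cint_abel_expi.
rewrite -rmorph_prod /=; congr (_%:C).
by rewrite big_split/= prodr_const card_ord prodfV.
Qed.

Lemma integrable_abel_rV : integrableR leb abel_rV.
Proof.
have [[+ _] _] := cint_abel_rV 0.
rewrite /integrableR; congr (_.-integrable _ (EFin \o _)).
apply/funext => xi; rewrite (_ : dotp 0 xi = 0) ?expi0 ?mulr1//.
by rewrite -[0](scale0r (0 : V)) dotpZl mul0r.
Qed.

(** Together with the 2^n of the Abel kernel, this pi^n makes up the constant (2 pi)^n of the
    inversion formula. *)
Lemma weight_massE : weight_mass R n = pi ^+ n.
Proof.
have [_ e] := cint_abel_rV 0.
have [ci ce] := @integral_cauchy R.
have [_] := @cint_prod R n (fun _ t => ((1 + t ^+ 2)^-1)%:C)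
  (fun _ => cintegrable_real ci).
rewrite (_ : (fun x : V => _) = fun x => ((weight x)^-1)%:C); last first.
  by apply/funext => x; rewrite -rmorph_prod /= /weight prodfV.
rewrite cint_real -/(weight_mass R n).
under eq_bigr do rewrite cint_real ce.
by rewrite prodr_const card_ord -rmorphXn => -[].
Qed.

Lemma measurable_div_weight (c : R) : measurable_fun setT (fun z : V => c / weight z).
Proof.
apply/measurable_EFinP.
exact: measurable_int (integrableRZ c (@integrable_weightV R n)).
Qed.

Lemma norm1_div_weight (c : R) z : 0 <= c -> norm1 (c / weight z)%:C <= c.
Proof.
move=> c0; rewrite norm1_real ger0_norm; last by rewrite divr_ge0 ?weight_ge0.
by rewrite ler_pdivrMr ?weight_gt0// -[leLHS]mulr1 ler_wpM2l// weight_ge1.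
Qed.

Section inversion.
Variables (f : V -> R[i]) (x : V).
Hypothesis sf : is_schwartz f.

Let eps (m : nat) : R := m.+1%:R^-1.
Let eps_gt0 m : 0 < eps m. Proof. by rewrite /eps. Qed.

Let fi := schwartz_integrable sf.
Let Fi := schwartz_integrable (schwartz_fourier sf).

Let smoothed m :=
  cint leb (fun xi => fourier_sg sg f xi * expi (- sg * dotp x xi) * (abel_rV (eps m *: xi))%:C).

(** Fubini exchanges the damped double integral. The inner integral is then the transform of the
    dilated Abel kernel, so that the Abel mean is an average of f around x against a Cauchy kernel
    of width eps. *)
Lemma smoothed_fourier m : smoothed m =
  cint leb (fun z => f (eps m *: z + x) * (2 ^+ n / weight z)%:C).
Proof.
rewrite /smoothed; move: (eps m) (eps_gt0 m) => e e_gt0.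
have e0 : e != 0 by exact: lt0r_neq0.
have eN : `|e| = e by exact: gtr0_norm.
have [iK _] := integral_affine_rV 0 e0 integrable_abel_rV.
have {}iK : integrableR leb (fun xi => abel_rV (e *: xi)).
  by under eq_fun do rewrite -[X in abel_rV X]addr0.
have mK : measurable_fun setT (fun xi => abel_rV (e *: xi)).
  by apply/measurable_EFinP; exact: measurable_int iK.
pose G (p : V * V) := f p.1 * expi (sg * dotp p.2 p.1) * expi (- sg * dotp x p.2) *
  (abel_rV (e *: p.2))%:C.
have mf := cintegrable_cmeasurable fi.
have mG : cmeasurable G.
  apply: cmeasurableM; last first.
    by apply: cmeasurable_real; exact: (measurableT_comp mK measurable_snd).
  apply: cmeasurableM; last first.
    exact: (cmeasurable_comp measurable_snd (cmeasurable_expi_dotp (- sg) x)).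
  apply: cmeasurableM; first exact: (cmeasurable_comp measurable_fst mf).
  apply: cmeasurable_expi; apply: measurable_funM => //.
  apply: measurable_sum => i; apply: measurable_funM.
    exact: (measurableT_comp (measurable_rV_coord i) measurable_snd).
  exact: (measurableT_comp (measurable_rV_coord i) measurable_fst).
have nG y xi : norm1 (G (y, xi)) <= (4 * norm1 (f y)) * abel_rV (e *: xi).
  rewrite /G /= mulrC norm1Z ger0_norm ?abel_rV_ge0// mulrC ler_wpM2r ?abel_rV_ge0//.
  rewrite (le_trans (ler_norm1M _ _))// (@le_trans _ _ ((norm1 (f y) * 2) * 2))//.
    rewrite ler_pM ?norm1_ge0 ?norm1_expi// (le_trans (ler_norm1M _ _))//.
    by rewrite ler_wpM2l ?norm1_ge0// norm1_expi.
  by rewrite le_eqVlt; apply/orP; left; apply/eqP; ring.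
have i4 := integrableRZ 4 (cintegrable_norm1 fi).
have Fub := cint_fubini mG i4 iK nG.
transitivity (cint leb (fun xi => cint leb (fun y => G (y, xi)))).
  apply: eq_cint => xi; rewrite /fourier_sg -mulrA mulrC -cintZ.
    by apply: eq_cint => y; rewrite /G /=; ring.
  exact: cintegrable_fourier.
rewrite -Fub.
(* The sign disappears because [weight] is even in each coordinate and sg^2 = 1. *)
have PE y : cint leb (fun xi => G (y, xi)) =
    f y * ((e ^+ n)^-1 * (2 ^+ n / weight (e^-1 *: (y - x))))%:C.
  pose h xi := (abel_rV xi)%:C * expi (dotp ((sg / e) *: (y - x)) xi).
  have [hi he] := cint_abel_rV ((sg / e) *: (y - x)).
  have [hi' he'] := cint_affine_rV 0 e0 hi.
  have -> : weight (e^-1 *: (y - x)) = weight ((sg / e) *: (y - x)).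
    by apply: eq_bigr => j _; rewrite !mxE -!mulrA [in RHS]exprMn sg2 mul1r.
  rewrite rmorphM/=.
  rewrite eN in he'.
  rewrite -he.
  rewrite -[X in _ = _ * X]he'.
  rewrite -cintZ; last exact hi'.
  apply: eq_cint => xi; rewrite /G /= addr0 -!mulrA; congr (_ * _).
  rewrite mulrA -expiD mulrC; congr (_ * expi _).
  rewrite [RHS]dotpZl (dotpC (y - x)) dotpZl (dotpC xi (y - x)) dotpDl dotpNl (dotpC xi y).
  by field.
rewrite (eq_cint leb PE).
pose H y := f y * (2 ^+ n / weight (e^-1 *: (y - x)))%:C.
have mW : measurable_fun setT (fun y => 2 ^+ n / weight (e^-1 *: (y - x))).
  have E y : e^-1 *: (y - x) = e^-1 *: y + - (e^-1 *: x) by rewrite scalerBr.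
  under eq_fun do rewrite E.
  exact: (measurableT_comp (measurable_div_weight (2 ^+ n)) (measurable_affine_rV _ _)).
have Hi : cintegrable leb H.
  have cW := cmeasurable_real mW.
  have WB y : norm1 (2 ^+ n / weight (e^-1 *: (y - x)))%:C <= 2 ^+ n.
    by apply: norm1_div_weight; exact: exprn_ge0.
  have -> : H = fun y => (2 ^+ n / weight (e^-1 *: (y - x)))%:C * f y.
    by apply/funext => y; rewrite /H mulrC.
  exact (cintegrableMl cW WB fi).
have [Hi' He] := cint_affine_rV x e0 Hi.
transitivity ((e ^+ n)^-1%:C * cint leb H).
  rewrite -cintZ; last exact Hi.
  by congr (cint leb _); apply/funext => y; rewrite /H rmorphM/=; ring.
rewrite eN in He; rewrite -He; apply: eq_cint => z.
have E : e^-1 *: (e *: z + x - x) = z.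
  rewrite addrK.
  rewrite scalerA.
  rewrite (mulVf e0).
  exact: scale1r.
by rewrite /H E.
Qed.

Lemma schwartz_bound g : is_schwartz g -> exists B, forall y, norm1 (g y) <= B.
Proof.
move=> /is_schwartzP[_ /(_ 0%N)[e ge]]; exists e => y.
by have := ge [::] isT y; rewrite expr0 mul1r cpderiv_nil.
Qed.

Lemma cvg_eps : eps m @[m --> \oo] --> 0.
Proof.
apply/cvgrPdist_lt => e e0; near=> m; rewrite sub0r normrN gtr0_norm//.
rewrite /eps invf_plt ?posrE//; near: m; exact: large_nat.
Unshelve. all: by end_near. Qed.

(* Abel summation: both sides are limits, as e tends to 0, of the integrals   *)
(* with the damping factor exp (- e (|xi_1| + ... + |xi_n|)).                 *)
Lemma fourier_inversion :
  fourier_sg (- sg) (fourier_sg sg f) x = ((2 * pi) ^+ n)%:C * f x.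
Proof.
have mF := cintegrable_cmeasurable Fi.
have mE := cmeasurable_expi_dotp (- sg) x.
(* The damping factor lies between 0 and 1 and tends to 1; the dominating function is twice the
   transform of f. *)
have l1 : norm1 (smoothed m - fourier_sg (- sg) (fourier_sg sg f) x) @[m --> \oo] --> 0.
  apply: (@cint_dominated _ _ _ leb _ _ (fun xi => 2 * norm1 (fourier_sg sg f xi))).
  - move=> m; apply: cmeasurableM; first exact: cmeasurableM.
    apply: cmeasurable_real.
    apply: (measurableT_comp measurable_abel_rV).
    by have := measurable_affine_rV (eps m) (0 : V); under eq_fun do rewrite addr0.
  - exact: cmeasurableM.
  - exact: integrableRZ (cintegrable_norm1 Fi).
  - move=> m xi; rewrite mulrC norm1Z ger0_norm ?abel_rV_ge0//.
    rewrite (@le_trans _ _ (1 * (norm1 (fourier_sg sg f xi) * 2)))//.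
      rewrite ler_pM ?abel_rV_ge0 ?norm1_ge0 ?abel_rV_le1//.
      by rewrite (le_trans (ler_norm1M _ _))// ler_wpM2l ?norm1_ge0// norm1_expi.
    by rewrite mul1r mulrC.
  - move=> xi; set c := _ * expi _.
    have -> : (fun k => norm1 (c * (abel_rV (eps k *: xi))%:C - c)) =
        (fun k => `|abel_rV (eps k *: xi) - 1| * norm1 c).
      by apply/funext => k; rewrite -{2}[c]mulr1 -mulrBr -rmorphB/= mulrC norm1Z.
    rewrite -[X in _ --> X](mul0r (norm1 c)); apply: cvgMr_tmp.
    rewrite -(@normr0 _ R) -(subrr (1 : R)); apply: cvg_norm; apply: cvgB; last exact: cvg_cst.
    have -> : (1 : R) = \prod_(j < n) 1 by rewrite big1.
    rewrite /abel_rV; apply: cvg_big; [exact: mul_continuous|move=> j _].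
    have -> : 1 = abel (0 * xi 0 j) :> R by rewrite /abel mul0r normr0 oppr0 expR0.
    under eq_fun do rewrite mxE.
    apply: (cvg_comp (fun m => eps m * xi 0 j) (@abel R)); last exact: continuous_abel.
    by apply: cvgMr_tmp; exact: cvg_eps.
have [B fB] := schwartz_bound sf.
have mf := cintegrable_cmeasurable fi.
have mW := measurable_div_weight (2 ^+ n).
(* The averaging kernel has total mass 2^n pi^n, and f(eps z + x) tends to f(x) for each z by the
   Lipschitz bound [L]. *)
have l2 : norm1 (smoothed m - ((2 * pi) ^+ n)%:C * f x) @[m --> \oo] --> 0.
  have -> : ((2 * pi) ^+ n)%:C * f x = cint leb (fun z => f x * (2 ^+ n / weight z)%:C).
    rewrite cintZ; last first.
      by apply: cintegrable_real; apply: integrableRZ; exact: integrable_weightV.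
    rewrite cint_real RintegralZl//; last exact: integrable_weightV.
    by rewrite -/(weight_mass R n) weight_massE exprMn mulrC.
  under eq_fun do rewrite smoothed_fourier.
  apply: (@cint_dominated _ _ _ leb _ _ (fun z => (B * 2 ^+ n) * (weight z)^-1)).
  - move=> m; apply: cmeasurableM; last exact: cmeasurable_real.
    exact: cmeasurable_comp (measurable_affine_rV _ _) mf.
  - by apply: cmeasurableM; [exact: cmeasurable_cst|exact: cmeasurable_real].
  - exact: integrableRZ (@integrable_weightV R n).
  - move=> m z; rewrite mulrC norm1Z ger0_norm; last by rewrite divr_ge0// weight_ge0.
    by rewrite mulrC mulrA ler_wpM2r ?invr_ge0 ?weight_ge0// ler_wpM2r.
  - move=> z; set c := `|2 ^+ n / weight z|.
    have -> : (fun k => norm1 (f (eps k *: z + x) * (2 ^+ n / weight z)%:C -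
        f x * (2 ^+ n / weight z)%:C)) = (fun k => c * norm1 (f (eps k *: z + x) - f x)).
      by apply/funext => k; rewrite -mulrBl mulrC norm1Z.
    rewrite -[X in _ --> X](mulr0 c); apply: cvgMl_tmp.
    have [e fe] := ((is_schwartzP f).1 sf).2 1%N.
    have L y : norm1 (f y - f x) <= 2 * e * \sum_j `|y 0 j - x 0 j|.
      apply: lipschitz_norm1; first by apply: csmooth_cderivable; case: sf.
      move=> i w _; rewrite (le_trans _ (fe [:: i] isT w))//.
      by rewrite ler_peMl ?norm1_ge0// expr1 weight_ge1.
    apply: (@squeeze_cvgr _ _ _ _ (fun=> 0) (fun m => eps m * (2 * e * \sum_j `|z 0 j|))).
    + apply: nearW => m; rewrite norm1_ge0/= (le_trans (L _))//.
      rewrite mulrCA ler_wpM2l ?mulr_ge0 ?(bounded_by_ge0 fe)// mulr_sumr.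
      apply: ler_sum => j _; rewrite !mxE addrK normrM gtr0_norm//.
    + exact: cvg_cst.
    + rewrite -[X in _ --> X](mul0r (2 * e * \sum_j `|z 0 j|)); apply: cvgMr_tmp.
      exact: cvg_eps.
apply/eqP; rewrite -subr_eq0; apply/eqP; apply: norm1_eq_small => d d0.
have d2 : 0 < d / 2 by rewrite divr_gt0.
have /cvgrPdist_lt /(_ _ d2) h1 := l1; have /cvgrPdist_lt /(_ _ d2) h2 := l2.
have [m []] := filter_ex (filterI h1 h2).
rewrite /= !sub0r !normrN !ger0_norm ?norm1_ge0// => {}h1 {}h2.
rewrite -(subrKA (smoothed m)) (le_trans (ler_norm1D _ _))// [leRHS]splitr.
by rewrite lerD ?(ltW h2)// norm1BC ltW.
Qed.

End inversion.
End fourier_inversion.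

(** * Test functions *)

Section flat_functions.
Variable R : realType.
Implicit Types (c t u : R) (p : {poly R}).

Lemma monomial_exp_bound c u i : 0 < c -> 0 <= u ->
  u ^+ i * expR (- (c * u)) <= i`!%:R / c ^+ i.
Proof.
move=> c0 u0; have cu0 : 0 <= c * u by rewrite mulr_ge0// ltW.
have H : (c * u) ^+ i / i`!%:R <= expR (c * u).
  case: i => [|i]; first by rewrite expr0 divr1 -expR0 ler_expR.
  by rewrite (le_trans _ (expR_ge1Dxn i cu0))// lerDr.
rewrite expRN ler_pdivrMr ?expR_gt0// mulrAC ler_pdivlMr ?exprn_gt0//.
move: H; rewrite ler_pdivrMr ?ltr0n ?fact_gt0// exprMn => H.
by rewrite mulrC [leRHS]mulrC.
Qed.

Lemma poly_exp_bound c p : 0 < c -> exists C : R, forall u, 0 <= u ->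
  `|p.[u]| * expR (- (c * u)) <= C.
Proof.
move=> c0; exists (\sum_(i < size p) `|p`_i| * (i`!%:R / c ^+ i)) => u u0.
rewrite horner_coef (le_trans (ler_wpM2r (expR_ge0 _) (ler_norm_sum _ _ _)))//.
rewrite mulr_suml; apply: ler_sum => i _; rewrite normrM -mulrA ler_wpM2l//.
by rewrite ger0_norm ?exprn_ge0// monomial_exp_bound.
Qed.

(* The k-th derivative of [t > 0] exp (- c / t) is [t > 0] p_k(1/t) exp (- c / t). *)
Fixpoint flat_poly c k : {poly R} :=
  if k is k'.+1 then 'X^2 * (c *: flat_poly c k' - (flat_poly c k')^`()) else 1.

(** As [c] tends to 0, [flat c 0] tends to the indicator of t > 0; this is why [c] is kept as a
    parameter. *)
Definition flat c k t : R :=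
  if 0 < t then (flat_poly c k).[t^-1] * expR (- (c * t^-1)) else 0.

Lemma flat0 c k t : t <= 0 -> flat c k t = 0.
Proof. by rewrite /flat ltNge => ->. Qed.

(** A direct computation away from 0. At 0 all these functions have derivative 0, since they are
    O(t^2) there. *)
Lemma is_derive_flat c k t : 0 < c -> is_derive t 1 (flat c k) (flat c k.+1 t).
Proof.
move=> c0; have [t0|t0|->] := ltgtP t 0.
- rewrite flat0; last exact: ltW.
  apply: (near_eq_is_derive _ (is_derive_cst (0 : R) t 1)).
  near=> y; rewrite /= flat0//; apply: ltW; near: y; exact: lt_nbhsl.
- pose q := flat_poly c k.
  have V := is_deriveV (lt0r_neq0 t0) (is_derive_id t 1).
  have P := @is_derive1_comp _ (horner q) (fun y => y^-1) t _ _ (is_derive_poly q t^-1) V.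
  have E := @is_derive1_comp _ expR (fun y => - c * y^-1) t _ _ (is_derive_expR _)
    (is_deriveZ (- c) V).
  apply: (near_eq_is_derive _ (is_derive_cast (is_deriveM P E) _)).
    near=> y; rewrite /flat ifT; first by rewrite -mulNr.
    near: y; exact: lt_nbhsr.
  rewrite /flat t0 /= -/q !hornerE /= /GRing.scale /= mulNr; field; exact: lt0r_neq0.
(* With u = 1/t, the factor u^2 in the bounded quantity is what gives the quadratic estimate at
   0. *)
- have [C hC] := poly_exp_bound ('X^2 * flat_poly c k) c0.
  rewrite flat0//; apply: (@is_derive_quadratic _ _ _ _ _ _ `|C|) => h _.
  rewrite add0r [h%:A]mulr1 (flat0 _ _ (lexx 0)) mulr0 !subr0 /flat.
  case: ifPn => h0; last by rewrite normr0 mulr_ge0// sqr_ge0.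
  have := hC h^-1; rewrite invr_ge0 ltW// => /(_ isT); rewrite hornerM hornerXn.
  rewrite normrM [`|_ ^+ 2|]ger0_norm ?sqr_ge0// -mulrA => {}hC.
  rewrite normrM [`|expR _|]ger0_norm ?expR_ge0//.
  rewrite -ler_pdivrMl ?exprn_gt0// -exprVn (le_trans hC)// ler_norm//.
Unshelve. all: by end_near. Qed.

Lemma flat_ge0 c t : 0 <= flat c 0 t.
Proof. by rewrite /flat; case: ifP => // _; rewrite hornerC mul1r expR_ge0. Qed.

Lemma flat_gt0 c t : 0 < t -> 0 < flat c 0 t.
Proof. by rewrite /flat => ->; rewrite hornerC mul1r expR_gt0. Qed.

Lemma flat_le1 c t : 0 < c -> flat c 0 t <= 1.
Proof.
move=> c0; rewrite /flat; case: ifP => // t0.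
by rewrite hornerC mul1r -expR0 ler_expR oppr_le0 mulr_ge0 ?invr_ge0 ?ltW.
Qed.

End flat_functions.

(** * Bumps on boxes and compactly supported functions *)

Section test_functions.
Variables (R : realType) (n : nat).
Local Notation V := 'rV[R]_n.
Implicit Types (h : V -> R) (f g : V -> R[i]) (s : seq 'I_n).
Local Notation "'e_ i" := (delta_mx 0 i : V) (at level 8, i at level 2, format "''e_' i").
Local Notation D i f := (cpderiv [:: i] f).

Lemma is_derive_lineP (h : V -> R) (x v : V) (d : R) :
  is_derive x v h d <-> is_derive (0 : R) 1 (fun t : R => h (x + t *: v)) d.
Proof.
have E : (fun k : R => k^-1 *: (((fun s : R => h (x + s *: v)) \o shift 0) (k *: 1)
    - h (x + 0 *: v))) =
    (fun k => k^-1 *: ((h \o shift x) (k *: v) - h x)).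
  apply/funext => k /=; congr (_ *: (h _ - h _)); last by rewrite scale0r addr0.
  by rewrite [k *: 1]mulr1 addr0 addrC.
by split => -[dh dE]; apply: DeriveDef; move: dh dE; rewrite /derivable /derive E.
Qed.

Lemma is_derive_comp (E : R -> R) (h : V -> R) (x v : V) (dE d : R) :
  is_derive (h x) 1 E dE -> is_derive x v h d ->
  is_derive x v (E \o h) (dE * d).
Proof.
move=> HE /is_derive_lineP Hh; apply/is_derive_lineP.
apply: (@is_derive1_comp _ E (fun t => h (x + t *: v)) 0) => //.
by rewrite scale0r addr0.
Qed.

(** [E] lists the successive derivatives of [E 0]. The induction on k is carried out for every level
    [l] of the list at once. *)
Lemma smooth_comp_coord (E : nat -> R -> R) (a b : R) i :
  (forall k (t : R), is_derive t 1 (E k) (E k.+1 t)) ->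
  smooth (fun x : V => E 0%N (a * x 0 i + b)).
Proof.
move=> dE; apply/smooth_Ck => k.
have dl j (x : V) : is_derive x 'e_j (fun x : V => a * x 0 i + b) (a * (i == j)%:R).
  have := is_deriveD (derive_coord a i j x) (is_derive_cst b x 'e_j).
  by rewrite addr0.
have Ec l : continuous (E l).
  move=> t; apply/differentiable_continuous/derivable1_diffP.
  exact: (@ex_derive _ _ _ _ _ _ _ (dE l t)).
have lc : continuous (fun x : V => a * x 0 i + b).
  apply: (@continuous_lipschitz_rV _ _ _ `|a|) => y z.
  rewrite opprD addrACA subrr addr0 -mulrBr normrM ler_wpM2l// (bigD1 i)//=.
  by rewrite lerDl sumr_ge0.
suff H l : Ck k (fun x : V => E l (a * x 0 i + b)) by exact: H.
elim: k l => [|k IH] l.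
  by split => // x; apply: continuous_comp; [exact: lc|exact: Ec].
split; first by move=> x; apply: continuous_comp; [exact: lc|exact: Ec].
move=> j; have dEl x := is_derive_comp (dE l _) (dl j x).
split; first by move=> x; exact: (@ex_derive _ _ _ _ _ _ _ (dEl x)).
rewrite (_ : 'D_('e_j) _ = fun x => E l.+1 (a * x 0 i + b) * (a * (i == j)%:R)).
  by apply: CkM; [exact: IH|exact: Ck_cst].
by apply/funext => x; exact: (@derive_val _ _ _ _ _ _ _ (dEl x)).
Qed.

Definition box_bump (c : R) (a b x : V) : R :=
  \prod_i (flat c 0 (x 0 i - a 0 i) * flat c 0 (b 0 i - x 0 i)).

Lemma smooth_box_bump c a b : 0 < c -> smooth (box_bump c a b).
Proof.
move=> c0; apply: smooth_prod => i; apply: smoothM.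
  have := @smooth_comp_coord (flat c) 1 (- a 0 i) i (fun k t => is_derive_flat k t c0).
  by under eq_fun do rewrite mul1r.
have := @smooth_comp_coord (flat c) (-1) (b 0 i) i (fun k t => is_derive_flat k t c0).
by under eq_fun do rewrite mulN1r addrC.
Qed.

Lemma box_bump_ge0 c a b x : 0 <= box_bump c a b x.
Proof. by apply: prodr_ge0 => i _; rewrite mulr_ge0 ?flat_ge0. Qed.

Lemma box_bump_le1 c a b x : 0 < c -> box_bump c a b x <= 1.
Proof.
move=> c0; apply: (@le_trans _ _ (\prod_(i < n) 1)); last by rewrite big1.
apply: ler_prod => i _; rewrite mulr_ge0 ?flat_ge0//=.
by rewrite -[leRHS]mulr1 ler_pM ?flat_ge0 ?flat_le1.
Qed.

Lemma box_bump_eq0 c (a b x : V) i : (x 0 i <= a 0 i) \/ (b 0 i <= x 0 i) ->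
  box_bump c a b x = 0.
Proof.
rewrite /box_bump (bigD1 i)//= => -[h|h].
  by rewrite flat0 ?mul0r// subr_le0.
by rewrite [X in _ * X * _]flat0 ?mulr0 ?mul0r// subr_le0.
Qed.

(** Vanishing outside a coordinate cube is the working form of compact support; [supported_test] and
    [test_supported] pass to and from [test_function]. *)
Definition supported_in (M : R) f := forall (x : V) j, M < `|x 0 j| -> f x = 0.

Definition cube (M : R) : set V := [set v | forall j, v 0 j \in `[- M, M]].

Lemma compact_cube M : compact (cube M).
Proof.
have := @rV_compact R n (fun=> `[- M, M]%classic) (fun _ => @segment_compact R (- M) M).
by congr compact; apply/seteqP; split.
Qed.

Lemma supported_cube M f x : supported_in M f -> f x != 0 -> cube M x.
Proof.
move=> fM fx j; rewrite in_itv/= -ler_norml leNgt; apply/negP => h.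
by move/eqP: fx; apply; exact: fM h.
Qed.

Lemma supported_test (phi : schwartz R n) M : supported_in M phi -> test_function phi.
Proof.
move=> pM; rewrite /test_function.
apply: (@subclosed_compact _ _ (cube M)); [exact: closed_closure|exact: compact_cube|].
rewrite [X in _ `<=` X](closure_id _).1; last first.
  by apply: compact_closed; [exact: norm_hausdorff|exact: compact_cube].
by apply: closureS => x /= /(supported_cube pM).
Qed.

Lemma ler_coord_norm (x : V) j : `|x 0 j| <= `|x|.
Proof.
rewrite [leRHS]/Num.norm/= mx_normrE.
by apply: (le_bigmax _ (fun ij : 'I_1 * 'I_n => `|x ij.1 ij.2|) (0, j)).
Qed.

Lemma test_supported (phi : schwartz R n) : test_function phi -> exists M, supported_in M phi.
Proof.
move=> /compact_bounded[M [_ hM]]; exists (M + 1) => x j xM.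
apply/eqP; apply: contraTT xM => px; rewrite -leNgt (le_trans (ler_coord_norm _ _))//.
by apply: (hM (M + 1)); [rewrite ltrDl|exact: subset_closure].
Qed.

Lemma supported_D M f i : supported_in M f -> supported_in M (D i f).
Proof.
move=> fM x j xj.
have N : \forall y \near x, f y = 0.
  have e0 : 0 < `|x 0 j| - M by rewrite subr_gt0.
  apply: filterS (coord_near x e0) => y /(_ j) yx; apply: (fM y j).
  have := ler_normB (x 0 j - y 0 j) (- y 0 j); rewrite opprK subrK normrN distrC.
  by move: yx; lra.
apply: complexP => /=.
  rewrite (@near_eq_derive _ _ _ _ (cst 0)) ?derive_cst//.
  by apply: filterS N => y /= ->.
rewrite (@near_eq_derive _ _ _ _ (cst 0)) ?derive_cst//.
by apply: filterS N => y /= ->.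
Qed.

Lemma supported_cpderiv M f s : supported_in M f -> supported_in M (cpderiv s f).
Proof.
move=> fM; elim: s => [|i s IH]; first by rewrite cpderiv_nil.
by rewrite cpderiv_cons; exact: supported_D.
Qed.

Lemma continuous_cube_bounded h M : continuous h -> exists B, forall x, cube M x -> `|h x| <= B.
Proof.
move=> ch.
have /compact_bounded[B [_ hB]] : compact (h @` cube M).
  apply: (@continuous_compact _ _ h (cube M)); last exact: compact_cube.
  exact: continuous_subspaceT.
by exists (B + 1) => x xM; apply: (hB (B + 1)); [rewrite ltrDl|exists x].
Qed.

Lemma supported_schwartz M f : csmooth f -> supported_in M f -> is_schwartz f.
Proof.
move=> sf fM; split => // a s.
have [B1 h1] := continuous_cube_bounded M (sf.1 s).1.
have [B2 h2] := continuous_cube_bounded M (sf.2 s).1.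
exists (`|M| ^+ size a * (`|B1| + `|B2|)) => x.
have [->|fx] := eqVneq (cpderiv s f x) 0.
  by rewrite mulr0 normr0 lecR mulr_ge0 ?exprn_ge0// addr_ge0.
have xM := supported_cube (supported_cpderiv s fM) fx.
rewrite (le_trans (ler_normC_norm1 _))// lecR norm1Z ler_pM ?norm1_ge0//.
  rewrite /monomial; elim: a => [|i a IH]; first by rewrite big_nil normr1.
  rewrite big_cons exprS normrM ler_pM//; have := xM i.
  rewrite in_itv/= -ler_norml => /le_trans; apply; exact: ler_norm.
rewrite /norm1 lerD//=.
  by rewrite (le_trans (h1 x xM))// ler_norm.
by rewrite (le_trans (h2 x xM))// ler_norm.
Qed.

End test_functions.

(** * Tempered distributions *)

Section tempered_distributions.
Variables (R : realType) (n : nat).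
Local Notation V := 'rV[R]_n.
Implicit Types (f g : V -> R[i]) (phi psi : schwartz R n) (u : schwartz R n -> R[i]^o).
Implicit Types (s : seq 'I_n) (T : (V -> R[i]) -> V -> R[i]).

Lemma to_schwartzE f : is_schwartz f -> to_schwartz f = f :> (V -> R[i]).
Proof. by move=> sf; rewrite /to_schwartz insubdK// inE. Qed.

Lemma to_schwartzK phi : to_schwartz phi = phi.
Proof. by apply: val_inj; exact: to_schwartzE (schwartzP phi). Qed.

Lemma eq_to_schwartz f phi : f = phi -> to_schwartz f = phi.
Proof. by move=> ->; exact: to_schwartzK. Qed.

Lemma to_schwartz_linear (c : R[i]) f g : is_schwartz f -> is_schwartz g ->
  to_schwartz (c *: f + g) = c *: to_schwartz f + to_schwartz g.
Proof.
move=> sf sg; apply: eq_to_schwartz.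
transitivity (c *: (to_schwartz f : V -> R[i]) + to_schwartz g) => //.
by rewrite !to_schwartzE.
Qed.

Lemma gt0_realC (e : R[i]) : 0 < e -> exists2 d : R, 0 < d & e = d%:C.
Proof.
by case: e => a b; rewrite ltcE /= => /andP[/eqP -> a0]; exists a.
Qed.

Section linear.
Variable u : schwartz R n -> R[i]^o.
Hypothesis lu : linear u.

Lemma lin0 : u 0 = 0.
Proof.
have := lu (-1) 0 0; rewrite scaler0 add0r scaleN1r => /eqP.
by rewrite addrC subrr => /eqP.
Qed.

Lemma linZ (c : R[i]) phi : u (c *: phi) = c * u phi.
Proof. by rewrite -[c *: phi]addr0 lu lin0 addr0. Qed.

Lemma linD phi psi : u (phi + psi) = u phi + u psi.
Proof. by rewrite -[phi]scale1r lu !scale1r. Qed.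

Lemma linB phi psi : u (phi - psi) = u phi - u psi.
Proof. by rewrite linD -scaleN1r linZ mulN1r. Qed.

Lemma lin_sum I (r : seq I) (F : I -> schwartz R n) :
  u (\sum_(i <- r) F i) = \sum_(i <- r) u (F i).
Proof.
elim: r => [|i r IH]; first by rewrite !big_nil lin0.
by rewrite !big_cons linD IH.
Qed.

Lemma bound_continuous : (exists k (C : R), forall phi e, bounded_by k e phi ->
  norm1 (u phi) <= C * e) -> continuous u.
Proof.
move=> [k [C uC]] phi.
apply: (@cvgrPdist_lt _ _ _ (nbhs phi) (nbhs_filter phi) u (u phi)).2 => eps /gt0_realC[d d0 ->].
(* [K] covers the monomials of degree up to 2 n k and the derivatives of order up to k required by
   [schwartz_bounded_by]; [e] is chosen so that the final bound is [d]. *)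
pose K := (2 * (n * k) + k)%N; pose e := d / (2 ^+ (n * k) * 2 * (`|C| + 1)).
have p0 : 0 < 2 ^+ (n * k) * 2 * (`|C| + 1).
  by rewrite mulr_gt0 ?ltr_wpDl// mulr_gt0// exprn_gt0.
exists K, e; split; first exact: divr_gt0.
move=> psi b; rewrite -linB (le_lt_trans (ler_normC_norm1 _))// ltcR.
have H : bounded_by k (2 ^+ (n * k) * (2 * e)) (psi - phi).
  apply: schwartz_bounded_by => a s ak sk x; apply: b.
    exact: leq_trans (leq_addr _ _).
  exact: leq_trans (leq_addl _ _).
have e2 : 0 <= 2 ^+ (n * k) * (2 * e) by exact: bounded_by_ge0 H.
have -> : norm1 (u (phi - psi)) = norm1 (u (psi - phi)) by rewrite !linB norm1BC.
rewrite (le_lt_trans (uC _ _ H))// (@lt_le_trans _ _ ((`|C| + 1) * (2 ^+ (n * k) * (2 * e))))//.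
  rewrite ltr_pM2r; first by rewrite (le_lt_trans (ler_norm _))// ltrDl.
  by rewrite mulr_gt0 ?exprn_gt0// mulr_gt0// divr_gt0.
have -> : (`|C| + 1) * (2 ^+ (n * k) * (2 * e)) = e * (2 ^+ (n * k) * 2 * (`|C| + 1)) by ring.
by rewrite /e divfK// lt0r_neq0.
Qed.

End linear.

(** Continuity at 0 bounds [u] by 1 on a ball, and rescaling [phi] into the ball gives the estimate.
    The 2 in the constant is the passage from the modulus to [norm1]. *)
Lemma tempered_bound u : tempered u ->
  exists k (C : R), 0 <= C /\ forall phi e, bounded_by k e phi -> norm1 (u phi) <= C * e.
Proof.
move=> [lu cu].
have /(@cvgrPdist_lt _ _ _ (nbhs (0 : schwartz R n)) (nbhs_filter _) u (u 0)) := cu 0.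
move=> /(_ 1 ltr01) [k [e0 [e00 He]]]; exists k, (2 / e0); split; first exact: divr_ge0 (ltW _).
move=> phi e be; have e_ge0 := bounded_by_ge0 be.
apply/ler_addgt0Pr => d d0.
(* Made positive, in case e = 0, to allow the division; the excess contributes exactly d, since (2 /
   e0) (d e0 / 2) = d. *)
pose e' := e + d * e0 / 2.
have e'0 : 0 < e' by rewrite ltr_wpDl// divr_gt0// mulr_gt0.
have e'e : e <= e' by rewrite lerDl divr_ge0// mulr_ge0// ltW.
have c0 : 0 < e0 / e' by exact: divr_gt0.
have B : schwartz_ball 0 k e0 ((e0 / e')%:C *: phi).
  move=> a s ak sk x; rewrite subr0; apply: (@bounded_by_schwartz _ _ k) => //.
  have := bounded_byZ (e0 / e')%:C (schwartzP phi).1 (bounded_by_le (leqnn k) e'e be).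
  by rewrite norm1_real gtr0_norm// divfK// lt0r_neq0.
have := He _ B; rewrite /= (lin0 lu) sub0r normrN (linZ lu) => /ltW.
move=> /(@ler_norm1_normC R _ 1); rewrite norm1Z gtr0_norm// mulr1.
rewrite -ler_pdivlMl// invf_div => /le_trans; apply.
rewrite /e' le_eqVlt; apply/orP; left; apply/eqP; field; exact: lt0r_neq0.
Qed.

Definition linear_on_schwartz T := forall (c : R[i]) f g, is_schwartz f -> is_schwartz g ->
  T (c *: f + g) = c *: T f + T g.

Lemma tempered_comp u T : tempered u -> continuous_operator T -> linear_on_schwartz T ->
  tempered (fun phi => u (to_schwartz (T phi))).
Proof.
move=> tu cT lT; have [lu _] := tu.
have lc : linear (fun phi => u (to_schwartz (T phi)) : R[i]^o).
  move=> c phi psi /=.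
  rewrite (_ : T (c *: phi + psi)%R = c *: T phi + T psi); last first.
    by rewrite -lT//; exact: schwartzP.
  by rewrite to_schwartz_linear ?lu//; exact/(operator_schwartz cT)/schwartzP.
split => //; apply: bound_continuous => //.
have [k [C [C0 uC]]] := tempered_bound tu; have [k' [C' [C'0 TC]]] := cT.2 k.
exists k', (C * C') => phi e be; rewrite -mulrA; apply: uC.
rewrite to_schwartzE; last exact/(operator_schwartz cT)/schwartzP.
by apply: TC => //; exact: schwartzP.
Qed.

Lemma tempered_combination u1 u2 (c1 c2 : R[i]) : tempered u1 -> tempered u2 ->
  tempered (fun phi => c1 * u1 phi + c2 * u2 phi : R[i]^o).
Proof.
move=> t1 t2; have [l1 _] := t1; have [l2 _] := t2.
have lc : linear (fun phi => c1 * u1 phi + c2 * u2 phi : R[i]^o).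
  move=> c phi psi /=; rewrite l1 l2 /GRing.scale /=; ring.
split => //; apply: bound_continuous => //.
have [k1 [C1 [C10 h1]]] := tempered_bound t1; have [k2 [C2 [C20 h2]]] := tempered_bound t2.
exists (maxn k1 k2), (norm1 c1 * C1 + norm1 c2 * C2) => phi e be.
rewrite (le_trans (ler_norm1D _ _))// mulrDl lerD// (le_trans (ler_norm1M _ _))//
  -mulrA ler_wpM2l ?norm1_ge0//.
  by apply: h1; apply: bounded_by_le be => //; exact: leq_maxl.
by apply: h2; apply: bounded_by_le be => //; exact: leq_maxr.
Qed.

Lemma tempered_one : tempered (@one_dist R n).
Proof.
have si phi : cintegrable (lebesgue_rV R n) phi by exact/schwartz_integrable/schwartzP.
have lo : linear (@one_dist R n).
  move=> c phi psi; rewrite /one_dist !cintegralE.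
  transitivity (c * cint (lebesgue_rV R n) phi + cint (lebesgue_rV R n) psi) => //.
  rewrite -cintZ// -cintD//; exact: cintegrableZ.
split => //; apply: bound_continuous => //; exists 1%N, (weight_mass R n) => phi e be.
rewrite mulrC; apply: (norm1_cint_weight _ _).2.
  exact/csmooth_cmeasurable/(schwartzP phi).1.
by move=> x; exact: bounded_by_weight be.
Qed.

End tempered_distributions.

(** * Dilations, cutoffs and density of the test functions *)

Section density.
Variables (R : realType) (n : nat).
Local Notation V := 'rV[R]_n.
Local Notation "'e_ i" := (delta_mx 0 i : V) (at level 8, i at level 2, format "''e_' i").
Local Notation D i f := (cpderiv [:: i] f).
Implicit Types (h : V -> R) (f g : V -> R[i]) (s : seq 'I_n).

Definition dilate (e : R) f : V -> R[i] := fun x => f (e *: x).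

Lemma derive_dilate (e : R) h i (x : V) : derivable h (e *: x) 'e_i ->
  is_derive x 'e_i (fun y => h (e *: y)) (e * 'D_('e_i) h (e *: x)).
Proof.
move=> dh; apply/is_derive_lineP.
have H : is_derive (e * 0) 1 (fun t : R => h (e *: x + t *: 'e_i)) ('D_('e_i) h (e *: x)).
  by rewrite mulr0; apply/is_derive_lineP; exact: DeriveDef.
have em : is_derive (0 : R) 1 (fun t => e * t) e.
  by have := is_deriveZ e (is_derive_id (0 : R) 1); rewrite scaler1.
have := is_derive1_comp H em; rewrite mulrC.
by congr is_derive; apply/funext => t /=; rewrite scalerDr scalerA.
Qed.

Lemma smooth_dilate (e : R) h : smooth h -> smooth (fun x => h (e *: x)).
Proof.
move=> /smooth_Ck sh; apply/smooth_Ck => k.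
have ec : continuous (fun x : V => e *: x).
  by move=> x; exact: scaler_continuous.
elim: k h sh => [|k IH] h sh; (split; [by move=> x; apply: continuous_comp; [exact:
  ec|exact: (sh 0%N).1]|]) => //.
move=> i; have d1 x := ((sh 1%N).2 i).1 (e *: x).
split; first by move=> x; exact: (@ex_derive _ _ _ _ _ _ _ (derive_dilate (d1 x))).
rewrite (_ : 'D_('e_i) _ = fun x => e * 'D_('e_i) h (e *: x)).
  apply: CkM; first exact: Ck_cst.
  exact (IH _ (fun l => ((sh l.+1).2 i).2)).
by apply/funext => x; exact: (@derive_val _ _ _ _ _ _ _ (derive_dilate (d1 x))).
Qed.

Lemma csmooth_dilate (e : R) f : csmooth f -> csmooth (dilate e f).
Proof. by move=> [f1 f2]; split; [exact: smooth_dilate f1|exact: smooth_dilate f2]. Qed.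

Lemma cpderiv_dilate (e : R) s f : csmooth f ->
  cpderiv s (dilate e f) = fun x => (e ^+ size s)%:C * cpderiv s f (e *: x).
Proof.
move=> sf; elim: s => [|i s IH].
  by rewrite !cpderiv_nil; apply/funext => x; rewrite mul1r.
rewrite cpderiv_cons IH; have sfs := csmooth_cpderiv s sf.
apply/funext => x; have [d1 d2] := csmooth_cderivable sfs i (e *: x).
rewrite /= exprSr.
have E (P : R[i] -> R) : (forall (c : R) z, P (c%:C * z) = c * P z) ->
    derivable (P \o cpderiv s f) (e *: x) 'e_i ->
    'D_('e_i) (P \o (fun x => (e ^+ size s)%:C * cpderiv s f (e *: x))) x =
    e ^+ size s * (e * 'D_('e_i) (P \o cpderiv s f) (e *: x)).
  move=> PZ dP.
  have D1 := is_deriveZ (e ^+ size s) (derive_dilate dP).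
  have -> : P \o (fun x => (e ^+ size s)%:C * cpderiv s f (e *: x)) =
      e ^+ size s *: (fun x => (P \o cpderiv s f) (e *: x)).
    by apply/funext => y /=; rewrite PZ.
  exact: (@derive_val _ _ _ _ _ _ _ D1).
apply: complexP; rewrite ?cReM ?cImM /= E//.
- by rewrite mul0r subr0 mulrA.
- by move=> c z; rewrite cReM/= mul0r subr0.
- by rewrite mul0r addr0 mulrA.
- by move=> c z; rewrite cImM/= mul0r addr0.
Qed.

Lemma cpderiv_cst0 s (c : R[i]) : (0 < size s)%N ->
  cpderiv s (fun _ : V => c) = (fun=> 0).
Proof.
move=> s0; apply/funext => x; rewrite /cpderiv.
rewrite (_ : _ \o _ = fun=> complex.Re c)// (_ : @complex.Im R \o _ = fun=> complex.Im c)//.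
by rewrite !pderiv_cst; case: s s0.
Qed.

(** A bump on the unit cube, divided by its positive value at the origin. *)
Lemma cutoff_exists : exists f, [/\ csmooth f, f 0 = 1 & supported_in 1 f].
Proof.
pose a : V := const_mx (-1); pose b : V := const_mx 1.
pose h := box_bump 1 a b.
have h0 : 0 < h 0.
  by apply: prodr_gt0 => i _; rewrite mulr_gt0// flat_gt0// !mxE ?opprK ?add0r ?subr0.
exists (ofreal (fun x => (h 0)^-1 * h x)); split.
- by apply: csmooth_real; apply: smoothZ; exact: smooth_box_bump.
- by rewrite /ofreal mulVf// lt0r_neq0.
- move=> x j xj; rewrite /ofreal.
  have -> : h x = 0; last by rewrite mulr0.
  apply: (@box_bump_eq0 R n 1 a b x j).
  rewrite !mxE; move: xj; have [x0|x0] := leP 0 (x 0 j).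
    by rewrite ger0_norm// => /ltW; right.
  by rewrite ltr0_norm// => /ltW; rewrite lerNr; left.
Qed.

(* With a cutoff w equal to 1 at 0, the functions (w (e x) - 1) / e and their *)
(* derivatives grow polynomially, uniformly in e, so that w (e x) phi (x)     *)
(* tends to phi in the Schwartz class.                                        *)
Lemma test_dense (u : schwartz R n -> R[i]^o) : tempered u ->
  (forall phi, test_function phi -> u phi = 0) -> forall phi, u phi = 0.
Proof.
move=> tu u0 phi; have [lu _] := tu.
have [w [sw w1 wS]] := cutoff_exists.
have /is_schwartzP[_ wb] := supported_schwartz sw wS.
pose e (m : nat) : R := m.+1%:R^-1.
have e0 m : 0 < e m by rewrite /e.
have e1 m : e m <= 1 by rewrite /e invf_le1// ler1n.
pose fam m := (fun x => (e m)^-1%:C * (dilate (e m) w x + (fun=> -1) x)).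
have sd m : csmooth (dilate (e m) w) := csmooth_dilate (e m) sw.
have famE m : fam m = ((e m)^-1%:C : R[i]) *: (dilate (e m) w + (fun=> -1)) by [].
have sc : csmooth (fun _ : V => -1 : R[i]) := @csmooth_cst R n (-1).
have sfam m : csmooth (fam m) by exact (csmoothZ _ (csmoothD (sd m) sc)).
have bfam s : exists p (C : R), forall m x, norm1 (cpderiv s (fam m) x) <= C * weight x ^+ p.
  (* At order 0, w(0) = 1 and the Lipschitz bound of w make (w(e x) - 1) / e grow at most linearly.
     At order |s| >= 1, dilation brings a factor e^|s|, which absorbs 1/e because e <= 1. *)
  case: (posnP (size s)) => [/size0nil ->|s0].
    have [B hB] := wb 1%N; have B0 := bounded_by_ge0 hB.
    exists 1%N, (2 * B * n%:R) => m x; rewrite cpderiv_nil /fam norm1Z gtr0_norm ?invr_gt0//.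
    rewrite ler_pdivrMl// expr1.
    have L : norm1 (w (e m *: x) - w 0) <= 2 * B * \sum_j `|(e m *: x) 0 j - (0 : V) 0 j|.
      apply: lipschitz_norm1; first exact: csmooth_cderivable.
      move=> i z _; apply: le_trans (bounded_by_norm1 z _ hB) _ => //.
      by rewrite ler_pdivrMr ?exprn_gt0 ?weight_gt0// ler_peMr// exprn_ege1// weight_ge1.
    rewrite -w1 (le_trans L)//.
    have -> : e m * (2 * B * n%:R * weight x) = 2 * B * \sum_(j < n) (e m * weight x).
      rewrite sumr_const card_ord -[in RHS]mulr_natl; ring.
    rewrite ler_wpM2l ?mulr_ge0//; apply: ler_sum => j _.
    by rewrite !mxE subr0 normrM gtr0_norm// ler_wpM2l ?ler_coord_weight// ltW.
  have [B hB] := wb (size s); have B0 := bounded_by_ge0 hB.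
  exists 0%N, B => m x; rewrite expr0 mulr1 famE.
  rewrite cpderivZ; last exact (csmoothD (sd m) sc).
  rewrite (cpderivD s (sd m) sc) (cpderiv_cst0 (-1) s0) (cpderiv_dilate (e m) s sw).
  have -> : ((e m)^-1%:C *: ((fun x : V => (e m ^+ size s)%:C * cpderiv s w (e m *: x)) +
    (fun=> 0))) x =
      (e m)^-1%:C * ((e m ^+ size s)%:C * cpderiv s w (e m *: x)).
    transitivity ((e m)^-1%:C * ((e m ^+ size s)%:C * cpderiv s w (e m *: x) + 0)) => //.
    by rewrite addr0.
  rewrite !norm1Z gtr0_norm ?invr_gt0// gtr0_norm ?exprn_gt0//.
  rewrite ler_pdivrMl//; case: s s0 hB => // i s _ hB; rewrite exprS -mulrA.
  apply: ler_wpM2l; first exact: ltW.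
  apply: (@le_trans _ _ (norm1 (cpderiv (i :: s) w (e m *: x)))).
    by rewrite ler_piMl ?norm1_ge0//; apply: exprn_ile1; first exact: ltW.
  apply: le_trans (bounded_by_norm1 (e m *: x) _ hB) _ => //.
  by rewrite ler_pdivrMr ?exprn_gt0 ?weight_gt0// ler_peMr// exprn_ege1// weight_ge1.
have [k0 [C0 [C00 uC]]] := tempered_bound tu.
have BM := bounded_byM sfam bfam; have [k' [C [C_ge0 hC]]] := BM k0.
have [sphi pb] := (is_schwartzP phi).1 (schwartzP phi); have [e' hb] := pb k'.
have fs m : is_schwartz (fun x => fam m x * phi x).
  apply/is_schwartzP; split; first exact (csmoothM (sfam m) sphi).
  move=> k; have [k1 [C1 [_ h1]]] := BM k; have [e1' he1] := pb k1.
  by exists (C1 * e1'); exact: h1.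
have ss m : supported_in (e m)^-1 (fun x => dilate (e m) w x * phi x).
  move=> x j xj; rewrite /dilate (wS _ j) ?mul0r//.
  by rewrite mxE normrM gtr0_norm// -ltr_pdivrMl// mulr1.
have cs m : is_schwartz (fun x => dilate (e m) w x * phi x).
  exact (supported_schwartz (csmoothM (sd m) sphi) (ss m)).
(* As u vanishes on the compactly supported w(e x) phi, what remains is the error term, with an
   explicit factor e. *)
have E m : u phi = - ((e m)%:C * u (to_schwartz (fun x => fam m x * phi x))).
  have T : u (to_schwartz (fun x => dilate (e m) w x * phi x)) = 0.
    apply: u0; apply: (@supported_test _ _ _ (e m)^-1) => x j xj.
    by rewrite to_schwartzE//; exact: ss xj.
  apply/eqP; rewrite -addr_eq0 addrC -(linZ lu) -(linD lu) -T; apply/eqP; congr u.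
  apply/esym/eq_to_schwartz/funext => x.
  transitivity ((e m)%:C * (to_schwartz (fun x => fam m x * phi x) : V -> R[i]) x + phi x) => //.
  rewrite to_schwartzE// /fam mulrA mulrA -rmorphM/= divff ?gt_eqF// mul1r mulrDl mulN1r addrNK.
  by [].
have K0 : 0 <= C0 * (C * e') by rewrite !mulr_ge0// (bounded_by_ge0 hb).
apply: norm1_eq_small => d d0.
have [m _ /(_ m (leqnn m)) /= hm] := large_nat (C0 * (C * e') / d).
rewrite (E m) norm1N norm1Z gtr0_norm// ler_pdivrMl//.
apply: (@le_trans _ _ (C0 * (C * e'))).
  by apply: uC; rewrite to_schwartzE//; exact: hC.
by rewrite -ler_pdivrMr// ltW.
Qed.

End density.

(** * The lemma of du Bois-Reymond *)

Section du_bois_reymond.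
Variables (R : realType) (n : nat).
Local Notation V := 'rV[R]_n.
Local Notation leb := (lebesgue_rV R n).
Implicit Types (h : V -> R) (a b x : V).

Lemma measurable_coordinates (B : 'I_n -> set (measurableTypeR R)) :
  (forall j, measurable (B j)) -> measurable [set x : V | forall j, B j (x 0 j)].
Proof.
move=> mB; rewrite (_ : [set _ | _] = \big[setI/setT]_(j < n) (@rV_coord R n j @^-1` B j)).
  apply: bigsetI_measurable => j _; rewrite -[X in measurable X]setTI.
  exact: measurable_rV_coord.
rewrite -bigcap_seq; apply/seteqP; split => x /=; first by move=> xB j _; exact: xB.
by move=> xB j; apply: xB; rewrite /= mem_index_enum.
Qed.

Lemma measurable_cube (M : R) : measurable (@cube R n M).
Proof. exact: (@measurable_coordinates (fun=> `[- M, M]%classic)). Qed.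

Definition half_open_box a b : set V := [set x | forall j, x 0 j \in `]a 0 j, b 0 j]].

Lemma measurable_half_open_box a b : measurable (half_open_box a b).
Proof. exact: (@measurable_coordinates (fun j => `]a 0 j, b 0 j]%classic)). Qed.

Definition half_open_boxes : set (set V) := [set A | exists a b, A = half_open_box a b].

Lemma half_open_boxes_setI : setI_closed half_open_boxes.
Proof.
move=> _ _ [a [b ->]] [c [d ->]].
exists (\row_j Num.max (a 0 j) (c 0 j)), (\row_j Num.min (b 0 j) (d 0 j)).
apply/seteqP; split => x /=.
  move=> [xa xc] j; have := xa j; have := xc j; rewrite !in_itv/= !mxE gt_max le_min.
  by move=> /andP[-> ->] /andP[-> ->].
move=> xH; split => j; have := xH j; rewrite !in_itv/= !mxE gt_max le_min;
  by move=> /andP[/andP[h1 h2] /andP[h3 h4]]; apply/andP.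
Qed.

Lemma measurable_half_open_boxes : @measurable _ V = <<s half_open_boxes >>.
Proof.
apply/seteqP; split; last first.
  apply: smallest_sub; first exact: sigma_algebra_measurable.
  by move=> _ [a [b ->]]; exact: measurable_half_open_box.
apply: smallest_sub; first exact: smallest_sigma_algebra.
rewrite -bigcup_seq => A /= [i _ [B mB <-]]; rewrite setTI.
pose C : set (set R) := [set B | <<s half_open_boxes >> (@rV_coord R n i @^-1` B)].
suff : C B by [].
move: B mB; apply: smallest_sub.
  have sa := smallest_sigma_algebra setT half_open_boxes.
  split.
  - by rewrite /C/= preimage_set0; exact: sigma_algebra0.
  - move=> B CB; rewrite /C/= setTD preimage_setC -setTD; exact: sigma_algebraCD.
  - by move=> F CF; rewrite /C/= preimage_bigcup; exact: sigma_algebra_bigcup.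
move=> _ [[u v] _ <-]; rewrite /C/=.
(* A slab in one coordinate is the union of boxes that are bounded by -k and k in the other
   coordinates. *)
rewrite (_ : _ @^-1` _ = \bigcup_k half_open_box
    (\row_j if j == i then u else - k%:R) (\row_j if j == i then v else k%:R)).
  apply: sigma_algebra_bigcup => k; apply: sub_sigma_algebra.
  by do 2 eexists; reflexivity.
apply/seteqP; split => [x xi|x [k _ /(_ i)]]; last by rewrite !mxE eqxx.
exists (Num.truncn (\sum_j `|x 0 j|)).+1 => // j; rewrite !mxE.
have [->|ji] := eqVneq j i; first exact: xi.
have H : `|x 0 j| < (Num.truncn (\sum_j `|x 0 j|)).+1%:R.
  apply: le_lt_trans (truncnS_gt _); rewrite (bigD1 j)//= lerDl.
  exact: sumr_ge0.
by move: H; rewrite ltr_norml in_itv/= => /andP[-> /ltW ->].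
Qed.

Lemma flat_pos (c t : R) : 0 < t -> flat c 0 t = expR (- (c / t)).
Proof. by move=> t0; rewrite /flat t0 hornerC mul1r. Qed.

(** exp(-c/d) is at least 1 - c/d. With c = h^2 and h <= K d this is 1 - K h, even when d itself
    shrinks like h. *)
Lemma flat_cvg1 (d : nat -> R) (K : R) : (forall m, 0 < d m) ->
  (forall m, harmonic m <= K * d m) -> flat (harmonic m ^+ 2) 0 (d m) @[m --> \oo] --> (1 : R).
Proof.
move=> d0 dK.
apply: (@squeeze_cvgr _ _ _ _ (fun m => 1 - K * harmonic m) (fun=> 1)).
- apply: nearW => m; have h0 : 0 < harmonic m :> R by exact: harmonic_gt0.
  rewrite flat_le1 ?exprn_gt0// andbT flat_pos// (le_trans _ (expR_ge1Dx _))//.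
  by rewrite lerD2l lerN2 ler_pdivrMr// expr2 -mulrA mulrCA ler_wpM2l// ltW.
- rewrite -[X in _ --> X]subr0 -(mulr0 K); apply: cvgB; first exact: cvg_cst.
  by apply: cvgM; [exact: cvg_cst|exact: cvg_harmonic].
- exact: cvg_cst.
Qed.

Lemma cvg_prod1 (I : Type) (r : seq I) (F : I -> nat -> R) :
  (forall i, F i m @[m --> \oo] --> (1 : R)) ->
  \prod_(i <- r) F i m @[m --> \oo] --> (1 : R).
Proof.
move=> F1; elim: r => [|i r IH].
  by under eq_fun do rewrite big_nil; exact: cvg_cst.
under eq_fun do rewrite big_cons.
by have := cvgM (F1 i) IH; rewrite mulr1; exact.
Qed.

(** The upper corner is pushed outwards by [harmonic m], so that points on the closed upper faces
    get limit 1, whereas the open lower faces keep the value 0. *)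
Lemma box_bump_cvg a b x :
  box_bump (harmonic m ^+ 2) a (b + const_mx (harmonic m)) x @[m --> \oo] -->
  (\1_(half_open_box a b) x : R).
Proof.
rewrite indicE; have [xb|] := pselect (half_open_box a b x).
  rewrite mem_set//; apply: cvg_prod1 => j;
  have := xb j; rewrite in_itv/= => /andP[ax xb'].
  have F1 : flat (harmonic m ^+ 2) 0 (x 0 j - a 0 j) @[m --> \oo] --> (1 : R).
    apply: (@flat_cvg1 _ (x 0 j - a 0 j)^-1) => m; first by rewrite subr_gt0.
    by rewrite mulVf ?subr_eq0 ?gt_eqF// /harmonic invf_le1// ler1n.
  have F2 : flat (harmonic m ^+ 2) 0 ((b + const_mx (harmonic m)) 0 j - x 0 j) @[m --> \oo]
    --> (1 : R).
    have h0 m : 0 < harmonic m :> R by exact: harmonic_gt0.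
    apply: (@flat_cvg1 _ 1) => m; rewrite !mxE.
      by rewrite addrAC ltr_wpDl// subr_ge0.
    by rewrite mul1r addrAC lerDr subr_ge0.
  by have := cvgM F1 F2; rewrite mulr1; exact.
move=> xb; rewrite memNset//; move: xb => /existsNP[j]; rewrite in_itv/= => /negP; rewrite
  negb_and -leNgt -ltNge => /orP[xa|bx].
  apply: cvg_near_cst; apply: nearW => m.
  by apply: (@box_bump_eq0 R n _ _ _ x j); left.
apply: cvg_near_cst.
have : \forall m \near \oo, harmonic m < x 0 j - b 0 j.
  have /cvgrPdist_lt/(_ (x 0 j - b 0 j)) := @cvg_harmonic R.
  rewrite subr_gt0 => /(_ bx); apply: filterS => m.
  by rewrite sub0r normrN gtr0_norm// harmonic_gt0.
apply: filterS => m hm; apply: (@box_bump_eq0 R n _ _ _ x j); right.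
by rewrite !mxE -lerBrDl ltW.
Qed.

Lemma cint_half_open_box h a b : measurable_fun setT h ->
  (forall M, leb.-integrable (cube M) (EFin \o h)) ->
  (forall c a b, 0 < c -> cint leb (ofreal (fun x => h x * box_bump c a b x)) = 0) ->
  cint leb (ofreal (fun x => h x * \1_(half_open_box a b) x)) = 0.
Proof.
move=> mh ih h0; apply: norm1_eq_small => e e0.
(* The final + 1 leaves room for the bumps, which reach up to b + harmonic m <= b + 1. *)
pose M : R := \sum_j (`|a 0 j| + `|b 0 j|) + 1.
have MP j : `|a 0 j| + `|b 0 j| + 1 <= M.
  by rewrite lerD2r (bigD1 j)//= lerDl sumr_ge0.
have ihM : integrableR leb (fun x => `|(h \_ (cube M)) x|).
  have := (integrable_mkcond (mu := leb) (EFin \o h) (measurable_cube M)).1 (ih M).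
  by rewrite restrict_EFin => /integrable_norm; exact.
pose bump m : V -> R := box_bump (harmonic m ^+ 2) a (b + const_mx (harmonic m)).
have c0 m : 0 < harmonic m ^+ 2 :> R by rewrite exprn_gt0// harmonic_gt0.
have h1 m : harmonic m <= 1 :> R by rewrite /harmonic invf_le1// ler1n.
have mb m : measurable_fun setT (bump m).
  by apply: continuous_measurable_rV; exact: (smooth_box_bump _ _ (c0 m) [::]).1.
have mi : measurable_fun setT (\1_(half_open_box a b) : V -> R).
  by apply: measurable_indic; exact: measurable_half_open_box.
have H := @cint_dominated _ _ _ leb (fun m x => (h x * bump m x)%:C)
  (fun x => (h x * \1_(half_open_box a b) x)%:C) _
  (fun m => cmeasurable_real (measurable_funM mh (mb m)))
  (cmeasurable_real (measurable_funM mh mi)) ihM.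
have {}H : norm1 (cint leb (fun x => (h x * bump m x)%:C) -
    cint leb (fun x => (h x * \1_(half_open_box a b) x)%:C)) @[m --> \oo] --> (0 : R).
  apply: H => [m x|x].
    rewrite norm1_real normrM patchE; case: ifPn => xM.
      by rewrite ler_piMr// ger0_norm ?box_bump_ge0// box_bump_le1.
    have {}xM : ~ cube M x by move=> xM'; move/negP: xM; apply; rewrite inE.
    rewrite [X in _ * X](_ : _ = 0) ?mulr0 ?normr0//.
    apply/eqP; rewrite normr_eq0; apply/eqP.
    move: xM => /existsNP[j]; rewrite in_itv/= => xj.
    apply: (@box_bump_eq0 R n _ _ _ x j); rewrite !mxE.
    have := MP j; have := h1 m; have [xa|xa] := leP (x 0 j) (a 0 j); first by left.
    have [xb|xb] := leP (b 0 j + harmonic m) (x 0 j); first by right.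
    move=> hm HM; exfalso; apply: xj; apply/andP.
    have := ler_norm (b 0 j); have := ler_norm (- a 0 j); rewrite normrN.
    have := normr_ge0 (b 0 j); have := normr_ge0 (a 0 j).
    move: hm xb; set t := harmonic m; move=> *; split; lra.
  have -> : (fun m => norm1 ((h x * bump m x)%:C - (h x * \1_(half_open_box a b) x)%:C)) =
      (fun m => `|h x * bump m x - h x * \1_(half_open_box a b) x|).
    by apply/funext => m; rewrite -norm1_real rmorphB.
  have C1 : h x * bump m x @[m --> \oo] --> h x * \1_(half_open_box a b) x.
    by apply: cvgM; [exact: cvg_cst|exact: box_bump_cvg].
  have C2 : (h x * \1_(half_open_box a b) x : R) @[m --> \oo] --> h x * \1_(half_open_box a b) x.
    exact: cvg_cst.
  by have := cvg_norm (cvgB C1 C2); rewrite subrr normr0; exact.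
have /cvgrPdist_lt/(_ e e0) [m _ /(_ m (leqnn m))] := H.
have -> : cint leb (fun x => (h x * bump m x)%:C) = 0 by exact: h0.
by rewrite /= !sub0r normrN norm1N ger0_norm ?norm1_ge0// => /ltW.
Qed.

(* The bumps approximate the indicators of half-open boxes, which form a      *)
(* pi-system generating the sigma-algebra.                                    *)
Lemma du_bois_reymond h : measurable_fun setT h ->
  (forall M, leb.-integrable (cube M) (EFin \o h)) ->
  (forall c a b, 0 < c -> cint leb (ofreal (fun x => h x * box_bump c a b x)) = 0) ->
  {ae leb, forall x, h x = 0}.
Proof.
move=> mh ih h0.
pose Q (M : nat) := half_open_box (const_mx (- M%:R)) (const_mx M%:R).
have bQ M : half_open_boxes (Q M) by do 2 eexists; reflexivity.
have mQ M : measurable (Q M) by exact: measurable_half_open_box.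
have hQ M : leb.-integrable setT ((EFin \o h) \_ (Q M)).
  apply/(integrable_mkcond (mu := leb) (EFin \o h) (mQ M)).
  apply: (integrableS (measurable_cube M%:R) (mQ M)) => [x xQ j|].
    by have := xQ j; rewrite !mxE !in_itv/= => /andP[/ltW -> ->].
  exact: ih.
(* The boxes [Q M] exhaust the space, and [h] cut off to one of them is integrable. *)
suff H M : ae_eq leb setT ((EFin \o h) \_ (Q M)) (cst 0%E).
  have := ae_foralln H; apply: filterS => x Hx.
  pose M := (Num.truncn (\sum_j `|x 0 j|)).+1.
  have xQ : x \in Q M.
    rewrite inE => j; rewrite !mxE.
    have HM : `|x 0 j| < M%:R.
      apply: le_lt_trans (truncnS_gt _); rewrite (bigD1 j)//= lerDl.
      exact: sumr_ge0.
    by move: HM; rewrite ltr_norml in_itv/= => /andP[-> /ltW ->].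
  by have := Hx M I; rewrite patchE xQ => -[].
apply: integral_ae_eq => // E _ mE; rewrite integral0.
have IE (A : set V) : measurable A -> leb.-integrable A ((EFin \o h) \_ (Q M)).
  by move=> mA; apply: integrableS (hQ M).
have box0 a b : (\int[leb]_(x in half_open_box a b) (h x)%:E = 0)%E.
  have mb := measurable_half_open_box a b.
  have ib : leb.-integrable (half_open_box a b) (EFin \o h).
    pose K : R := \sum_j (`|a 0 j| + `|b 0 j|).
    apply: (integrableS (measurable_cube K) mb) => [x xb j|].
      have KP : `|a 0 j| + `|b 0 j| <= K by rewrite /K (bigD1 j)//= lerDl sumr_ge0.
      have := xb j; rewrite !in_itv/= => /andP[xa xb'].
      have := ler_norm (b 0 j); have := ler_norm (- a 0 j); rewrite normrN.
      have := normr_ge0 (b 0 j); have := normr_ge0 (a 0 j).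
      by move=> *; apply/andP; split; lra.
    exact: ih.
  rewrite -[LHS]fineK; last exact: integrable_fin_num.
  have /(congr1 (@complex.Re R)) /= := cint_half_open_box a b mh ih h0.
  rewrite /Rintegral => E0; congr EFin; rewrite -{}E0; congr fine; rewrite [LHS]integral_mkcond.
  apply: eq_integral => x _; rewrite patchE indicE.
  by case: ifP => _; rewrite ?mulr1 ?mulr0.
have integral0T : (\int[leb]_x ((EFin \o h) \_ (Q M)) x = 0)%E.
  by rewrite -integral_mkcond; exact: box0.
move: mE; rewrite measurable_half_open_boxes.
apply: (dynkin_induction measurable_half_open_boxes half_open_boxes_setI
  (P := fun E => \int[leb]_(x in E) ((EFin \o h) \_ (Q M)) x = 0)%E).
- by rewrite -integral_mkcond; exact: box0.
- move=> _ [c [d ->]]; rewrite integral_mkcond -patch_setI -integral_mkcond.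
  have [c' [d' ->]] := half_open_boxes_setI (ex_intro _ c (ex_intro _ d erefl)) (bQ M).
  exact: box0.
- move=> S mS S0; have := integral0T.
  rewrite -(setUv S) integral_setU//; first by rewrite S0 add0e.
  + exact: measurableC.
  + by rewrite setUv; exact: measurable_int (hQ M).
  + by rewrite disj_set2E setICr.
- move=> F mF tF F0; rewrite integral_bigcup//; first by apply: eseries0 => k _ _; exact: F0.
  by apply: IE; exact: bigcup_measurable.
Qed.

(** By [cint_prod] applied to the indicators of its sides, the box has the product of the side
    lengths as measure. *)
Lemma half_open_box_measure_neq0 a b : (forall j, a 0 j < b 0 j) ->
  leb (half_open_box a b) <> 0%E.
Proof.
move=> ab B0.
pose f (j : 'I_n) (t : measurableTypeR R) : R[i] := (\1_(`]a 0 j, b 0 j]%classic) t)%:C.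
have mf j : measurable (`]a 0 j, b 0 j]%classic : set (measurableTypeR R)) by [].
have If j : (\int[@lebesgue_measure R]_t (\1_(`]a 0 j, b 0 j]%classic) t)%:E = (b 0 j - a 0
  j)%:E)%E.
  rewrite integral_indic// setIT.
  have := @lebesgue_measure_itv R `]a 0 j, b 0 j]; rewrite /= lte_fin ab => E.
  by rewrite EFinB; exact: E.
have fi j : cintegrable (@lebesgue_measure R) (f j).
  apply: cintegrable_real; apply/integrableP; split.
    exact/measurable_EFinP/measurable_indic.
  rewrite (_ : (fun t => _) = (fun t => (\1_(`]a 0 j, b 0 j]%classic) t)%:E)).
    by rewrite If ltry.
  by apply/funext => t /=; rewrite ger0_norm.
have [_] := cint_prod fi.
rewrite (_ : (fun x : V => _) = fun x => (\1_(half_open_box a b) x)%:C).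
  rewrite cint_real [X in X%:C](_ : _ = 0); last first.
    rewrite /Rintegral integral_indic//; last exact: measurable_half_open_box.
    by rewrite setIT; exact: (congr1 fine B0).
  move=> /(congr1 (@complex.Re R))/= /esym/eqP; apply/negP.
  under eq_bigr do rewrite cint_real /Rintegral If/=.
  rewrite -[X in complex.Re X](rmorph_prod (real_complex R))/=.
  by apply/prodf_neq0 => j _; rewrite subr_eq0 gt_eqF.
apply/funext => x; rewrite -[LHS](rmorph_prod (real_complex R))/=; congr (_%:C).
rewrite indicE; have [xb|xb] := pselect (half_open_box a b x).
  by rewrite mem_set// big1// => j _; rewrite indicE mem_set//; exact: xb.
rewrite memNset//; move: xb => /existsNP[j xj].
by rewrite (bigD1 j)//= indicE memNset ?mul0r.
Qed.

(** Any neighbourhood contains a nondegenerate box, which cannot lie inside the exceptional null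
    set. *)
Lemma ae_dense (P : V -> Prop) : {ae leb, forall x, P x} ->
  forall x (A : set V), nbhs x A -> exists y, A y /\ P y.
Proof.
move=> [N [mN N0 PN]] x A /near_of_coord[e e0 xA]; apply: contrapT => nE.
pose a : V := x - const_mx (e / 2); pose b : V := x + const_mx (e / 2).
have e20 : 0 < e / 2 by exact: divr_gt0.
apply: (@half_open_box_measure_neq0 a b).
  by move=> j; rewrite !mxE; lra.
apply/eqP; rewrite eq_le measure_ge0 andbT -N0.
apply: le_measure; rewrite ?inE//; first exact: measurable_half_open_box.
move=> y yb; apply: PN => /= Py; apply: nE; exists y; split => //; apply: xA => j.
have := yb j; rewrite in_itv/= !mxE => /andP[ya yb'].
by rewrite ltr_norml; apply/andP; split; lra.
Qed.

Lemma ae_eq_continuity_point h k x : {for x, continuous h} -> {for x, continuous k} ->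
  {ae leb, forall y, h y = k y} -> h x = k x.
Proof.
move=> ch ck hk; apply/eqP; rewrite -subr_eq0; apply: contraT => e0.
have e1 : 0 < `|h x - k x| by rewrite normr_gt0.
have := @cvgB _ _ _ _ (nbhs_filter x) _ _ _ _ ch ck.
move=> /(@cvgrPdist_lt _ _ _ (nbhs x) (nbhs_filter x))/(_ _ e1)/(ae_dense hk)[y [/=]].
move=> + yk; have -> : (h - k) y = 0 by rewrite fctE yk subrr.
by rewrite subr0 ltxx.
Qed.

End du_bois_reymond.

(** * Convolution and translates *)

Section convolution.
Variables (R : realType) (n : nat).
Local Notation V := 'rV[R]_n.
Local Notation leb := (lebesgue_rV R n).
Implicit Types (h : V -> R) (f phi : V -> R[i]) (s : seq 'I_n) (mu : V).

Definition conv f phi : V -> R[i] := fun x => cint leb (fun mu => phi mu * f (x - mu)).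

Lemma cintegrable_conv f phi x : is_schwartz f -> cintegrable leb phi ->
  cintegrable leb (fun mu => phi mu * f (x - mu)).
Proof.
move=> sf ip; have [B fB] := schwartz_bound sf.
have -> : (fun mu => phi mu * f (x - mu)) = (fun mu => f (x - mu) * phi mu).
  by apply/funext => mu; rewrite mulrC.
apply: (@cintegrableMl _ _ _ leb phi (fun mu => f (x - mu)) B) => //.
apply: (cmeasurable_comp (T' := V) (f := f) (h := fun mu => x - mu)).
  have -> : (fun mu => x - mu) = (fun mu : V => (-1) *: mu + x).
    by apply/funext => mu; rewrite scaleN1r addrC.
  exact: measurable_affine_rV.
exact/csmooth_cmeasurable/sf.1.
Qed.

Section fourier.
Variable sg : R.
Hypothesis sg2 : sg ^+ 2 = 1.

(** Writing out the transform of phi and exchanging the integrals leaves, for each y, the inversion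
    formula for f at x - y. *)
Lemma fourier_product f phi x : is_schwartz f -> is_schwartz phi ->
  fourier_sg (- sg) (fun xi => fourier_sg sg f xi * fourier_sg sg phi xi) x =
  ((2 * pi) ^+ n)%:C * conv f phi x.
Proof.
move=> sf sphi; have sF := schwartz_fourier sg2 sf.
have pi := schwartz_integrable sphi; have Fi := schwartz_integrable sF.
have mp := cintegrable_cmeasurable pi; have mF := cintegrable_cmeasurable Fi.
pose G (p : V * V) := phi p.1 * expi (sg * dotp p.2 p.1) * expi (- sg * dotp x p.2) *
  fourier_sg sg f p.2.
have mG : cmeasurable G.
  apply: cmeasurableM; last exact: (cmeasurable_comp measurable_snd mF).
  apply: cmeasurableM; last first.
    exact: (cmeasurable_comp measurable_snd (cmeasurable_expi_dotp (- sg) x)).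
  apply: cmeasurableM; first exact: (cmeasurable_comp measurable_fst mp).
  apply: cmeasurable_expi; apply: measurable_funM => //.
  apply: measurable_sum => i; apply: measurable_funM.
    exact: (measurableT_comp (measurable_rV_coord i) measurable_snd).
  exact: (measurableT_comp (measurable_rV_coord i) measurable_fst).
have nG y xi : norm1 (G (y, xi)) <= (4 * norm1 (phi y)) * norm1 (fourier_sg sg f xi).
  rewrite (le_trans (ler_norm1M _ _))// ler_wpM2r ?norm1_ge0//.
  rewrite (le_trans (ler_norm1M _ _))// (@le_trans _ _ ((norm1 (phi y) * 2) * 2))//.
    rewrite ler_pM ?norm1_ge0 ?norm1_expi// (le_trans (ler_norm1M _ _))//.
    by rewrite ler_wpM2l ?norm1_ge0// norm1_expi.
  by rewrite le_eqVlt; apply/orP; left; apply/eqP; ring.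
have i4 := integrableRZ 4 (cintegrable_norm1 pi).
have Fub := cint_fubini mG i4 (cintegrable_norm1 Fi) nG.
transitivity (cint leb (fun xi => cint leb (fun y => G (y, xi)))).
  apply: eq_cint => xi; rewrite [fourier_sg sg phi xi]/fourier_sg mulrAC -cintZ.
    by apply: eq_cint => y; rewrite /G /=; ring.
  exact: cintegrable_fourier.
rewrite -Fub /conv.
rewrite -cintZ; last exact: cintegrable_conv.
 apply: eq_cint => y.
have := fourier_inversion sg2 (x - y) sf; rewrite mulrCA => <-.
rewrite -cintZ; last exact: cintegrable_fourier.
apply: eq_cint => xi; rewrite /G/= dotpDl dotpNl mulrDr expiD.
by rewrite (dotpC xi y) mulrNN; ring.
Qed.

Lemma convE f phi : is_schwartz f -> is_schwartz phi -> conv f phi =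
  ((2 * pi) ^- n)%:C *: fourier_sg (- sg) (fun xi => fourier_sg sg f xi * fourier_sg sg phi xi).
Proof.
move=> sf sphi; apply/funext => x.
transitivity (((2 * pi) ^- n)%:C *
  fourier_sg (- sg) (fun xi => fourier_sg sg f xi * fourier_sg sg phi xi) x) => //.
rewrite fourier_product// mulrA -rmorphM/= mulVf ?mul1r//.
by rewrite expf_neq0// mulf_neq0// gt_eqF// pi_gt0.
Qed.

Lemma schwartz_fourier_product f phi : is_schwartz f -> is_schwartz phi ->
  is_schwartz (fun xi => fourier_sg sg f xi * fourier_sg sg phi xi).
Proof.
move=> /(schwartz_fourier sg2) sf /(schwartz_fourier sg2) sphi.
exact: operator_schwartz (schwartz_operatorM sf) sphi.
Qed.

Lemma schwartz_conv f phi : is_schwartz f -> is_schwartz phi -> is_schwartz (conv f phi).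
Proof.
move=> sf sphi; rewrite convE//; apply: is_schwartzZ.
by apply: schwartz_fourier; rewrite ?sqrrN//; exact: schwartz_fourier_product.
Qed.

(** [convE] exhibits the convolution as a transform of the opposite sign, which [fourier_inversion]
    undoes. *)
Lemma fourier_conv f phi : is_schwartz f -> is_schwartz phi ->
  fourier_sg sg (conv f phi) = fun xi => fourier_sg sg f xi * fourier_sg sg phi xi.
Proof.
move=> sf sphi; have sG := schwartz_fourier_product sf sphi.
have sN : (- sg) ^+ 2 = 1 by rewrite sqrrN.
have sFG := schwartz_fourier sN sG.
apply/funext => xi; have H := fourier_inversion sN xi sG; rewrite opprK in H.
rewrite (convE sf sphi) (fourier_sgZ _ _ (schwartz_integrable sFG)).
have scE (c : R[i]) (g : V -> R[i]) x : (c *: g) x = c * g x by [].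
rewrite scE H mulrA -rmorphM/= mulVf ?mul1r//.
by rewrite expf_neq0// mulf_neq0// gt_eqF// pi_gt0.
Qed.

End fourier.

(** Read on the Fourier side through [convE], the derivative multiplies the transform of f by a
    coordinate, hence falls on f. *)
Lemma cpderiv_conv s f phi : is_schwartz f -> is_schwartz phi ->
  cpderiv s (conv f phi) = conv (cpderiv s f) phi /\ is_schwartz (cpderiv s f).
Proof.
have one2 : (1 : R) ^+ 2 = 1 by rewrite expr1n.
have one2N : (- (1 : R)) ^+ 2 = 1 by rewrite sqrrN expr1n.
move=> sf sphi; elim: s => [|i s [IH ss]]; first by rewrite !cpderiv_nil.
have sD : is_schwartz (cpderiv (i :: s) f).
  by rewrite cpderiv_cons; exact: operator_schwartz (operator_D R i) ss.
split => //; rewrite cpderiv_cons IH (convE one2 ss sphi) (convE one2 sD sphi).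
have sG := schwartz_fourier_product one2 ss sphi.
have sFG := schwartz_fourier one2N sG.
rewrite (cpderivZ [:: i] _ sFG.1) (cpderiv_fourier (- 1) i sG).
congr (_ *: fourier_sg _ _); apply/funext => xi.
rewrite cpderiv_cons /mul_icoord fourier_D// mulrA; congr (_ * _ * _).
by apply: complexP => /=; rewrite ?oppr0// mulN1r mul1r.
Qed.


Definition translate mu f : V -> R[i] := fun x => f (x - mu).

Lemma shift_translate h mu x (v : V) : (fun t : R => t^-1 *:
    (((fun y => h (y - mu)) \o shift x) (t *: v) - h (x - mu))) =
  (fun t : R => t^-1 *: ((h \o shift (x - mu)) (t *: v) - h (x - mu))).
Proof. by apply/funext => t /=; rewrite !addrA. Qed.

Lemma pderiv_translate s mu h : pderiv s (fun x => h (x - mu)) = fun x => pderiv s h (x - mu).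
Proof.
elim: s => //= i s ->; apply/funext => x; by rewrite /derive shift_translate.
Qed.

Lemma cpderiv_translate s mu f : cpderiv s (translate mu f) = translate mu (cpderiv s f).
Proof.
apply/funext => x; rewrite /translate /cpderiv.
by rewrite (pderiv_translate s mu (@complex.Re R \o f)) (pderiv_translate s mu (@complex.Im
  R \o f)).
Qed.

Lemma smooth_translate mu h : smooth h -> smooth (fun x => h (x - mu)).
Proof.
move=> sh s; rewrite pderiv_translate; split=> [x|i x].
  apply: (@continuous_comp _ _ _ (fun x : V => x - mu)); last exact: (sh s).1.
  by apply: continuousB; [exact: cvg_id|exact: cst_continuous].
have := (sh s).2 i (x - mu); by rewrite /derivable shift_translate.
Qed.

Lemma csmooth_translate mu f : csmooth f -> csmooth (translate mu f).
Proof. by move=> [f1 f2]; split; [exact: smooth_translate f1|exact: smooth_translate f2]. Qed.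

Lemma ler_weight_exp_shift k x y : weight x ^+ k <= (2 ^+ n * weight (x - y)) ^+ k * weight
  (y : V) ^+ k.
Proof.
rewrite -exprMn lerXn2r ?nnegrE ?mulr_ge0 ?weight_ge0 ?exprn_ge0//.
by have := ler_weight_shift (x - y) y; rewrite subrK.
Qed.

Lemma schwartz_translate mu f : is_schwartz f -> is_schwartz (translate mu f).
Proof.
move=> /is_schwartzP[sf fb]; apply/is_schwartzP; split; first exact: csmooth_translate.
move=> k; have [e fe] := fb k; exists ((2 ^+ n * weight mu) ^+ k * e) => s sk x.
rewrite cpderiv_translate /translate.
apply: (@le_trans _ _ ((2 ^+ n * weight mu) ^+ k * (weight (x - mu) ^+ k * norm1 (cpderiv s
  f (x - mu))))).
  rewrite [leRHS]mulrA ler_wpM2r ?norm1_ge0//.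
  by rewrite (le_trans (ler_weight_exp_shift k x mu))// !exprMn mulrAC.
by rewrite ler_wpM2l ?fe// exprn_ge0// mulr_ge0 ?exprn_ge0// weight_ge0.
Qed.

Lemma cube_weight M : exists K : R, 0 <= K /\ forall x : V, cube M x -> weight x <= K.
Proof.
exists (\prod_(i < n) (1 + M ^+ 2)); split.
  by apply: prodr_ge0 => i _; rewrite addr_ge0// sqr_ge0.
move=> x xM; apply: ler_prod => i _; rewrite addr_ge0 ?sqr_ge0//= lerD2l.
by have := xM i; rewrite in_itv/= -ler_norml -[x 0 i ^+ 2]real_normK ?num_real// => xi; 
  rewrite lerXn2r ?nnegrE// (le_trans _ xi).
Qed.

(** The mean value inequality for each derivative of f on the segment between x - nu and x - mu. The
    decay, known at a point z near the segment, is moved to x by [ler_weight_exp_shift]. *)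
Lemma translate_lipschitz f k M : is_schwartz f -> exists L : R, 0 <= L /\
  forall mu nu, cube M mu -> cube M nu ->
    bounded_by k (L * \sum_j `|mu 0 j - nu 0 j|) (translate mu f - translate nu f).
Proof.
move=> /is_schwartzP[sf fb]; have [e fe] := fb k.+1; have e0 := bounded_by_ge0 fe.
(* x - z differs from nu by at most |mu - nu| in each coordinate, hence is at most M + 2 M. *)
have [K [K0 hK]] := cube_weight (3 * M).
exists (2 * ((2 ^+ n * K) ^+ k * e)); split.
  by rewrite !mulr_ge0// exprn_ge0// mulr_ge0// exprn_ge0.
move=> mu nu hmu hnu s sk x.
have -> : cpderiv s (translate mu f - translate nu f) x =
    cpderiv s f (x - mu) - cpderiv s f (x - nu).
  rewrite -scaleN1r cpderivD; first last.
  - by apply: csmoothZ; exact: csmooth_translate.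
  - exact: csmooth_translate.
  rewrite cpderivZ; last exact: csmooth_translate.
  rewrite scaleN1r !cpderiv_translate.
  by [].
have w0 : 0 < weight x ^+ k by rewrite exprn_gt0// weight_gt0.
pose B := (2 ^+ n * K) ^+ k * e / weight x ^+ k.
have L : norm1 (cpderiv s f (x - mu) - cpderiv s f (x - nu)) <=
    2 * B * \sum_j `|(x - mu) 0 j - (x - nu) 0 j|.
  apply: lipschitz_norm1; first exact/csmooth_cderivable/csmooth_cpderiv.
  move=> i z hz; rewrite -cpderiv_cons /B ler_pdivlMr// mulrC.
  have zc : weight (x - z) <= K.
    apply: hK => j; have := hz j; have := hmu j; have := hnu j.
    rewrite !in_itv/= !mxE -!ler_norml => h1 h2 h3.
    have -> : x 0 j - z 0 j = nu 0 j - (z 0 j - (x 0 j - nu 0 j)) by ring.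
    rewrite (le_trans (ler_normB _ _))//.
    have -> : 3 * M = M + (M + M) by ring.
    rewrite lerD// (le_trans h3)//.
    have -> : x 0 j - mu 0 j - (x 0 j - nu 0 j) = nu 0 j - mu 0 j by ring.
    by rewrite (le_trans (ler_normB _ _))// lerD.
  have sk1 : (size (i :: s) <= k.+1)%N by [].
  apply: (@le_trans _ _ ((2 ^+ n * K) ^+ k * (weight z ^+ k * norm1 (cpderiv (i :: s) f z)))).
    rewrite [leRHS]mulrA ler_wpM2r ?norm1_ge0//.
    apply: (le_trans (ler_weight_exp_shift k x z)).
    rewrite !exprMn ler_wpM2r ?exprn_ge0 ?weight_ge0// ler_wpM2l ?exprn_ge0//.
    by rewrite lerXn2r ?nnegrE ?weight_ge0.
  rewrite ler_wpM2l ?exprn_ge0 ?mulr_ge0 ?exprn_ge0//.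
  apply: le_trans (fe _ sk1 z); rewrite ler_wpM2r ?norm1_ge0//.
  exact: ler_weight_exp.
apply: (@le_trans _ _ (weight x ^+ k * (2 * B * \sum_j `|(x - mu) 0 j - (x - nu) 0 j|))).
  by rewrite ler_wpM2l// ltW.
have -> : weight x ^+ k * (2 * B * \sum_j `|(x - mu) 0 j - (x - nu) 0 j|) =
    2 * ((2 ^+ n * K) ^+ k * e) * \sum_j `|(x - mu) 0 j - (x - nu) 0 j|.
  by rewrite /B; field; exact: lt0r_neq0.
rewrite le_eqVlt; apply/orP; left; apply/eqP; congr (_ * _); apply: eq_bigr => j _.
by rewrite !mxE distrC; congr (`|_|); ring.
Qed.

(** * Pairing a functional with the translates of a Schwartz function *)

Section pairing.
Variables (f : V -> R[i]) (sf : is_schwartz f).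
Let T mu : schwartz R n := to_schwartz (translate mu f).

Let TE mu : T mu = translate mu f :> (V -> R[i]).
Proof. exact/to_schwartzE/schwartz_translate. Qed.

Section functional.
Variables (l : schwartz R n -> R[i]^o) (k : nat) (C : R).
Hypotheses (ll : linear l) (C0 : 0 <= C).
Hypothesis lC : forall (psi : schwartz R n) e, bounded_by k e psi -> norm1 (l psi) <= C * e.

Lemma pairing_lipschitz M L mu nu : (forall mu nu, cube M mu -> cube M nu ->
    bounded_by k (L * \sum_j `|mu 0 j - nu 0 j|) (translate mu f - translate nu f)) ->
  cube M mu -> cube M nu ->
  norm1 (l (T mu) - l (T nu)) <= C * L * \sum_j `|mu 0 j - nu 0 j|.
Proof.
move=> hL hmu hnu; rewrite -(linB ll) -mulrA; apply: lC.
have := hL _ _ hmu hnu; rewrite -!TE; exact.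
Qed.

Lemma pairing_continuous (P : R[i] -> R) : (forall z w, P (z - w) = P z - P w) ->
  (forall z, `|P z| <= norm1 z) -> continuous (fun mu => P (l (T mu))).
Proof.
move=> PB P1 x.
apply: (@cvgrPdist_lt _ _ _ (nbhs x) (nbhs_filter x) _ (P (l (T x)))).2 => e e0.
pose M := \sum_j `|x 0 j| + 1.
have xM j : `|x 0 j| + 1 <= M by rewrite lerD2r (bigD1 j)//= lerDl sumr_ge0.
have [L [L0 hL]] := translate_lipschitz k M sf.
have d0 : 0 < e / (C * L + 1) by rewrite divr_gt0// ltr_wpDl// mulr_ge0.
have N1 := coord_near x ltr01; have N2 := sum_dist_near x d0.
have := @filterI _ (nbhs x) (nbhs_filter x) _ _ N1 N2; apply: filterS => y [y1 y2].
rewrite -PB (le_lt_trans (P1 _))// -norm1N opprB.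
have cx : cube M x by move=> j; rewrite in_itv/= -ler_norml (le_trans _ (xM j))// lerDl.
have cy : cube M y.
  move=> j; rewrite in_itv/= -ler_norml (le_trans _ (xM j))//.
  have -> : (y : V) 0 j = x 0 j + ((y : V) 0 j - x 0 j) by rewrite addrC subrK.
  by rewrite (le_trans (ler_normD _ _))// lerD2l ltW// y1.
rewrite (le_lt_trans (pairing_lipschitz hL cy cx))//.
apply: (@le_lt_trans _ _ ((C * L + 1) * \sum_j `|(y : V) 0 j - x 0 j|)).
  by rewrite ler_wpM2r ?sumr_ge0// lerDl.
by rewrite mulrC -ltr_pdivlMr// ltr_wpDl// mulr_ge0.
Qed.

Lemma pairing_continuous_Re : continuous (fun mu => complex.Re (l (T mu))).
Proof. by apply: pairing_continuous => [z w|z]; [rewrite cReD cReN|exact: ler_Re_norm1]. Qed.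

Lemma pairing_continuous_Im : continuous (fun mu => complex.Im (l (T mu))).
Proof. by apply: pairing_continuous => [z w|z]; [rewrite cImD cImN|exact: ler_Im_norm1]. Qed.

Lemma cmeasurable_pairing : cmeasurable (fun mu => l (T mu)).
Proof.
by split; apply: continuous_measurable_rV;
  [exact: pairing_continuous_Re|exact: pairing_continuous_Im].
Qed.

Lemma pairing_bounded M : exists B, forall mu, cube M mu -> norm1 (l (T mu)) <= B.
Proof.
have [B1 h1] := continuous_cube_bounded M pairing_continuous_Re.
have [B2 h2] := continuous_cube_bounded M pairing_continuous_Im.
by exists (B1 + B2) => mu hmu; rewrite lerD// ?h1 ?h2.
Qed.

Variables (phi : V -> R[i]) (M : R).
Hypotheses (iphi : cintegrable leb phi) (phiM : supported_in M phi).

Lemma cintegrable_pairing : cintegrable leb (fun mu => phi mu * l (T mu)).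
Proof.
have [B hB] := pairing_bounded M.
have mphi := cintegrable_cmeasurable iphi.
apply: (cintegrable_le _ (integrableRZ B (cintegrable_norm1 iphi))) => [|mu].
  exact: cmeasurableM mphi cmeasurable_pairing.
have [->|p0] := eqVneq (phi mu) 0; first by rewrite mul0r norm1_0 mulr0.
rewrite mulrC (le_trans (ler_norm1M _ _))// ler_wpM2r ?norm1_ge0//.
by apply: hB; exact: supported_cube phiM p0.
Qed.

Definition grid_mass m (q : {ffun 'I_n -> 'I_(2 * m.+1 * m.+1).+1}) : R[i] :=
  cint leb (fun mu => phi mu * (if @grid_cell R n m mu == q then 1 else 0)).

(** Depends on f and phi but not on the functional [l]: the same sums serve for every functional
    bounded by a seminorm. *)
Definition riemann_sum (m : nat) : schwartz R n :=
  \sum_q @grid_mass m q *: T (grid_point R q).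

Let cmeasurable_cell m q : cmeasurable (fun mu : V => if grid_cell m mu == q then 1 else 0 : R[i]).
Proof.
have -> : (fun mu : V => if grid_cell m mu == q then 1 else 0 : R[i]) =
    (fun mu => (\1_[set y | grid_cell m y = q] mu)%:C).
  apply/funext => mu; rewrite indicE; case: eqP => h; first by rewrite mem_set.
  by rewrite memNset.
by apply: cmeasurable_real; apply: measurable_indic; exact: measurable_grid_cell.
Qed.

Lemma pairing_riemann_sum m : l (riemann_sum m) =
  cint leb (fun mu => phi mu * l (T (grid_point R (grid_cell m mu)))).
Proof.
rewrite /riemann_sum (lin_sum ll).
have ci q : cintegrable leb (fun mu => phi mu * (if grid_cell m mu == q then 1 else 0)).
  have -> : (fun mu => phi mu * (if grid_cell m mu == q then 1 else 0)) =
      (fun mu => (if grid_cell m mu == q then 1 else 0) * phi mu).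
    by apply/funext => mu; rewrite mulrC.
  apply: (cintegrableMl (B := 1) (cmeasurable_cell q)) iphi => mu.
  by case: ifP => _; rewrite ?norm1_0// norm1_real normr1.
transitivity (\sum_q cint leb (fun mu => l (T (grid_point R q)) *
    (phi mu * (if @grid_cell R n m mu == q then 1 else 0)))).
  by apply: eq_bigr => q _; rewrite (linZ ll) cintZ// mulrC.
rewrite -cint_sum; last by move=> q; exact: cintegrableZ.
apply: eq_cint => mu; rewrite -(grid_sum m (fun p => l (T p) : R[i])) mulr_sumr.
by apply: eq_bigr => q _; case: ifP => _; rewrite ?mulr1 ?mulr0 ?mulr0// mulrC.
Qed.

(** On the support of phi the grid point is within 1/(m+1) of mu in each coordinate. The cube is
    enlarged by 1 so that it contains the grid point too. *)
Lemma riemann_sum_error m L : 0 <= L -> (forall mu nu, cube (M + 1) mu -> cube (M + 1) nu ->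
    bounded_by k (L * \sum_j `|mu 0 j - nu 0 j|) (translate mu f - translate nu f)) ->
  M < m.+1%:R ->
  norm1 (l (riemann_sum m) - cint leb (fun mu => phi mu * l (T mu))) <=
  C * (L * (n%:R / m.+1%:R) * (\int[leb]_mu norm1 (phi mu))%R).
Proof.
move=> L0 hL mM; rewrite pairing_riemann_sum.
pose p mu := grid_point R (grid_cell m mu).
have mphi := cintegrable_cmeasurable iphi.
have i1 : cintegrable leb (fun mu => phi mu * l (T (p mu))).
  pose B := \sum_q norm1 (l (T (@grid_point R n m q))).
  have mg : cmeasurable (fun mu => l (T (p mu))).
    by split; [exact: (measurable_grid m (fun mu => complex.Re (l (T mu))))|
               exact: (measurable_grid m (fun mu => complex.Im (l (T mu))))].
  have -> : (fun mu => phi mu * l (T (p mu))) = (fun mu => l (T (p mu)) * phi mu).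
    by apply/funext => mu; rewrite mulrC.
  apply: (cintegrableMl (B := B) mg) iphi => mu.
  rewrite /B (bigD1 (grid_cell m mu))//= lerDl.
  by apply: sumr_ge0 => q _; exact: norm1_ge0.
rewrite -(cintB i1 cintegrable_pairing).
pose B := C * (L * (n%:R / m.+1%:R)).
have -> : C * (L * (n%:R / m.+1%:R) * (\int[leb]_mu norm1 (phi mu))%R) =
    (\int[leb]_mu (B * norm1 (phi mu)))%R.
  rewrite RintegralZl//; last exact: cintegrable_norm1.
  by rewrite /B; ring.
apply: norm1_cint_le.
- exact: cmeasurableB (cintegrable_cmeasurable i1) (cintegrable_cmeasurable cintegrable_pairing).
- exact: integrableRZ (cintegrable_norm1 iphi).
move=> mu; rewrite -mulrBr.
have [->|p0] := eqVneq (phi mu) 0; first by rewrite mul0r norm1_0 mulr0.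
have hmu := supported_cube phiM p0.
have hM j : `|(mu : V) 0 j| <= M by have := hmu j; rewrite in_itv/= -ler_norml.
have hd := @grid_dist R n m mu (fun j => le_lt_trans (hM j) mM).
have h1 : m.+1%:R^-1 <= 1 :> R by rewrite invf_le1// ler1n.
have c1 : cube (M + 1) mu.
  by move=> j; rewrite in_itv/= -ler_norml (le_trans (hM j))// lerDl.
have c2 : cube (M + 1) (p mu).
  move=> j; rewrite in_itv/= -ler_norml.
  have -> : p mu 0 j = mu 0 j - (mu 0 j - p mu 0 j) by ring.
  by rewrite (le_trans (ler_normB _ _))// lerD// (le_trans (hd j)).
rewrite mulrC (le_trans (ler_norm1M _ _))// ler_wpM2r ?norm1_ge0//.
rewrite (le_trans (pairing_lipschitz hL c2 c1))// /B mulrA ler_wpM2l ?mulr_ge0//.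
have -> : n%:R / m.+1%:R = \sum_(j < n) m.+1%:R^-1 :> R.
  by rewrite sumr_const card_ord mulr_natl.
by apply: ler_sum => j _; rewrite distrC; exact: hd.
Qed.

End functional.

(* Pairing u with conv f phi may be done under the integral sign, since       *)
(* conv f phi is the limit, for every seminorm, of finite combinations of     *)
(* translates of f.                                                           *)
Lemma tempered_conv (u : schwartz R n -> R[i]^o) (phi : schwartz R n) : tempered u ->
  test_function phi ->
  cintegrable leb (fun mu => phi mu * u (T mu)) /\
  u (to_schwartz (conv f phi)) = cint leb (fun mu => phi mu * u (T mu)).
Proof.
move=> tu /test_supported[M phiM]; have [lu _] := tu.
have [k [C [C0 uC]]] := tempered_bound tu.
have sphi := schwartzP phi; have iphi := schwartz_integrable sphi.
split; first exact (cintegrable_pairing lu C0 uC iphi phiM).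
have one2 : (1 : R) ^+ 2 = 1 by rewrite expr1n.
have sc := schwartz_conv one2 sf sphi.
have [L [L0 hL]] := translate_lipschitz k (M + 1) sf.
pose I := (\int[leb]_mu norm1 (phi mu))%R.
have I0 : 0 <= I by apply: Rintegral_ge0 => mu _; exact: norm1_ge0.
apply/eqP; rewrite -subr_eq0; apply/eqP/norm1_eq_small => d d0.
pose K := 2 * (C * (L * n%:R * I)).
have [N _ hN] : \forall m \near \oo, K / d < m.+1%:R by exact: large_nat.
have [N' _ hN'] : \forall m \near \oo, M < m.+1%:R by exact: large_nat.
pose m := maxn N N'.
have mK : K / d < m.+1%:R by apply: hN; exact: leq_maxl.
have mM : M < m.+1%:R by apply: hN'; exact: leq_maxr.
have e1 := riemann_sum_error lu C0 uC iphi phiM L0 hL mM.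
have e2 : bounded_by k (L * (n%:R / m.+1%:R) * I) (riemann_sum phi m - to_schwartz (conv f phi)).
  move=> s sk x; have w0 : 0 < weight x ^+ k by rewrite exprn_gt0// weight_gt0.
  (* Evaluation of d^s at x is bounded with constant weight(x)^-k. Applying the error estimate to
     all these functionals shows that the sums converge to the convolution in the seminorm of index
     k. *)
  pose l (psi : schwartz R n) : R[i]^o := cpderiv s psi x.
  have ll : linear l.
    move=> c p q; have [sp _] := schwartzP p; have [sq _] := schwartzP q.
    have := congr1 (fun g => g x) (cpderivD s (csmoothZ c sp) sq).
    by rewrite (cpderivZ s c sp).
  have lb (psi : schwartz R n) e : bounded_by k e psi -> norm1 (l psi) <= (weight x ^+ k)^-1 * e.
    by move=> /(bounded_by_norm1 x sk); rewrite mulrC.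
  have wi0 : 0 <= (weight x ^+ k)^-1 by rewrite invr_ge0 ltW.
  have := riemann_sum_error ll wi0 lb iphi phiM L0 hL mM.
  rewrite ler_pdivlMl//.
  have -> : cint leb (fun mu => phi mu * l (T mu)) = l (to_schwartz (conv f phi)).
    rewrite /l to_schwartzE// (cpderiv_conv s sf sphi).1; apply: eq_cint => mu.
    by rewrite TE cpderiv_translate.
  have := linB ll (riemann_sum phi m) (to_schwartz (conv f phi)); rewrite /l => <-.
  exact.
have {}e2 := uC _ _ e2; rewrite (linB lu) in e2.
set a := u (riemann_sum phi m) in e1 e2; set b := u (to_schwartz _) in e2 *.
set c := cint _ _ in e1 *.
have -> : b - c = (a - c) - (a - b) by ring.
rewrite (le_trans (ler_norm1B _ _))// (le_trans (lerD e1 e2))//.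
have -> : C * (L * (n%:R / m.+1%:R) * I) + C * (L * (n%:R / m.+1%:R) * I) = K / m.+1%:R.
  rewrite /K; field; exact: lt0r_neq0.
by rewrite ler_pdivrMr// mulrC -ler_pdivrMr// ltW.
Qed.

End pairing.

End convolution.

(** * Deconvolution *)

Section deconvolution.
Variables (R : realType) (n : nat).
Local Notation V := 'rV[R]_n.
Local Notation leb := (lebesgue_rV R n).
Implicit Types (f g : V -> R[i]) (phi psi chi : schwartz R n) (u v : schwartz R n -> R[i]^o).

Let one2 : (1 : R) ^+ 2 = 1. Proof. by rewrite expr1n. Qed.
Let one2N : (- 1 : R) ^+ 2 = 1. Proof. by rewrite sqrrN expr1n. Qed.
Let c : R := (2 * pi) ^- n.
Let c0 : ((2 * pi) ^+ n : R) != 0.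
Proof. by rewrite expf_neq0// mulf_neq0// gt_eqF// pi_gt0. Qed.

Lemma fourierE : @fourier R n = fourier_sg (- 1).
Proof.
apply/funext => f; apply/funext => xi; rewrite /fourier cintegralE.
by apply: eq_cint => x; rewrite mulN1r.
Qed.

Lemma inv_fourierE f : inv_fourier f = c%:C *: fourier_sg 1 f.
Proof.
apply/funext => x; rewrite /inv_fourier cintegralE.
transitivity (c%:C * fourier_sg 1 f x) => //; congr (_ * _).
by apply: eq_cint => xi; rewrite mul1r dotpC.
Qed.

Lemma linear_fourier_sg sg : linear_on_schwartz (@fourier_sg R n sg).
Proof.
move=> a f g /schwartz_integrable fi /schwartz_integrable gi.
rewrite fourier_sgD ?fourier_sgZ//; exact: (cintegrableZ a fi).
Qed.

Lemma operator_inv_fourier : continuous_operator (@inv_fourier R n).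
Proof.
have -> : @inv_fourier R n = fun f => c%:C *: fourier_sg 1 f.
  by apply/funext => f; exact: inv_fourierE.
exact (operatorZ _ (operator_fourier n one2)).
Qed.

Lemma linear_inv_fourier : linear_on_schwartz (@inv_fourier R n).
Proof.
move=> a f g sf sg; rewrite !inv_fourierE linear_fourier_sg//.
by rewrite scalerDr !scalerA [_ * a]mulrC.
Qed.

Lemma schwartz_inv_fourier f : is_schwartz f -> is_schwartz (inv_fourier f).
Proof. exact: operator_schwartz operator_inv_fourier. Qed.

Lemma inv_fourierK f : is_schwartz f -> fourier (inv_fourier f) = f.
Proof.
move=> sf; have sF := schwartz_fourier one2 sf.
rewrite fourierE inv_fourierE (fourier_sgZ _ _ (schwartz_integrable sF)).
apply/funext => x; have H := fourier_inversion one2 x sf.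
have scE (a : R[i]) (g : V -> R[i]) y : (a *: g) y = a * g y by [].
by rewrite scE H mulrA -rmorphM/= mulVf// mul1r.
Qed.

Lemma tempered_inv_Fourier u : tempered u -> tempered (inv_Fourier u).
Proof. by move=> tu; exact: tempered_comp tu operator_inv_fourier linear_inv_fourier. Qed.

Lemma tempered_Fourier u : tempered u -> tempered (Fourier u).
Proof.
move=> tu; rewrite /Fourier fourierE.
exact: tempered_comp tu (operator_fourier n one2N) (@linear_fourier_sg _).
Qed.

Lemma linear_multiplication g : linear_on_schwartz (fun f x => g x * f x).
Proof.
move=> a f1 f2 _ _; apply/funext => x.
transitivity (g x * (a * f1 x + f2 x)) => //.
by rewrite mulrDr mulrCA.
Qed.

Section division.
Variable g : V -> R[i].
Hypotheses (sg : is_schwartz g) (g0 : forall xi, g xi != 0).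

Let schwartz_mul phi : is_schwartz (fun x => g x * phi x).
Proof. exact: operator_schwartz (schwartz_operatorM sg) (schwartzP phi). Qed.

Lemma test_function_mul phi (h : V -> R[i]) : is_schwartz (fun x => h x * phi x) ->
  test_function phi -> test_function (to_schwartz (fun x => h x * phi x)).
Proof.
move=> sh /test_supported[M pM]; apply: (@supported_test _ _ _ M) => x j xj.
by rewrite to_schwartzE// (pM x j xj) mulr0.
Qed.

(** Multiplying back by g cancels the inverse on test functions. Both sides are tempered in chi, so
    [test_dense] extends the equality to every Schwartz function. *)
Lemma quotientK u v : tempered u -> tempered v ->
  is_product (fun xi => (g xi)^-1) u v ->
  forall chi, v (to_schwartz (fun xi => g xi * chi xi)) = u chi.
Proof.
move=> tu tv uv chi; apply/eqP; rewrite -subr_eq0; apply/eqP.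
have tg := tempered_comp tv (schwartz_operatorM sg) (linear_multiplication g).
have := test_dense (tempered_combination 1 (-1) tg tu).
move=> /(_ _ chi); rewrite mul1r mulN1r; apply => phi tphi.
rewrite mul1r mulN1r uv; last exact: test_function_mul.
apply/eqP; rewrite subr_eq0; apply/eqP; congr u.
apply: eq_to_schwartz; rewrite to_schwartzE//; apply/funext => x.
by rewrite mulKf.
Qed.

(** The inverse of g may grow fast at infinity, but compact support confines the quotient. *)
Lemma schwartz_div phi : test_function phi -> is_schwartz (fun x => (g x)^-1 * phi x).
Proof.
move=> /test_supported[M pM].
apply: (@supported_schwartz _ _ M).
  exact (csmoothM (csmoothV g0 sg.1) (schwartzP phi).1).
by move=> x j xj; rewrite (pM x j xj) mulr0.
Qed.

End division.

Lemma fourier_opp f xi : fourier f (- xi) = fourier_sg 1 f xi.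
Proof.
rewrite /fourier cintegralE; apply: eq_cint => x.
by rewrite dotpNl opprK mul1r.
Qed.

(** The substitution of -x for x moves the reflection to the exponential, whose sign it reverses. *)
Lemma fourier_check (b : V -> R) : cintegrable leb (ofreal b) ->
  fourier (ofreal (check b)) = fourier_sg 1 (ofreal b).
Proof.
move=> ib; apply/funext => xi.
have m1 : -1 != 0 :> R by rewrite oppr_eq0 oner_neq0.
have [_ E] := cint_affine_rV 0 m1 (cintegrable_fourier 1 xi ib).
rewrite normrN1 expr1n invr1 mul1r in E; rewrite /fourier cintegralE.
transitivity (cint leb (fun x => ofreal b (-1 *: x + 0) * expi (1 * dotp xi (-1 *: x + 0)))) => //.
apply: eq_cint => x; rewrite addr0 scaleN1r /ofreal /check mul1r.
by rewrite (dotpC xi (- x)) dotpNl (dotpC x).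
Qed.

(** On the cube [weight] is at most [K], so that [|B| * K / weight] is an integrable majorant. *)
Lemma integrable_cube_continuous (h : V -> R) M : continuous h ->
  leb.-integrable (cube M) (EFin \o h).
Proof.
move=> ch; have mc := @measurable_cube R n M.
apply/(integrable_mkcond (mu := leb) (EFin \o h) mc); rewrite restrict_EFin.
have [B hB] := continuous_cube_bounded M ch; have [K [K0 hK]] := cube_weight n M.
apply: (integrableR_le _ (integrableRZ (`|B| * K) (@integrable_weightV R n))) => [|x].
  apply: (measurable_restrictT h mc).1.
  by apply: (@measurable_funS _ _ _ _ setT) => //; exact: continuous_measurable_rV.
rewrite patchE; case: ifPn => [|_]; last first.
  by rewrite normr0 !mulr_ge0// invr_ge0 weight_ge0.
rewrite inE => xM; rewrite -mulrA (le_trans (hB _ xM))// (le_trans (ler_norm _))//.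
by rewrite ler_peMr// -[X in X <= _](@mulfV _ (weight x)) ?gt_eqF ?weight_gt0//
  ler_wpM2r ?invr_ge0 ?weight_ge0// hK.
Qed.

Lemma supported_box_bump (e : R) (a b : V) : exists M, supported_in M (ofreal (box_bump e a b)).
Proof.
exists (\sum_j (`|a 0 j| + `|b 0 j|)) => x j xj.
have H : `|a 0 j| + `|b 0 j| < `|x 0 j|.
  by apply: le_lt_trans xj; rewrite (bigD1 j)//= lerDl sumr_ge0.
rewrite /ofreal (@box_bump_eq0 R n e a b x j)//.
have := ler_norm (b 0 j); have := ler_norm (- a 0 j); rewrite normrN.
have := normr_ge0 (b 0 j); have := normr_ge0 (a 0 j); move: H.
have [x0|x0] := leP 0 (x 0 j); first by rewrite (ger0_norm x0) => *; right; lra.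
by rewrite (ltr0_norm x0) => *; left; lra.
Qed.

Section density_function.
Variable f : V -> R[i].
Hypotheses (sf : is_schwartz f) (f0 : forall xi, fourier_sg 1 f xi != 0).
Let T mu : schwartz R n := to_schwartz (translate mu f).

Lemma inv_fourier_conv phi : inv_fourier (conv f phi) =
  fun x => fourier_sg 1 f x * inv_fourier phi x.
Proof.
rewrite !inv_fourierE (fourier_conv one2 sf (schwartzP phi)); apply/funext => x.
transitivity (c%:C * (fourier_sg 1 f x * fourier_sg 1 phi x)) => //.
rewrite mulrCA.
by [].
Qed.

(* Fourier transforms of the conv f phi are multiples of that of f, and each  *)
(* test function is such a multiple because f0 allows division.               *)
Lemma translates_total u : tempered u -> (forall mu, u (T mu) = 0) -> forall psi, u psi = 0.
Proof.
move=> tu u0.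
have sF := schwartz_fourier one2 sf.
have conv0 phi : test_function phi -> u (to_schwartz (conv f phi)) = 0.
  move=> tphi; rewrite (tempered_conv sf tu tphi).2.
  rewrite (eq_cint leb (g := fun=> 0)) ?cint0// => mu.
  by rewrite u0 mulr0.
pose a : R[i] := ((2 * pi) ^+ n)%:C.
have a0 : a != 0 by rewrite /a (inj_eq (@complexI R)).
have scE (b : R[i]) (g : V -> R[i]) y : (b *: g) y = b * g y by [].
pose W (h : V -> R[i]) := fourier_sg (- 1) (fun xi => fourier_sg 1 f xi * fourier_sg 1 h xi).
have cW : continuous_operator W.
  exact (operator_comp (operator_fourier n one2N)
    (operator_comp (schwartz_operatorM sF) (operator_fourier n one2))).
have lW : linear_on_schwartz W.
  move=> b g h sg sh; rewrite /W (linear_fourier_sg 1 b sg sh).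
  rewrite -(linear_fourier_sg (- 1) b (schwartz_fourier_product one2 sf sg)
    (schwartz_fourier_product one2 sf sh)).
  congr fourier_sg; apply: (linear_multiplication (fourier_sg 1 f));
    exact: schwartz_fourier.
(* W phi is (2 pi)^n times the convolution of f and phi, on which u is known to vanish for test phi;
   density gives all Schwartz phi. *)
have W0 : forall phi, u (to_schwartz (W phi)) = 0.
  apply: (test_dense (tempered_comp tu cW lW)) => phi tphi.
  have sphi := schwartzP phi; have sc := schwartz_conv one2 sf sphi.
  have -> : to_schwartz (W phi) = a *: to_schwartz (conv f phi).
    apply: eq_to_schwartz; apply/funext => x; rewrite /W fourier_product//.
    transitivity (a * (to_schwartz (conv f phi) : V -> R[i]) x) => //.
    by rewrite to_schwartzE.
  by rewrite (linZ tu.1) conv0// mulr0.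
(* For a test function psi take h = psi / F f, where F f is the transform of f. W maps the transform
   of h to (2 pi)^n times that of psi. *)
have F0 : forall psi, u (to_schwartz (fourier_sg (- 1) psi)) = 0.
  apply: (test_dense (tempered_comp tu (operator_fourier n one2N) (@linear_fourier_sg _))).
  move=> psi tpsi; have spsi := schwartzP psi.
  have sh := schwartz_div sF f0 tpsi.
  set h := (fun x => _) in sh.
  have sFh := schwartz_fourier one2N sh; have sFpsi := schwartz_fourier one2N spsi.
  have := W0 (to_schwartz (fourier_sg (- 1) h)); rewrite (to_schwartzE sFh).
  have -> : to_schwartz (W (fourier_sg (- 1) h)) = a *: to_schwartz (fourier_sg (- 1) psi).
    apply: eq_to_schwartz; transitivity (a *: fourier_sg (- 1) psi); last by rewrite -[in
      LHS](to_schwartzE sFpsi).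
    rewrite -(fourier_sgZ _ _ (schwartz_integrable spsi)); congr fourier_sg.
    apply/funext => xi; have := fourier_inversion one2N xi sh; rewrite opprK => ->.
    by rewrite scE mulrCA /h mulVKf.
  by rewrite (linZ tu.1) => /eqP; rewrite mulf_eq0 (negbTE a0) => /eqP.
(* By inversion, every Schwartz function is a multiple of a transform. *)
move=> psi; have spsi := schwartzP psi; have sFpsi := schwartz_fourier one2 spsi.
have := F0 (to_schwartz (fourier_sg 1 psi)); rewrite to_schwartzE//.
have -> : to_schwartz (fourier_sg (- 1) (fourier_sg 1 psi)) = a *: psi.
  by apply: eq_to_schwartz; apply/funext => x; rewrite (fourier_inversion one2 x spsi).
by rewrite (linZ tu.1) => /eqP; rewrite mulf_eq0 (negbTE a0) => /eqP.
Qed.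

(** With B the inverse transform of Q, the integral of phi(mu) B(T mu) is B(f conv phi), that is Q
    evaluated at the transform of f times the inverse transform of phi. Since Q is a quotient by the
    former, this is the transform of r at the latter, hence r at phi. *)
Lemma deconvolution_ae (r : V -> R) (rD Q : schwartz R n -> R[i]^o) :
  tempered rD -> is_function r rD -> tempered Q ->
  is_product (fun xi => (fourier_sg 1 f xi)^-1) (Fourier rD) Q ->
  {ae leb, forall mu, (r mu)%:C = inv_Fourier Q (T mu)}.
Proof.
move=> tr [[mr ir] rr] tQ rQ.
have sF := schwartz_fourier one2 sf; have tB := tempered_inv_Fourier tQ.
have [lB _] := tB; have [k [C [C0 hC]]] := tempered_bound tB.
have cR := pairing_continuous_Re sf lB C0 hC.
have cI := pairing_continuous_Im sf lB C0 hC.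
set K := fun mu => inv_Fourier Q (T mu).
have irc M : leb.-integrable (cube M) (EFin \o r) by apply: ir; exact: compact_cube.
have pairing phi : test_function phi -> cintegrable leb (fun mu => phi mu * K mu) /\
    cint leb (fun mu => phi mu * K mu) = cint leb (fun mu => (r mu)%:C * phi mu).
  move=> tphi; have [i1 <-] := tempered_conv sf tB tphi; split => //.
  have sphi := schwartzP phi; have si := schwartz_inv_fourier sphi.
  rewrite -cintegralE -rr// /inv_Fourier (to_schwartzE (schwartz_conv one2 sf sphi)).
  rewrite inv_fourier_conv.
  have := quotientK sF f0 (tempered_Fourier tr) tQ rQ (to_schwartz (inv_fourier phi)).
  rewrite to_schwartzE// => ->; rewrite /Fourier to_schwartzE//.
  by rewrite inv_fourierK// to_schwartzK.
have bump e a b : 0 < e ->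
    cint leb (fun mu => (box_bump e a b mu)%:C * K mu - (r mu)%:C * (box_bump e a b mu)%:C) = 0.
  move=> e0; have [M hM] := supported_box_bump e a b.
  have sb : is_schwartz (ofreal (box_bump e a b)).
    exact (supported_schwartz (csmooth_real (smooth_box_bump a b e0)) hM).
  have tb : test_function (to_schwartz (ofreal (box_bump e a b))).
    by apply: (@supported_test _ _ _ M); rewrite to_schwartzE.
  have [i1 E] := pairing _ tb; rewrite to_schwartzE// in i1 E.
  have i2 : cintegrable leb (fun mu => (r mu)%:C * ofreal (box_bump e a b) mu).
    have irM : integrableR leb (fun x => `|(r \_ (cube M)) x|).
      have := (integrable_mkcond (mu := leb) (EFin \o r) (@measurable_cube R n M)).1 (irc M).
      by rewrite restrict_EFin => /integrable_norm; exact.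
    apply: (cintegrable_le _ irM) => [|x].
      apply: cmeasurableM; first exact: cmeasurable_real.
      exact: csmooth_cmeasurable sb.1.
    rewrite norm1Z patchE; case: ifPn => xM.
      rewrite ler_piMr// /ofreal norm1_real ger0_norm ?box_bump_ge0//.
      exact: box_bump_le1.
    have -> : ofreal (box_bump e a b) x = 0; last by rewrite norm1_0 mulr0 normr0.
    apply/eqP; apply: contraNT xM => px; rewrite inE.
    exact: supported_cube hM px.
  by rewrite (cintB i1 i2) E subrr.
have H1 : {ae leb, forall mu, complex.Re (K mu) - r mu = 0}.
  apply: (du_bois_reymond (h := fun mu => complex.Re (K mu) - r mu)).
  - by apply: measurable_funB => //; exact: continuous_measurable_rV.
  - move=> M; have := integrableB (@measurable_cube R n M) (integrable_cube_continuous M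
    cR) (irc M).
    exact.
  move=> e a b e0; rewrite cint_real; have /(congr1 (@complex.Re R)) /= := bump e a b e0.
  move=> E0; congr (_%:C); rewrite -[RHS]E0; apply: eq_Rintegral => mu _.
  by rewrite cReD cReN !cReM /=; ring.
(* [r] is real, so the imaginary part of the pairing has zero integral against every bump. *)
have H2 : {ae leb, forall mu, complex.Im (K mu) = 0}.
  apply: (du_bois_reymond (h := fun mu => complex.Im (K mu))).
  - exact: continuous_measurable_rV.
  - by move=> M; exact: integrable_cube_continuous.
  move=> e a b e0; rewrite cint_real; have /(congr1 (@complex.Im R)) /= := bump e a b e0.
  move=> E0; congr (_%:C); rewrite -[RHS]E0; apply: eq_Rintegral => mu _.
  by rewrite cImD cImN !cImM /=; ring.
apply: filterS2 H1 H2 => mu h1 h2; apply: complexP => /=.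
  by apply/esym/eqP; rewrite -subr_eq0; apply/eqP.
by rewrite -[RHS]/(complex.Im (K mu)) h2.
Qed.

End density_function.
End deconvolution.

(** * Kullback-Leibler penalties *)

Section kullback_leibler.
Variables (R : realType) (n : nat).
Local Notation V := 'rV[R]_n.
Local Notation leb := (lebesgue_rV R n).
Implicit Types (b : V -> R) (mu : V).

Lemma integral_translate b mu : integrableR leb b ->
  (\int[leb]_x b (x - mu) = \int[leb]_x b x)%R.
Proof.
move=> ib; have [_] := integral_affine_rV (- mu) (oner_neq0 R) ib.
rewrite normr1 expr1n invr1 mul1r => <-.
by apply: eq_Rintegral => x _; rewrite scale1r.
Qed.

Lemma KL_exp_translate b mu (A : schwartz R n -> R[i]^o) : finite_entropy b ->
  KL_exp (fun x => b (x - mu)) A =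
  (- Ent b)%:C - A (to_schwartz (translate mu (ofreal b))).
Proof.
move=> eb; rewrite /KL_exp /Ent opprK.
by rewrite (integral_translate (b := fun x => ln (b x) * b x)).
Qed.

Lemma one_dist_translate b mu : is_density b -> is_schwartz (ofreal b) ->
  one_dist (to_schwartz (translate mu (ofreal b))) = 1.
Proof.
move=> [_ _ b1] sb; rewrite /one_dist to_schwartzE; last exact: schwartz_translate.
have [ib _] := schwartz_integrable sb.
rewrite cintegralE cint_real integral_translate//.
by rewrite /Rintegral b1.
Qed.

End kullback_leibler.

Theorem theorem1 (R : realType) (N : nat) (param : Type)
    (beta : 'rV[R]_N -> param -> 'rV[R]_N -> R)
    (r : param -> 'rV[R]_N -> R)
    (rD Q : param -> schwartz R N -> R[i]^o)
    (beta_density : forall mu nu,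
      is_density (beta mu nu) /\ has_mean (beta mu nu) mu)
    (beta_translation : forall mu nu theta,
      beta mu nu theta = beta 0 nu (theta - mu))
    (beta_regular : forall nu,
      finite_entropy (beta 0 nu) /\ is_schwartz (ofreal (beta 0 nu)))
    (beta_fourier_neq0 : forall nu xi, fourier (ofreal (beta 0 nu)) xi != 0)
    (r_tempered : forall nu, tempered (rD nu) /\ is_function (r nu) (rD nu))
    (quotient_tempered : forall nu, tempered (Q nu) /\
      is_product (fun xi => (fourier (ofreal (check (beta 0 nu))) xi)^-1)
        (Fourier (rD nu)) (Q nu)) :
  forall nu,
    (exists! A : schwartz R N -> R[i]^o, tempered A /\
      {ae lebesgue_rV R N, forall mu, (r nu mu)%:C = KL_exp (beta mu nu) A}) /\
    (forall A : schwartz R N -> R[i]^o, tempered A ->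
      {ae lebesgue_rV R N, forall mu, (r nu mu)%:C = KL_exp (beta mu nu) A} ->
      A = (- Ent (beta 0 nu))%:C *: @one_dist R N - inv_Fourier (Q nu) /\
      (forall mu, {for mu, continuous (r nu)} ->
        (r nu mu)%:C = KL_exp (beta mu nu) A)).
Proof.
move=> nu; have [entb sf] := beta_regular nu.
have [tr fr] := r_tempered nu; have [tQ pQ] := quotient_tempered nu.
set b := beta 0 nu in entb sf pQ *; pose f := ofreal b.
have [db _] := beta_density 0 nu.
have f0 xi : fourier_sg 1 f xi != 0 by rewrite -fourier_opp; exact: beta_fourier_neq0.
(* Restates the quotient with the transform of sign 1 of b itself, as in [deconvolution_ae]. *)
rewrite (fourier_check (schwartz_integrable sf)) in pQ.
pose T mu := to_schwartz (translate mu f).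
have bE mu : beta mu nu = fun x => b (x - mu).
  by apply/funext => x; exact: beta_translation.
have KLE A mu : KL_exp (beta mu nu) A = (- Ent b)%:C - A (T mu).
  by rewrite bE; exact: KL_exp_translate.
set A0 := _ - inv_Fourier (Q nu).
have tB := tempered_inv_Fourier tQ.
have tA0 : tempered A0.
  have := tempered_combination (- Ent b)%:C (-1) (@tempered_one R N) tB.
  congr tempered; apply/funext => phi.
  by rewrite mulN1r.
have KLA0 mu : KL_exp (beta mu nu) A0 = inv_Fourier (Q nu) (T mu).
  rewrite KLE.
  have -> : A0 (T mu) = (- Ent b)%:C * one_dist (T mu) - inv_Fourier (Q nu) (T mu) by [].
  by rewrite one_dist_translate// mulr1 opprB addrC subrK.
have rA0 : {ae lebesgue_rV R N, forall mu, (r nu mu)%:C = KL_exp (beta mu nu) A0}.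
  have := deconvolution_ae sf f0 tr fr tQ pQ.
  by apply: filterS => mu ->; rewrite KLA0.
have uniqA A : tempered A ->
    {ae lebesgue_rV R N, forall mu, (r nu mu)%:C = KL_exp (beta mu nu) A} -> A = A0.
  move=> tA rA; have tD := tempered_combination 1 (-1) tA tA0.
  have [lD _] := tD; have [k [C [C0 hC]]] := tempered_bound tD.
  set D := (fun phi => _) in tD lD hC.
  (* The entropy terms of the two solutions cancel. *)
  have D0 : {ae lebesgue_rV R N, forall mu, D (T mu) = 0}.
    apply: filterS2 rA rA0 => mu -> /eqP; rewrite !KLE => /eqP/addrI/oppr_inj E.
    by rewrite /D E mul1r mulN1r subrr.
  (* Both parts of mu |-> D(T mu) are continuous, so that vanishing almost everywhere becomes
     vanishing everywhere, as [translates_total] requires. *)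
  have DT mu : D (T mu) = 0.
    apply: complexP.
      apply: (ae_eq_continuity_point (h := fun mu => complex.Re (D (T mu))) (k := fun=> 0)).
      - exact: (pairing_continuous_Re sf lD C0 hC).
      - exact: cst_continuous.
      - by apply: filterS D0 => y ->.
    apply: (ae_eq_continuity_point (h := fun mu => complex.Im (D (T mu))) (k := fun=> 0)).
    - exact: (pairing_continuous_Im sf lD C0 hC).
    - exact: cst_continuous.
    - by apply: filterS D0 => y ->.
  apply/funext => psi; have := translates_total sf f0 tD DT psi.
  by rewrite /D mul1r mulN1r => /eqP; rewrite subr_eq0 => /eqP.
split.
  exists A0; split; first by split.
  by move=> A [tA rA]; rewrite (uniqA A tA rA).
move=> A tA rA; have -> := uniqA A tA rA; split => // mu cr.
have [lB _] := tB; have [k [C [C0 hC]]] := tempered_bound tB.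
rewrite KLA0; apply: complexP => /=.
  apply: (ae_eq_continuity_point (k := fun mu => complex.Re (inv_Fourier (Q nu) (T mu)))) => //.
    exact: (pairing_continuous_Re sf lB C0 hC).
  by apply: filterS rA0 => y; rewrite KLA0 => <-.
apply: (ae_eq_continuity_point (h := fun=> 0)
  (k := fun mu => complex.Im (inv_Fourier (Q nu) (T mu)))) => //.
- exact: cst_continuous.
- exact: (pairing_continuous_Im sf lB C0 hC).
- by apply: filterS rA0 => y; rewrite KLA0 => <-.
Qed.
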